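(* Let $n\ge2$, let $\psi:\mathbb{R}\to[0,\infty)$ be a smooth, even, compactly supported function with $\|\psi\|_{L^\infty}\le1$, and let $d\sigma_{loc}=\psi(\nu)\,d\sigma$ be the associated localized surface measure on $S=\{(\alpha,\lambda,\nu)\in\mathbb{N}_0^n\times\mathbb{R}^*\times\mathbb{R}:\nu=(2|\alpha|+n)|\lambda|\}$. If $1\le q\le2$, then there is a constant $C(q)$ such that $$\|\mathcal{R}_{S_{loc}}f\|_{L^2(S,d\sigma_{loc})}\le C(q)\,\|f\|_{L_t^1L_s^qL_x^2}$$ for all $f\in\mathcal{S}_{rad}(\mathbb{R}^{n+2})$, the set of all radial Schwartz class functions on $\mathbb{R}^{n+2}$.
   Context: Points of $\mathbb{R}^{n+2}$ are $(x,t,s)$ with $x\in\mathbb{R}^n$, $t,s\in\mathbb{R}$; $\mathbb{R}^*=\mathbb{R}\setminus\{0\}$. A function $f$ on $\mathbb{R}^{n+2}$ is called radial if $f(x,t,s)=f(|x|,t,s)$, i.e. it depends on $x\in\mathbb{R}^n$ only through $|x|$. Hermite functions: $h_k(x)=(2^k\sqrt{\pi}\,k!)^{-1/2}H_k(x)e^{-x^2/2}$ with $H_k(x)=(-1)^k e^{x^2}\frac{d^k}{dx^k}e^{-x^2}$; for $\alpha\in\mathbb{N}_0^n$, $\Phi_\alpha(x)=\prod_{j=1}^n h_{\alpha_j}(x_j)$, $|\alpha|=\sum_j\alpha_j$; for $\lambda\in\mathbb{R}^*$, $\Phi_\alpha^\lambda(x)=|\lambda|^{n/4}\Phi_\alpha(\sqrt{|\lambda|}\,x)$.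 Scaled Hermite-Fourier transform: $\hat f(\alpha,\lambda,\nu)=\int_{\mathbb{R}^n}\int_{\mathbb{R}}\int_{\mathbb{R}}e^{i\lambda t}e^{i\nu s}f(x,t,s)\Phi_\alpha^\lambda(x)\,ds\,dt\,dx$ for $(\alpha,\lambda,\nu)\in\mathbb{N}_0^n\times\mathbb{R}^*\times\mathbb{R}$. Measure: $\int_S\Theta\,d\sigma_{loc}=\sum_{\alpha\in\mathbb{N}_0^n}\int_{\mathbb{R}^*}\Theta(\alpha,\lambda,(2|\alpha|+n)|\lambda|)\,\psi((2|\alpha|+n)|\lambda|)\,d\lambda$. Restriction operator: $\mathcal{R}_{S_{loc}}f=\hat f|_S$. Mixed norm: $\|f\|_{L_t^1L_s^qL_x^2}=\int_{\mathbb{R}}\Big(\int_{\mathbb{R}}\Big(\int_{\mathbb{R}^n}|f(x,t,s)|^2\,dx\Big)^{q/2}ds\Big)^{1/q}dt$. The dimension $n$ and the cutoff $\psi$ are fixed; constants may depend on them. *)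

(* Defs.v *)
From HB Require Import structures.
From mathcomp Require Import all_boot all_order all_algebra.
From mathcomp Require Import all_classical all_reals all_analysis.
From mathcomp Require Import complex.

Set Implicit Arguments.
Unset Strict Implicit.
Unset Printing Implicit Defensive.
Import Order.TTheory GRing.Theory Num.Theory.
Import numFieldNormedType.Exports.
Local Open Scope classical_set_scope.
Local Open Scope ring_scope.

(* points (x, t, s) *)
Notation hspace R n := ('rV[R]_n * R * R)%type.
Notation multi_index n := {ffun 'I_n -> nat}.

Section smoothness.
Context {R : realType} {V : normedModType R}.
Implicit Types f : V -> R.

Fixpoint iter_derive f (vs : seq V) : V -> R :=
  if vs is v :: vs' then fun z => 'D_v (iter_derive f vs') z else f.

(* C^infinity on a finite-dimensional V: all iterated directional derivatives
   exist and are continuous.  Ranging over all directions rather than over a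
   basis changes nothing, since C^1 functions have 'D_v f linear in v. *)
Definition smooth f := forall vs : seq V,
  continuous (iter_derive f vs) /\
  (forall z v : V, derivable (iter_derive f vs) z v).

Definition schwartz f := smooth f /\
  forall (vs : seq V) (N : nat), exists M : R, forall z : V,
    (1 + `|z|) ^+ N * `|iter_derive f vs z| <= M.

Definition cschwartz (f : V -> R[i]) :=
  schwartz (fun z => complex.Re (f z)) /\ schwartz (fun z => complex.Im (f z)).

End smoothness.

Section euclidean.
Context {R : realType}.

(* The library norm `|x| on 'rV[R]_n is the sup norm. *)
Definition enorm n (x : 'rV[R]_n) : R := Num.sqrt (\sum_(j < n) x 0 j ^+ 2).

Definition radial n (f : hspace R n -> R[i]) :=
  forall (x y : 'rV[R]_n) (t s : R),
    enorm x = enorm y -> f (x, t, s) = f (y, t, s).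

End euclidean.

(* The library puts the product sigma-algebra on n.-tuple but none on 'rV_n;
   n-dimensional Lebesgue measure is therefore built on n-tuples. *)
Section lebesgue_cons.
Context {R : realType} (n : nat).
Variable mu : {sigma_finite_measure
  set (n.-tuple (measurableTypeR R)) -> \bar R}.
Local Open Scope ereal_scope.

Let cons_tup (p : measurableTypeR R * n.-tuple (measurableTypeR R)) :
  n.+1.-tuple (measurableTypeR R) := [the n.+1.-tuple _ of p.1 :: p.2].

Let uncons_tup (u : n.+1.-tuple (measurableTypeR R)) :
  measurableTypeR R * n.-tuple (measurableTypeR R) :=
  (tnth u ord0, [tuple of behead u]).

Let cons_tupK : cancel cons_tup uncons_tup.
Proof.
by move=> [x u]; rewrite /uncons_tup/=; congr (_, _); apply: val_inj.
Qed.

Let measurable_cons_tup : measurable_fun setT cons_tup.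
Proof. by apply: measurable_cons; [exact: measurable_fst|exact: measurable_snd]. Qed.

Let measurable_uncons_tup : measurable_fun setT uncons_tup.
Proof.
apply: measurable_fun_pair; first exact: measurable_tnth.
exact: measurable_behead.
Qed.

Definition lebesgue_cons : set (n.+1.-tuple (measurableTypeR R)) -> \bar R :=
  pushforward (lebesgue_measure \x mu) cons_tup.

Let lebesgue_cons0 : lebesgue_cons set0 = 0.
Proof. by rewrite /lebesgue_cons /pushforward preimage_set0 measure0. Qed.

Let lebesgue_cons_ge0 A : 0 <= lebesgue_cons A.
Proof. exact: measure_ge0. Qed.

Let lebesgue_cons_sigma_additive : semi_sigma_additive lebesgue_cons.
Proof.
have mpre A : measurable A -> measurable (cons_tup @^-1` A).
  by move=> mA; rewrite -[X in measurable X]setTI; exact: measurable_cons_tup.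
move=> F mF tF mUF; rewrite /lebesgue_cons /pushforward preimage_bigcup.
apply: measure_semi_sigma_additive.
- by move=> k; exact: mpre.
- apply/trivIsetP => /= i j _ _ ij; rewrite -preimage_setI.
  by move/trivIsetP : tF => /(_ _ _ _ _ ij) ->//; rewrite preimage_set0.
- by rewrite -preimage_bigcup; exact: mpre.
Qed.

HB.instance Definition _ := isMeasure.Build _ _ _ lebesgue_cons
  lebesgue_cons0 lebesgue_cons_ge0 lebesgue_cons_sigma_additive.

Let sigma_finite_lebesgue_cons : sigma_finite setT lebesgue_cons.
Proof.
have /sigma_finiteP[F [TF ndF Foo]] :=
  sigma_finiteT (@lebesgue_measure R : {sigma_finite_measure set _ -> \bar R}).
have /sigma_finiteP[G [TG ndG Goo]] := sigma_finiteT mu.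
exists (fun k => uncons_tup @^-1` (F k `*` G k)).
  rewrite -preimage_bigcup (_ : \bigcup_k _ = setT) ?preimage_setT//.
  rewrite -setXTT TF TG; apply/seteqP; split=> -[x y].
    by move=> [k _ []/= ? ?]; split; exists k.
  move=> [/= [k _ Fkx] [l _ Gly]]; exists (maxn k l) => //; split.
  - by move: x Fkx; exact/subsetPset/ndF/leq_maxl.
  - by move: y Gly; exact/subsetPset/ndG/leq_maxr.
move=> k; have [? ?] := Foo k; have [? ?] := Goo k; split.
  rewrite -[X in measurable X]setTI; apply: measurable_uncons_tup => //.
  exact: measurableX.
rewrite /lebesgue_cons /pushforward.
have -> : cons_tup @^-1` (uncons_tup @^-1` (F k `*` G k)) = F k `*` G k.
  rewrite -comp_preimage (_ : uncons_tup \o cons_tup = id) ?preimage_id//.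
  exact/funext/cons_tupK.
by rewrite product_measure1E// lte_mul_pinfty// ge0_fin_numE.
Qed.

HB.instance Definition _ :=
  Measure_isSigmaFinite.Build _ _ _ lebesgue_cons sigma_finite_lebesgue_cons.

End lebesgue_cons.

Fixpoint lebesgue_tuple {R : realType} (n : nat) :
    {sigma_finite_measure set (n.-tuple (measurableTypeR R)) -> \bar R} :=
  match n with
  | 0 => [the {sigma_finite_measure set _ -> \bar R} of
          \d_([tuple] : 0.-tuple (measurableTypeR R))]
  | n'.+1 => [the {sigma_finite_measure set _ -> \bar R} of
              lebesgue_cons (lebesgue_tuple n')]
  end.

Section integrals.
Context {R : realType}.

Definition tuple_row n (u : n.-tuple R) : 'rV[R]_n := \row_j tnth u j.

Definition Cintegral d (T : measurableType d) (mu : {measure set T -> \bar R})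
    (f : T -> R[i]) : R[i] :=
  (\int[mu]_z complex.Re (f z) +i* \int[mu]_z complex.Im (f z))%C.

Definition CintegralR (f : R -> R[i]) : R[i] := Cintegral lebesgue_measure f.

Definition CintegralRn n (f : 'rV[R]_n -> R[i]) : R[i] :=
  Cintegral (lebesgue_tuple n) (fun u => f (tuple_row u)).

Definition sqnorm (z : R[i]) : R := ComplexField.Normc.normc z ^+ 2.

End integrals.

Section hermite.
Context {R : realType}.

Definition hermite_poly (k : nat) (x : R) : R :=
  (-1) ^+ k * expR (x ^+ 2) * derive1n k (fun y : R => expR (- y ^+ 2)) x.

Definition hermite (k : nat) (x : R) : R :=
  (Num.sqrt (2 ^+ k * Num.sqrt pi * k`!%:R))^-1 *
  hermite_poly k x * expR (- x ^+ 2 / 2).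

Definition size_mi n (a : multi_index n) : nat := (\sum_(j < n) a j)%N.

Definition Phi n (a : multi_index n) (x : 'rV[R]_n) : R :=
  \prod_(j < n) hermite (a j) (x 0 j).

Definition Phi_scaled n (a : multi_index n) (lam : R) (x : 'rV[R]_n) : R :=
  `|lam| `^ (n%:R / 4) * Phi a (Num.sqrt `|lam| *: x).

Definition expi (theta : R) : R[i] := (cos theta +i* sin theta)%C.

(* Only used for lam != 0. *)
Definition hermite_fourier n (f : hspace R n -> R[i])
    (w : multi_index n * R * R) : R[i] :=
  let: (a, lam, nu) := w in
  CintegralRn (fun x => CintegralR (fun t => CintegralR (fun s =>
    expi (lam * t) * expi (nu * s) * f (x, t, s) * (Phi_scaled a lam x)%:C%C))).

Definition level n (a : multi_index n) (lam : R) : R :=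
  (2 * size_mi a + n)%N%:R * `|lam|.

Definition surface n : set (multi_index n * R * R) :=
  [set w | let: (a, lam, nu) := w in lam != 0 /\ nu = level a lam].

(* Integral of Theta over the surface against psi(nu) dsigma; meant for
   Theta >= 0, where the unconditional sum over multi-indices is the integral. *)
Definition surface_integral n (psi : R -> R)
    (Theta : multi_index n * R * R -> \bar R) : \bar R :=
  (\esum_(a in [set: multi_index n])
     \int[lebesgue_measure]_(lam in [set lam : R | lam != 0%R])
       (Theta (a, lam, level a lam) * (psi (level a lam))%:E))%E.

Definition restriction n (f : hspace R n -> R[i]) :
    multi_index n * R * R -> R[i] :=
  patch (fun=> 0) (@surface n) (hermite_fourier f).

Definition surface_L2norm n (psi : R -> R)
    (Theta : multi_index n * R * R -> R[i]) : \bar R :=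
  (surface_integral psi (fun w => (sqnorm (Theta w))%:E) `^ 2^-1)%E.

End hermite.

Definition mixed_norm {R : realType} n (q : R) (f : hspace R n -> R[i]) : \bar R :=
  (\int[lebesgue_measure]_t
    (\int[lebesgue_measure]_s
      (\int[lebesgue_tuple n]_u
        (sqnorm (f (tuple_row u, t, s)))%:E) `^ (q / 2)) `^ q^-1)%E.

(* Main.v *)
Require Import Defs.
From HB Require Import structures.
From mathcomp Require Import all_boot all_order all_algebra.
From mathcomp Require Import all_classical all_reals all_analysis.
From mathcomp Require Import complex measurable_realfun ring lra.
Set Implicit Arguments.
Unset Strict Implicit.
Unset Printing Implicit Defensive.
Import Order.TTheory GRing.Theory Num.Theory.
Import numFieldNormedType.Exports.
Local Open Scope classical_set_scope.
Local Open Scope ring_scope.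

(* With M_k = 2k + n, the change of variables lam = nu / M_|a| turns the square
   of the left-hand side into the integral over nu of
     psi(nu) sum_a |<g_nu, Phi_a^{nu/M_|a|}>|^2 / M_|a|,
   where g_nu(x) is the Fourier transform of f(x, t, .) at nu.
   - For fixed nu, the sum is at most C |g_nu|_2^2.  By duality this is a bound on
     |sum_a c_a Phi_a^{nu/M_|a|}|_2; the scales differ between levels k and l, and
     the inner products decay like (M_l / M_k)^{1/4}, because h_k^2 = O(k^{-1/2})
     inside half of its oscillating region and has tails controlled by its second
     moment.
   - For fixed t, psi(nu) <= P e^{-|nu|}, and the integral of e^{-|nu|} |g_nu|_2^2
     is a convolution form with kernel 2 / (1 + (s - s')^2), bounded on L^q for
     1 <= q <= 2.
   - The integral in t is treated by a Cauchy-Schwarz inequality with weight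
     w(t) = |f(., t, .)|_{L_s^q L_x^2} + e / (1 + t^2), and e tends to 0; this is
     Minkowski's inequality in disguise.
   Complex values are avoided by working with cosines, sines, real and imaginary
   parts separately. *)

(** The cutoff is made in one coordinate [u_j], not in the norm of [u], because it leaves the
    functions of one level exactly orthogonal: multi-indices of equal size that agree off [j] agree
    at [j]. The decay of Hermite functions must then come from that same coordinate, so a level is
    divided into [n] classes by the position of its largest entry, which carries at least a share
    [1/n] of [M_k]. The decay exponent 1/4 is used in Schur's test, where the terms are
    [M_l^(-3/4) M_k^(-1/4)] for [l <= k] and [M_k^(1/4) M_l^(-5/4)] beyond. Both sums over [l] are
    bounded in [k]; any positive exponent would do, but no decay at all would lose a logarithm. The
    weight [1/M_a] is the Jacobian of the substitution in [lam]. The majorant of [psi] is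
    exponential because its Fourier transform is explicit and nonnegative, bounded and integrable:
    absolute values may then enter the convolution form, and all [q] between 1 and 2 are treated
    together. In the [t] integral the weight must not depend on [a] or [lam]; its term in [e] makes
    it strictly positive, hence fit for division, and keeps it integrable. *)

Notation integ mu f := (mu.-integrable setT (EFin \o f)).

(** * Linearity, comparison and products for real-valued integrals *)

Section real_integrals.
Context d (T : measurableType d) (R : realType) (mu : {measure set T -> \bar R}).
Implicit Types (f g : T -> R) (k : R).

Lemma integ_measurable f : integ mu f -> measurable_fun setT f.
Proof. by move=> /integrableP[/measurable_EFinP]. Qed.

Lemma eq_integ f g : f =1 g -> integ mu f -> integ mu g.
Proof. by move=> fg; apply: eq_integrable => // x _ /=; rewrite fg. Qed.

Lemma integZl k f : integ mu f -> integ mu (fun x => k * f x).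
Proof. by move=> h; have := integrableZl measurableT k h; apply: eq_integrable. Qed.

Lemma integD f g : integ mu f -> integ mu g -> integ mu (fun x => f x + g x).
Proof. by move=> h h'; have := integrableD measurableT h h'; apply: eq_integrable. Qed.

Lemma integ_sum I (s : seq I) (P : pred I) (h : I -> T -> R) :
  (forall i, P i -> integ mu (h i)) -> integ mu (fun x => \sum_(i <- s | P i) h i x).
Proof.
move=> ih; have := @integrable_sum _ _ _ mu _ measurableT _ s P (fun i => EFin \o h i) ih.
by apply: eq_integrable => // x _ /=; rewrite -sumEFin.
Qed.

Lemma le_integ f g : measurable_fun setT f -> (forall x, `|f x| <= g x) ->
  integ mu g -> integ mu f.
Proof.
move=> mf fg; apply: le_integrable => //; first exact/measurable_EFinP.
by move=> x _ /=; rewrite lee_fin (le_trans (fg x))// ler_norm.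
Qed.

Lemma integ_norm f : integ mu f -> integ mu (fun x => `|f x|).
Proof. exact: integrable_norm. Qed.

Lemma integM f g : measurable_fun setT f -> measurable_fun setT g ->
  integ mu (fun x => f x ^+ 2) -> integ mu (fun x => g x ^+ 2) ->
  integ mu (fun x => f x * g x).
Proof.
move=> mf mg f2 g2; apply: le_integ (integD f2 g2); first exact: measurable_funM.
move=> x; rewrite normrM -(real_normK (num_real (f x))) -(real_normK (num_real (g x))).
have := sqr_ge0 (`|f x| - `|g x|); have := normr_ge0 (f x); have := normr_ge0 (g x).
nra.
Qed.

Lemma integ_indic (D : set T) f : measurable D -> integ mu f ->
  integ mu (fun x => \1_D x * f x).
Proof.
move=> mD fi; apply: le_integ (integ_norm fi).
  apply: measurable_funM; [exact: measurable_indic|exact: integ_measurable].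
move=> x; rewrite normrM indicE; case: (_ \in _); rewrite ?normr1 ?mul1r//.
by rewrite normr0 mul0r.
Qed.

Lemma RintZl k f : integ mu f -> \int[mu]_x (k * f x) = k * \int[mu]_x f x.
Proof. exact: RintegralZl. Qed.

Lemma RintD f g : integ mu f -> integ mu g ->
  \int[mu]_x (f x + g x) = \int[mu]_x f x + \int[mu]_x g x.
Proof. exact: RintegralD. Qed.

Lemma eq_Rint f g : f =1 g -> \int[mu]_x f x = \int[mu]_x g x.
Proof. by move=> fg; apply: eq_Rintegral => x _. Qed.

Lemma EFin_Rint f : integ mu f -> (\int[mu]_x (f x)%:E)%E = (\int[mu]_x f x)%:E.
Proof. by move=> fi; rewrite /Rintegral fineK//; exact: integrable_fin_num. Qed.

Lemma Rint_sum I (s : seq I) (P : pred I) (h : I -> T -> R) :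
  (forall i, integ mu (h i)) ->
  \int[mu]_x (\sum_(i <- s | P i) h i x) = \sum_(i <- s | P i) \int[mu]_x h i x.
Proof.
move=> ih; apply: EFin_inj; rewrite -EFin_Rint; last exact: integ_sum.
under eq_integral do rewrite -sumEFin.
rewrite (integral_sum measurableT ih) -sumEFin.
by apply: eq_bigr => i _; rewrite EFin_Rint.
Qed.

Lemma le_Rint f g : integ mu f -> integ mu g -> (forall x, f x <= g x) ->
  \int[mu]_x f x <= \int[mu]_x g x.
Proof. by move=> fi gi fg; apply: le_Rintegral. Qed.

Lemma Rint_ge0 f : (forall x, 0 <= f x) -> 0 <= \int[mu]_x f x.
Proof. by move=> f0; apply: Rintegral_ge0. Qed.

End real_integrals.

(** * Integrals on the line *)

Section real_line.
Context {R : realType}.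
Implicit Types (f F G : R -> R) (a c x : R).
Notation mu := (@lebesgue_measure R).

Let affine a b (x : measurableTypeR R) : measurableTypeR R := a * x + b.

Let measurable_affine a b : measurable_fun setT (affine a b).
Proof.
apply: measurable_funD; last exact: measurable_cst.
exact: measurable_realfun.mulrl_measurable.
Qed.

Let affine_lebesgue a b : {measure set (measurableTypeR R) -> \bar R} :=
  mscale (NngNum (normr_ge0 a))
   (measure_function_pushforward__canonical__measure_function_Measure mu (measurable_affine a b)).

(** Lebesgue measure is determined by its values on half-open intervals. The two signs of [a] differ
    in which end of the preimage is closed. *)
Let lebesgue_measure_affine a b (A : set R) : a != 0 -> measurable A ->
  mu A = affine_lebesgue a b A.
Proof.
move=> a0 mA; apply: lebesgue_measure_unique => // _ [[x y] _ <-]/=.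
rewrite /affine_lebesgue /mscale/= /pushforward /affine lebesgue_measure_itv/=.
have [a_lt0|a_gt0|a00] := ltgtP a 0; last by rewrite a00 eqxx in a0.
- transitivity (`|a|%:E * mu `[((y - b) / a)%R, ((x - b) / a)%R[)%E.
    rewrite lebesgue_measure_itv/= !lte_fin ltr_ndivrMr// divfK// ltrD2r.
    case: ifPn => xy; last by rewrite mule0.
    by rewrite ltr0_norm// -!EFinD -EFinM; congr EFin; field.
  congr (_ * mu _)%E; apply/seteqP; split => z/=; rewrite !in_itv/= => /andP[h1 h2]; apply/andP.
    by move: h1 h2; rewrite ler_ndivrMr// ltr_ndivlMr// ![z * a]mulrC ltrBlDr lerBrDr.
  by rewrite ler_ndivrMr// ltr_ndivlMr// ![z * a]mulrC ltrBlDr lerBrDr.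
- transitivity (`|a|%:E * mu `]((x - b) / a)%R, ((y - b) / a)%R])%E.
    rewrite lebesgue_measure_itv/= !lte_fin ltr_pdivrMr// divfK// ltrD2r.
    case: ifPn => xy; last by rewrite mule0.
    by rewrite gtr0_norm// -!EFinD -EFinM; congr EFin; field.
  congr (_ * mu _)%E; apply/seteqP; split => z/=; rewrite !in_itv/= => /andP[h1 h2]; apply/andP.
    by move: h1 h2; rewrite ltr_pdivrMr// ler_pdivlMr// ![z * a]mulrC ltrBlDr lerBrDr.
  by rewrite ltr_pdivrMr// ler_pdivlMr// ![z * a]mulrC ltrBlDr lerBrDr.
Qed.

Lemma ge0_integral_affine a b (f : measurableTypeR R -> \bar R) : a != 0 ->
  measurable_fun [set: measurableTypeR R] f -> (forall x, 0 <= f x)%E ->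
  (\int[mu]_x f x = `|a|%:E * \int[mu]_x f (a * x + b)%R)%E.
Proof.
move=> a0 mf f0.
rewrite (eq_measure_integral (affine_lebesgue a b)); last first.
  by move=> A mA _; exact: lebesgue_measure_affine.
rewrite ge0_integral_mscale//= (ge0_integral_pushforward (measurable_affine a b))//.
Qed.

Lemma ge0_integral_scale a (f : measurableTypeR R -> \bar R) : a != 0 ->
  measurable_fun [set: measurableTypeR R] f -> (forall x, 0 <= f x)%E ->
  (\int[mu]_x f x = `|a|%:E * \int[mu]_x f (a * x)%R)%E.
Proof.
move=> a0 mf f0; rewrite (ge0_integral_affine 0 a0)//; congr (_ * _)%E.
by apply: eq_integral => x _; rewrite addr0.
Qed.

Lemma integrable_scale a f : a != 0 -> mu.-integrable setT (EFin \o f) ->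
  mu.-integrable setT (EFin \o (fun x => f (a * x))).
Proof.
move=> a0 /integrableP[mf fi]; have mf' : measurable_fun setT f by apply/measurable_EFinP.
apply/integrableP; split.
  by apply/measurable_EFinP; apply: (measurableT_comp mf'); exact: measurable_realfun.mulrl_measurable.
move: fi; rewrite (ge0_integral_scale a0)//; last exact: measurableT_comp.
rewrite -lte_pdivlMl ?normr_gt0// => /lt_le_trans; apply.
by rewrite leey.
Qed.

Lemma Rintegral_scale a f : a != 0 -> mu.-integrable setT (EFin \o f) ->
  \int[mu]_x f x = `|a| * \int[mu]_x f (a * x).
Proof.
move=> a0 fi; have := fi => /integrableP[mf _].
have fia := integrable_scale a0 fi.
rewrite /Rintegral -[RHS]/(fine `|a|%:E * _) -fineM ?integrable_fin_num//.
congr fine; rewrite integralE [in RHS]integralE.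
pose fa := EFin \o (fun x => f (a * x)).
have Ep : (\int[mu]_x (EFin \o f)^\+ x = `|a|%:E * \int[mu]_x fa^\+ x)%E.
  rewrite (ge0_integral_scale a0 (measurable_funepos mf) (funepos_ge0 _)).
  by congr (_ * _)%E; apply: eq_integral => x _; rewrite !funeposE.
have En : (\int[mu]_x (EFin \o f)^\- x = `|a|%:E * \int[mu]_x fa^\- x)%E.
  rewrite (ge0_integral_scale a0 (measurable_funeneg mf) (funeneg_ge0 _)).
  by congr (_ * _)%E; apply: eq_integral => x _; rewrite !funenegE.
rewrite [X in (X - _)%E = _]Ep [X in (_ - X)%E = _]En -muleBr//.
by apply: integrable_add_def => //; exact: measurableT.
Qed.

Lemma continuous_inv1Dsqr : continuous (fun x : R => (1 + x ^+ 2)^-1).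
Proof.
move=> x; apply: cvgV; first by rewrite gt_eqF// ltr_wpDr// sqr_ge0.
by apply: cvgD; [exact: cvg_cst|exact: exprn_continuous].
Qed.

Lemma inv1Dsqr_ge0 x : 0 <= (1 + x ^+ 2)^-1.
Proof. by rewrite invr_ge0 addr_ge0// sqr_ge0. Qed.

Let integral_itv_inv1Dsqr : (\int[mu]_(x in `[0%R, +oo[) (1 + x ^+ 2)^-1%:E = (pi / 2)%:E)%E.
Proof.
rewrite (@ge0_continuous_FTC2y _ _ atan 0 (pi / 2)) ?atan0 ?sube0//.
- by move=> x _; exact: inv1Dsqr_ge0.
- by apply: continuous_subspaceT; exact: continuous_inv1Dsqr.
- exact: cvgy_atan.
- by rewrite -[X in _ --> X]atan0; apply: cvg_at_right_filter; exact: continuous_atan.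
- by move=> x _; rewrite derive1_atan.
Qed.

Let ge0_integral_even f : continuous f -> (forall x, 0 <= f x) -> (forall x, f (- x) = f x) ->
  (\int[mu]_x (f x)%:E = 2%:E * \int[mu]_(x in `[0%R, +oo[) (f x)%:E)%E.
Proof.
move=> cf f0 ef; rewrite ge0_symfun_integralT//; last by move=> x /=; rewrite ef.
by rewrite set_itvcy.
Qed.

Lemma integral_inv1Dsqr : (\int[mu]_x (1 + x ^+ 2)^-1%:E = pi%:E)%E.
Proof.
rewrite ge0_integral_even.
- by rewrite integral_itv_inv1Dsqr -EFinM mulrC divfK.
- exact: continuous_inv1Dsqr.
- exact: inv1Dsqr_ge0.
- by move=> x; rewrite sqrrN.
Qed.

Lemma integ_inv1Dsqr : integ mu (fun x => (1 + x ^+ 2)^-1).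
Proof.
apply/integrableP; split.
  by apply/measurable_EFinP; apply: continuous_measurable_fun; exact: continuous_inv1Dsqr.
under eq_integral do rewrite /= ger0_norm ?inv1Dsqr_ge0//.
by rewrite integral_inv1Dsqr ltry.
Qed.

Lemma integ_le_inv1Dsqr c f : measurable_fun setT f ->
  (forall x, `|f x| <= c / (1 + x ^+ 2)) -> integ mu f.
Proof. by move=> mf fc; apply: (@le_integ _ _ _ mu _ _ mf fc); exact/integZl/integ_inv1Dsqr. Qed.

Lemma cvg_le_inv1Dsqr f c : (forall x, 0 <= x -> `|f x| <= c / (1 + x ^+ 2)) ->
  f x @[x --> +oo%R] --> 0.
Proof.
move=> fc; apply: norm_cvg0.
have h : c * (1 + x ^+ 2)^-1 @[x --> +oo] --> (0 : R).
  rewrite -[X in _ --> X](mulr0 c); apply: cvgM; first exact: cvg_cst.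
  apply/gtr0_cvgV0; first by near=> x; rewrite ltr_wpDr// sqr_ge0.
  apply: (@ger_cvgy _ _ _ _ (fun x : R => x ^+ 2)); last exact: cvgr_expr2.
  by near=> x; rewrite lerDr.
apply: (@squeeze_cvgr _ _ _ _ (cst 0) (fun x => c / (1 + x ^+ 2))) => //.
  by near=> x; rewrite normr_ge0 fc.
exact: cvg_cst.
Unshelve. all: by end_near. Qed.

(* Adding c times the derivative of atan makes the integrand nonnegative, so
   that the monotone version of the fundamental theorem applies. *)
Lemma Rintegral_FTC2y f F c : continuous f ->
  (forall x, 0 <= x -> `|f x| <= c / (1 + x ^+ 2)) ->
  (forall x, is_derive x 1 F (f x)) -> F x @[x --> +oo%R] --> 0 ->
  \int[mu]_(x in `[0, +oo[) f x = - F 0.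
Proof.
move=> cf fc dF F0.
pose g x := f x + c / (1 + x ^+ 2).
have cg : continuous g.
  move=> x; apply: cvgD; first exact: cf.
  by apply: cvgM; [exact: cvg_cst|exact: continuous_inv1Dsqr].
have g0 x : 0 <= x -> 0 <= g x.
  by move=> x0; have := fc x x0; rewrite ler_norml /g => /andP[h _]; lra.
have dG x : is_derive x (1:R) (fun x => F x + c * atan x) (g x).
  by apply: is_deriveD (dF x) _; exact: (is_deriveZ c (is_derive1_atan x)).
have -> : \int[mu]_(x in `[0, +oo[) f x =
    \int[mu]_(x in `[0, +oo[) g x - \int[mu]_(x in `[0, +oo[) (c * (1 + x ^+ 2)^-1).
  have if_ : mu.-integrable `[0, +oo[ (EFin \o f).
    apply: (@le_integrable _ _ _ mu _ _ _ (EFin \o (fun x => c / (1 + x ^+ 2)))) => //.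
    - by apply/measurable_EFinP; apply: measurable_funTS; exact: continuous_measurable_fun.
    - move=> x /=; rewrite in_itv/= andbT lee_fin => x0.
      by rewrite (le_trans (fc _ x0))// ler_norm.
    - by apply: (integrableS measurableT) => //; exact/integZl/integ_inv1Dsqr.
  have ic : mu.-integrable `[0, +oo[ (EFin \o (fun x => c * (1 + x ^+ 2)^-1)).
    by apply: (integrableS measurableT) => //; exact/integZl/integ_inv1Dsqr.
  by rewrite /g RintegralD// addrK.
have -> : \int[mu]_(x in `[0, +oo[) g x = c * (pi / 2) - F 0.
  rewrite (@Rintegral_ge0_continuous_FTC2y _ _ (fun x => F x + c * atan x) 0 (c * (pi / 2))).
  - by rewrite atan0 mulr0 addr0.
  - by move=> x; exact: g0.
  - exact: continuous_subspaceT.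
  - rewrite -[X in _ --> X]add0r; apply: cvgD => //; apply: cvgM; [exact: cvg_cst|exact: cvgy_atan].
  - by move=> x _; exact: ex_derive.
  - apply: cvg_at_right_filter.
    have : derivable (fun x => F x + c * atan x) 0 1 by exact: ex_derive.
    by move=> /derivable1_diffP/differentiable_continuous.
  - by move=> x _; rewrite derive1E derive_val.
have -> : \int[mu]_(x in `[0, +oo[) (c * (1 + x ^+ 2)^-1) = c * (pi / 2).
  rewrite RintegralZl//; first by rewrite /Rintegral integral_itv_inv1Dsqr.
  by apply: integrableS integ_inv1Dsqr.
by rewrite addrAC subrr sub0r.
Qed.

(** Adding [c / (1 + x ^+ 2)], which is even, reduces to a nonnegative integrand; the integrals of
    the added term, [c * pi] and [c * (pi / 2)], are then cancelled. *)
Lemma Rintegral_even f c : continuous f -> (forall x, f (- x) = f x) ->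
  (forall x, `|f x| <= c / (1 + x ^+ 2)) ->
  \int[mu]_x f x = 2 * \int[mu]_(x in `[0, +oo[) f x.
Proof.
move=> cf ef fc.
pose g x := f x + c / (1 + x ^+ 2).
have cg : continuous g.
  move=> x; apply: cvgD; first exact: cf.
  by apply: cvgM; [exact: cvg_cst|exact: continuous_inv1Dsqr].
have g0 x : 0 <= g x.
  by have := fc x; rewrite ler_norml /g => /andP[h _]; lra.
have if_ : mu.-integrable setT (EFin \o f).
  by apply: integ_le_inv1Dsqr fc; exact: continuous_measurable_fun.
have ic : integ mu (fun x => c / (1 + x ^+ 2)) by exact/integZl/integ_inv1Dsqr.
have ifp : mu.-integrable `[0, +oo[ (EFin \o f) by apply: integrableS if_.
have icp : mu.-integrable `[0, +oo[ (EFin \o (fun x => c / (1 + x ^+ 2))) by apply: integrableS ic.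
have H : \int[mu]_x g x = 2 * \int[mu]_(x in `[0, +oo[) g x.
  rewrite /Rintegral ge0_integral_even//; last by move=> x; rewrite /g ef sqrrN.
  rewrite fineM//; apply: integrable_fin_num => //.
  exact: (integrableD _ ifp icp).
move: H; rewrite /g !RintegralD// mulrDr => H.
apply: (addIr (\int[mu]_x (c / (1 + x ^+ 2)))); rewrite H; congr (_ + _).
rewrite !RintegralZl//; last 2 first.
- exact: integ_inv1Dsqr.
- by apply: integrableS integ_inv1Dsqr.
by rewrite /Rintegral integral_inv1Dsqr integral_itv_inv1Dsqr/=; lra.
Qed.

(** Symmetrization reduces to the half-line: [f x + f (- x)] is even, its primitive [F x - F (- x)]
    vanishes at 0 and at infinity, and its integral is twice that of [f]. *)
Lemma Rintegral_derive0 f F c : continuous f ->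
  (forall x, `|f x| <= c / (1 + x ^+ 2)) ->
  (forall x, is_derive x (1:R) F (f x)) -> F x @[x --> +oo%R] --> 0 ->
  F (- x) @[x --> +oo%R] --> 0 ->
  \int[mu]_x f x = 0.
Proof.
move=> cf fc dF F0 FN0.
have if_ : mu.-integrable setT (EFin \o f).
  by apply: integ_le_inv1Dsqr fc; exact: continuous_measurable_fun.
have N1 : (-1 : R) != 0 by rewrite oppr_eq0 oner_eq0.
have ifN := integrable_scale N1 if_.
have cfN : continuous (fun x => f (-1 * x)).
  move=> x; apply: continuous_comp; last exact: cf.
  exact: mulrl_continuous.
pose e x := f x + f (-1 * x).
have ce : continuous e by move=> x; apply: cvgD; [exact: cf|exact: cfN].
have ee x : `|e x| <= (c + c) / (1 + x ^+ 2).
  rewrite (le_trans (ler_normD _ _))// mulrDl lerD//.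
  by have := fc (-1 * x); rewrite mulN1r sqrrN.
have de x : is_derive x (1:R) (fun x => F x - F (-1 * x)) (e x).
  have -> : e x = f x - f (-1 * x) * -1 by rewrite mulrN1 opprK.
  apply: is_deriveB.
  apply: (is_derive1_comp (g := fun y => -1 * y) (dF (-1 * x))).
  rewrite -[X in is_derive _ _ _ X]mulr1.
  exact: (is_deriveZ (-1) (is_derive_id x 1)).
have e0 : F x - F (-1 * x) @[x --> +oo%R] --> 0.
  rewrite -[X in _ --> X]subr0; apply: cvgB => //.
  by under eq_fun do rewrite mulN1r.
have : \int[mu]_x e x = 0.
  rewrite (Rintegral_even ce _ ee); last by move=> x; rewrite /e !mulN1r opprK addrC.
  by rewrite (Rintegral_FTC2y ce (fun x _ => ee x) de e0) mulr0 subrr oppr0 mulr0.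
rewrite /e.
rewrite RintegralD// [X in X + _ = _](Rintegral_scale N1)// normrN1 mul1r -mulr2n.
move=> /eqP; rewrite mulrn_eq0/= => /eqP H.
by rewrite (Rintegral_scale N1)// H mulr0.
Qed.
End real_line.

(** * Hermite functions *)

Section hermite_polynomials.
Context {R : realType}.
Implicit Types (p q : {poly R}) (x : R) (i j k : nat).
Notation mu := (@lebesgue_measure R).

(** Obtained by differentiating Rodrigues' formula once more; [hermite_polyE] identifies it with
    [hermite_poly]. As polynomials, the recurrences become ring identities. *)
Fixpoint hermp k : {poly R} :=
  if k is k'.+1 then 2%:P * 'X * hermp k' - (hermp k')^`() else 1.

Arguments hermp : simpl never.

Lemma hermpS k : hermp k.+1 = 2%:P * 'X * hermp k - (hermp k)^`().
Proof. by []. Qed.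

(** A product of two Hermite functions carries exactly this Gaussian, so all their integrals reduce
    to [gauss_int] of a polynomial. *)
Definition gaussp p x : R := p.[x] * expR (- x ^+ 2).

Lemma is_derive_gaussp p x :
  is_derive x (1 : R) (gaussp p) (gaussp (p^`() - 2%:P * 'X * p) x).
Proof.
have dp : is_derive x (1 : R) (horner p) (p^`()).[x].
  apply: DeriveDef; first exact: derivable_horner.
  by rewrite derivE derive1E.
have dsq : is_derive x (1 : R) (fun y : R => - y ^+ 2) (- (2 * x)).
  apply: is_deriveN.
  have := @is_deriveX R R idfun 2 x 1 1 (is_derive_id x 1).
  by rewrite /= expr1 -[(_ * _) *: _]/(_ * _) mulr1.
have de := is_derive1_comp (g := fun y : R => - y ^+ 2) (is_derive_expR (- x ^+ 2)) dsq.
have := is_deriveM dp de.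
rewrite -[_ *: _ + _]/(_ * _ + _ * _).
rewrite /gaussp !hornerE /= => h.
have -> : (p^`().[x] - 2 * x * p.[x]) * expR (- x ^+ 2) =
  p.[x] * (expR (- x ^+ 2) * - (2 * x)) + expR (- x ^+ 2) * p^`().[x] by ring.
by rewrite mulrA.
Qed.

Lemma derive1n_gauss k :
  derive1n k (fun y : R => expR (- y ^+ 2)) = (fun x => (-1) ^+ k * gaussp (hermp k) x).
Proof.
elim: k => [|k IHk].
  by rewrite derive1n0; apply/funext => x; rewrite /gaussp !hornerE ?expr0 ?mul1r.
rewrite derive1nS IHk; apply/funext => x; rewrite derive1E.
have h := is_deriveZ ((-1) ^+ k) (is_derive_gaussp (hermp k) x).
rewrite -[LHS]/('D_1 ((-1) ^+ k *: gaussp (hermp k)) x) (@derive_val _ _ _ _ _ _ _ h).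
by rewrite -[_ *: _]/(_ * _) /gaussp hermpS [_ ^+ k.+1]exprS; set s := _ ^+ k; rewrite !hornerE /=; ring.
Qed.

Lemma hermite_polyE k x : hermite_poly k x = (hermp k).[x].
Proof.
rewrite /hermite_poly derive1n_gauss /gaussp; set s := _ ^+ k.
have hs : s * s = 1 by rewrite /s -exprMn mulrNN mulr1 expr1n.
have hE := expRxMexpNx_1 (x ^+ 2).
transitivity (s * s * (expR (x ^+ 2) * expR (- x ^+ 2)) * (hermp k).[x]).
  by ring.
by rewrite hs hE !mul1r.
Qed.

Lemma deriv1_poly : (1 : {poly R})^`() = 0.
Proof. by rewrite -polyC1 derivC. Qed.

Lemma deriv_2XM p : (2%:P * 'X * p)^`() = 2%:P * p + 2%:P * 'X * p^`().
Proof. by rewrite derivM derivM derivC derivX; ring. Qed.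

Lemma deriv_hermp k : (hermp k.+1)^`() = (2 * k.+1%:R)%:P * hermp k.
Proof.
elim: k => [|k IHk].
  rewrite hermpS [hermp 0]/(1 : {poly R}) derivB deriv_2XM deriv1_poly -polyC0.
  by rewrite derivC mulr1 polyC0; ring.
rewrite hermpS derivB deriv_2XM IHk derivM derivC [hermp k.+1]hermpS.
have -> : (2 * k.+2%:R)%:P = (2 * k.+1%:R)%:P + 2%:P :> {poly R}.
  by rewrite -polyCD -[k.+2%:R]natr1; congr polyC; ring.
by ring.
Qed.

Lemma hermp_rec k :
  hermp k.+2 = 2%:P * 'X * hermp k.+1 - (2 * k.+1%:R)%:P * hermp k.
Proof. by rewrite hermpS deriv_hermp. Qed.

Lemma hermp_ode k :
  (hermp k)^`()^`() = 2%:P * 'X * (hermp k)^`() - (2 * k%:R)%:P * hermp k.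
Proof.
case: k => [|k].
  by rewrite [hermp 0]/(1 : {poly R}) deriv1_poly -polyC0 derivC; ring.
by rewrite deriv_hermp derivM derivC [in RHS]hermpS; ring.
Qed.

(** Each monomial satisfies [|x|^i <= 1 + (x^2)^(i+1)], and one term of the exponential series
    bounds the last power by [(i+1)! exp(x^2)]. *)
Lemma gaussp_le p : exists c, forall x, `|gaussp p x| <= c.
Proof.
exists (\sum_(i < size p) `|p`_i| * (1 + i.+1`!%:R)) => x.
rewrite /gaussp horner_coef mulr_suml (le_trans (ler_norm_sum _ _ _))//.
apply: ler_sum => i _; rewrite !normrM -mulrA ler_wpM2l//.
rewrite (ger0_norm (expR_ge0 _)) expRN ler_pdivrMr ?expR_gt0//.
have h1 : 1 <= expR (x ^+ 2) by rewrite -[leLHS]expR0 ler_expR sqr_ge0.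
have h2 := expR_ge1Dxn i (sqr_ge0 x).
have f0 : 0 < (i.+1`!)%:R :> R by rewrite ltr0n fact_gt0.
have h3 : (x ^+ 2) ^+ i.+1 <= i.+1`!%:R * expR (x ^+ 2).
  rewrite mulrC -ler_pdivrMr//; apply: le_trans h2; rewrite lerDr; exact: ler01.
rewrite mulrDl mul1r.
apply: (@le_trans _ _ (1 + (x ^+ 2) ^+ i.+1)); last exact: lerD.
rewrite normrX -real_normK ?num_real// -exprM.
have [x1|x1] := leP `|x| 1.
  by rewrite (le_trans (exprn_ile1 _ _ x1))// lerDl exprn_ge0.
rewrite (@le_trans _ _ (`|x| ^+ (2 * i.+1)))// ?lerDr//.
by rewrite ler_weXn2l ?(ltW x1)// (leq_trans (leqnSn i))// leq_pmull.
Qed.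

Lemma gaussp_le_inv1Dsqr p : exists c, forall x, `|gaussp p x| <= c / (1 + x ^+ 2).
Proof.
have [c cP] := gaussp_le ((1 + 'X ^+ 2) * p); exists c => x.
have x0 : 0 < 1 + x ^+ 2 by rewrite ltr_wpDr// sqr_ge0.
rewrite ler_pdivlMr//; have := cP x; rewrite /gaussp !hornerE /= -mulrA normrM.
by rewrite (gtr0_norm x0) mulrC.
Qed.

Lemma continuous_gaussp p : continuous (gaussp p).
Proof.
move=> x; apply: cvgM; first exact: continuous_horner.
exact: continuous_gauss_fun.
Qed.

Lemma integrable_gaussp p : mu.-integrable setT (EFin \o gaussp p).
Proof.
have [c cP] := gaussp_le_inv1Dsqr p; apply: integ_le_inv1Dsqr cP.
by apply: continuous_measurable_fun; exact: continuous_gaussp.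
Qed.

Definition gauss_int p : R := \int[mu]_x gaussp p x.

Lemma gauss_intD p q : gauss_int (p + q) = gauss_int p + gauss_int q.
Proof.
rewrite /gauss_int -RintegralD//; [|exact: integrable_gaussp|exact: integrable_gaussp].
by apply: eq_Rintegral => x _; rewrite /gaussp hornerD mulrDl.
Qed.

Lemma gauss_intZ a p : gauss_int (a%:P * p) = a * gauss_int p.
Proof.
rewrite /gauss_int -RintegralZl//; last exact: integrable_gaussp.
by apply: eq_Rintegral => x _; rewrite /gaussp hornerM hornerC mulrA.
Qed.

Lemma gauss_int0 : gauss_int 0 = 0.
Proof. by have := gauss_intZ 0 0; rewrite mulr0 mul0r. Qed.

Lemma gauss_intN p : gauss_int (- p) = - gauss_int p.
Proof. by rewrite -mulN1r -polyCN gauss_intZ mulN1r. Qed.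

Lemma gauss_int1 : gauss_int 1 = Num.sqrt pi.
Proof.
rewrite /gauss_int /Rintegral; under eq_integral do rewrite /gaussp hornerE mul1r.
by rewrite (integralT_gauss (R := R)).
Qed.

Lemma gauss_int_deriv p : gauss_int (p^`() - 2%:P * 'X * p) = 0.
Proof.
have [c cP] := gaussp_le_inv1Dsqr (p^`() - 2%:P * 'X * p).
have [d dP] := gaussp_le_inv1Dsqr p.
apply: (Rintegral_derive0 (F := gaussp p) _ cP).
- exact: continuous_gaussp.
- by move=> x; exact: is_derive_gaussp.
- exact: cvg_le_inv1Dsqr (fun x _ => dP x).
- by apply: (cvg_le_inv1Dsqr (c := d)) => x _; have := dP (- x); rewrite sqrrN.
Qed.

(** Integration by parts: the derivative of [H_i q exp(-x^2)] is [(H_i q' - H_(i+1) q) exp(-x^2)],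
    and its integral vanishes. *)
Lemma gauss_int_hermpS i q : gauss_int (hermp i.+1 * q) = gauss_int (hermp i * q^`()).
Proof.
apply/eqP; rewrite -subr_eq0 -gauss_intN -gauss_intD; apply/eqP.
rewrite -[RHS]oppr0 -(gauss_int_deriv (hermp i * q)) -gauss_intN; congr gauss_int.
by rewrite hermpS derivM; ring.
Qed.

(** Since [H_(j+1)' = 2 (j+1) H_j], each integration by parts lowers both indices, until one of them
    is 0. *)
Lemma gauss_int_hermp i j : gauss_int (hermp i * hermp j) =
  (i == j)%:R * (2 ^+ i * Num.sqrt pi * i`!%:R).
Proof.
elim: i j => [|i IHi] [|j].
- by rewrite mulr1 gauss_int1 fact0 expr0 !mul1r mulr1.
- by rewrite mulrC gauss_int_hermpS [hermp 0]/(1 : {poly R}) deriv1_poly mulr0 gauss_int0 mul0r.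
- by rewrite gauss_int_hermpS [hermp 0]/(1 : {poly R}) deriv1_poly mulr0 gauss_int0 mul0r.
rewrite gauss_int_hermpS deriv_hermp mulrCA gauss_intZ IHi eqSS.
by case: eqP => [->|_]; rewrite ?mul0r ?mulr0// factS natrM exprS !mul1r; ring.
Qed.

(** Follows from [x H_j = H_(j+1) / 2 + j H_(j-1)] and orthogonality. This second moment is the
    source of the tail bound [shermite_tail]. *)
Lemma gauss_int_hermp_sqrX i : gauss_int (('X * hermp i) * ('X * hermp i)) =
  (2 ^+ i * Num.sqrt pi * i`!%:R) * (i%:R + 2^-1).
Proof.
have E j : 'X * hermp j.+1 = (2^-1)%:P * hermp j.+2 + j.+1%:R%:P * hermp j.
  rewrite hermp_rec.
  have h2 : (2^-1)%:P * 2%:P = 1 :> {poly R}.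
    by rewrite -polyCM mulVf ?pnatr_eq0// polyC1.
  rewrite polyCM.
  transitivity ((2^-1)%:P * 2%:P * ('X * hermp j.+1 - j.+1%:R%:P * hermp j) + j.+1%:R%:P * hermp j).
    by rewrite h2; ring.
  by ring.
have E0 : 'X * hermp 0 = (2^-1)%:P * hermp 1.
  rewrite hermpS [hermp 0]/(1 : {poly R}) deriv1_poly subr0 !mulr1 mulrA -polyCM.
  by rewrite mulVf ?pnatr_eq0// polyC1 mul1r.
case: i => [|i].
  rewrite E0 mulrACA -polyCM gauss_intZ gauss_int_hermp eqxx fact0 expr0 factS fact0.
  by rewrite expr1 mul1n /=; field.
have key a b p q : gauss_int ((a%:P * p + b%:P * q) * (a%:P * p + b%:P * q)) =
    a ^+ 2 * gauss_int (p * p) + 2 * a * b * gauss_int (p * q) + b ^+ 2 * gauss_int (q * q).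
  rewrite -!gauss_intZ -!gauss_intD; congr gauss_int.
  by rewrite !polyCM; ring.
rewrite E key !gauss_int_hermp !eqxx.
have -> : (i.+2 == i) = false by apply/negbTE; rewrite gtn_eqF// leqnSn.
rewrite mul0r mulr0 addr0 !factS !natrM ![2 ^+ _.+1]exprS -[i.+2%:R]natr1 -[i.+1%:R]natr1 /=.
by field.
Qed.

End hermite_polynomials.

Arguments hermp {R} k : simpl never.

Section hermite_functions.
Context {R : realType}.
Implicit Types (x : R) (i j k : nat).
Notation mu := (@lebesgue_measure R).

Definition hermc k : R := (Num.sqrt (2 ^+ k * Num.sqrt pi * k`!%:R))^-1.

Lemma hermite_norm_gt0 k : 0 < 2 ^+ k * Num.sqrt pi * k`!%:R :> R.
Proof.
by rewrite !mulr_gt0// ?exprn_gt0// ?sqrtr_gt0 ?pi_gt0// ltr0n fact_gt0.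
Qed.

Lemma hermc_sqr k : hermc k ^+ 2 = (2 ^+ k * Num.sqrt pi * k`!%:R)^-1.
Proof.
by rewrite /hermc exprVn sqr_sqrtr// ltW// hermite_norm_gt0.
Qed.

Lemma hermiteE k x : hermite k x = hermc k * ((hermp k).[x] * expR (- x ^+ 2 / 2)).
Proof. by rewrite /hermite hermite_polyE mulrA. Qed.

Lemma hermite_mul i j x :
  hermite i x * hermite j x = hermc i * hermc j * gaussp (hermp i * hermp j) x.
Proof.
rewrite !hermiteE /gaussp hornerM.
have -> : expR (- x ^+ 2) = expR (- x ^+ 2 / 2) * expR (- x ^+ 2 / 2).
  by rewrite -expRD; congr expR; field.
by ring.
Qed.

Lemma hermite_continuous k : continuous (@hermite R k).
Proof.
have -> : @hermite R k = (fun x => hermc k * ((hermp k).[x] * expR (- x ^+ 2 / 2))).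
  by apply/funext => x; exact: hermiteE.
move=> x; apply: cvgM; first exact: cvg_cst.
apply: cvgM; first exact: continuous_horner.
apply: continuous_comp; last exact: continuous_expR.
apply: cvgM; last exact: cvg_cst.
by apply: cvgN; exact: exprn_continuous.
Qed.

Lemma integ_hermite i j : integ mu (fun x => hermite i x * hermite j x).
Proof.
apply: eq_integ (integZl (hermc i * hermc j) (integrable_gaussp (hermp i * hermp j))) => x.
by rewrite hermite_mul.
Qed.

Lemma hermite_orthonormal i j : \int[mu]_x (hermite i x * hermite j x) = (i == j)%:R.
Proof.
under eq_Rint do rewrite hermite_mul.
rewrite RintZl; last exact: integrable_gaussp.
rewrite -/(gauss_int _) gauss_int_hermp; case: eqP => [->|_]; last by rewrite mul0r mulr0.
rewrite -expr2 hermc_sqr mul1r mulVf// gt_eqF//; exact: hermite_norm_gt0.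
Qed.

Lemma hermite_sqrX_gauss i x : x ^+ 2 * hermite i x ^+ 2 =
  hermc i ^+ 2 * gaussp (('X * hermp i) * ('X * hermp i)) x.
Proof. by rewrite [hermite i x ^+ 2]expr2 hermite_mul /gaussp !hornerM hornerX; ring. Qed.

Lemma integ_hermite_sqrX i : integ mu (fun x => x ^+ 2 * hermite i x ^+ 2).
Proof.
apply: eq_integ (integZl (hermc i ^+ 2) (integrable_gaussp (('X * hermp i) * ('X * hermp i)))) => x.
by rewrite hermite_sqrX_gauss.
Qed.

Lemma Rint_hermite_sqrX i : \int[mu]_x (x ^+ 2 * hermite i x ^+ 2) = i%:R + 2^-1.
Proof.
under eq_Rint do rewrite hermite_sqrX_gauss.
rewrite RintZl; last exact: integrable_gaussp.
rewrite -/(gauss_int _) gauss_int_hermp_sqrX hermc_sqr mulKf// gt_eqF//; exact: hermite_norm_gt0.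
Qed.

(** Initial data for the energy inequality: [p0 k] is used directly, and [p0 k.-1] through
    [h_k'(0)^2 = 2 k h_(k-1)(0)^2]. *)
Let p0 k : R := hermite k 0 ^+ 2.

Let p0E k : p0 k = (2 ^+ k * Num.sqrt pi * k`!%:R)^-1 * (hermp k).[0] ^+ 2.
Proof.
by rewrite /p0 hermiteE expr0n /= oppr0 mul0r expR0 mulr1 exprMn hermc_sqr.
Qed.

Let p0_rec k : p0 k.+2 = k.+1%:R / k.+2%:R * p0 k.
Proof.
rewrite !p0E hermp_rec hornerD hornerN !hornerM !hornerC hornerX mulr0 mul0r sub0r !factS !natrM ![2 ^+ _.+1]exprS.
have : (2 ^+ k : R) != 0 by rewrite expf_neq0.
have : Num.sqrt pi != 0 :> R by rewrite gt_eqF// sqrtr_gt0 pi_gt0.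
have : (k`!%:R : R) != 0 by rewrite pnatr_eq0 -lt0n fact_gt0.
have : (k.+1%:R : R) != 0 by rewrite pnatr_eq0.
have : (k.+2%:R : R) != 0 by rewrite pnatr_eq0.
move: (k.+2%:R) (k.+1%:R) (k`!%:R) (Num.sqrt pi) (2 ^+ k) (hermp k).[0] => a b c d e h a0 b0 c0 d0 e0.
by field; rewrite a0 b0 c0 d0 e0.
Qed.

(** The recurrence [p0_rec] goes two steps up, so the induction carries two consecutive indices; the
    step comes down to [(k+1)(k+3) <= (k+2)^2]. *)
Let p0_le k : p0 k ^+ 2 * k.+1%:R <= 1.
Proof.
suff : p0 k ^+ 2 * k.+1%:R <= 1 /\ p0 k.+1 ^+ 2 * k.+2%:R <= 1 by case.
elim: k => [|k [IH1 IH2]].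
  split.
    rewrite p0E hornerC expr0 fact0 !mul1r mulr1 expr1n mulr1 mulr1 exprVn sqr_sqrtr ?pi_ge0//.
    by rewrite invf_le1 ?pi_gt0// (le_trans _ (pi_ge2 R))// ler1n.
  rewrite p0E hermpS [hermp 0]/(1 : {poly R}) deriv1_poly subr0 !mulr1.
  by rewrite hornerM hornerX mulr0 expr0n mulr0 expr0n mul0r.
split=> //; rewrite p0_rec exprMn mulrAC.
apply: le_trans IH1.
rewrite mulrC; apply: ler_wpM2l; first exact: sqr_ge0.
rewrite expr_div_n mulrAC ler_pdivrMr ?exprn_gt0// -[k.+3%:R]natr1 -[k.+2%:R]natr1.
by have : 1 <= k.+1%:R :> R; [rewrite ler1n | move: (k.+1%:R) => y; nra].
Qed.

(* The energy [h'^2 + (2k+1-x^2) h^2] of the Hermite equation is nonincreasing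
   away from the origin. *)
Lemma hermite_energy k x :
  (k.*2.+1%:R - x ^+ 2) * hermite k x ^+ 2 <= 2 * k%:R * p0 k.-1 + k.*2.+1%:R * p0 k.
Proof.
pose c : R := k.*2.+1%:R.
pose H : {poly R} := hermp k.
(* Times the Gaussian, [q] is the energy of the unnormalized Hermite function, because the
   derivative of [H exp(-x^2/2)] is [(H' - x H) exp(-x^2/2)]. *)
pose q : {poly R} := (H^`() - 'X * H) * (H^`() - 'X * H) + (c%:P - 'X * 'X) * (H * H).
(* The Hermite equation cancels everything except the derivative [-2x] of the coefficient [c - x^2];
   its sign gives the monotonicity on each side of 0. *)
have dq : q^`() - 2%:P * 'X * q = - (2%:P * 'X * (H * H)).
  rewrite /q !(derivD, derivM, derivN, derivC, derivX) hermp_ode -/H /c -mul2n.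
  have -> : ((2 * k).+1%:R)%:P = 2%:P * (k%:R)%:P + 1 :> {poly R}.
    by rewrite -natr1 natrM polyCD polyCM.
  rewrite polyCM.
  by ring.
have qE y : q.[y] = (H^`().[y] - y * H.[y]) ^+ 2 + (c - y ^+ 2) * H.[y] ^+ 2.
  by rewrite /q !(hornerD, hornerN, hornerM, hornerC, hornerX); ring.
have E0 : gaussp q x <= gaussp q 0.
  have dg y : is_derive y (1 : R) (gaussp q) (- (2 * y * (gaussp (H * H) y))).
    have -> : - (2 * y * gaussp (H * H) y) = gaussp (- (2%:P * 'X * (H * H))) y.
      by rewrite /gaussp hornerN !hornerM hornerC hornerX; ring.
    by rewrite -dq; exact: is_derive_gaussp.
  have cg a b : {within `[a, b], continuous (gaussp q)}.
    by apply: continuous_subspaceT; exact: continuous_gaussp.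
  have g0 y : 0 <= gaussp (H * H) y.
    by rewrite /gaussp hornerM -expr2 mulr_ge0// ?sqr_ge0// expR_ge0.
  have [x0|x0] := leP 0 x.
    have [y + xy] := MVT_segment x0 (fun y _ => dg y) (cg _ _).
    rewrite in_itv/= => /andP[y0 _].
    rewrite -subr_le0 xy subr0 mulNr oppr_le0 mulr_ge0//.
    by rewrite mulr_ge0// mulr_ge0.
  have [y + xy] := MVT_segment (ltW x0) (fun y _ => dg y) (cg _ _).
  rewrite in_itv/= => /andP[_ y0].
  rewrite -subr_ge0 xy sub0r.
  by have := mulr_ge0 (g0 y) (mulr_le0 y0 (ltW x0)); lra.
(* Here [H_k' = 2 k H_(k-1)] is evaluated at 0. For [k = 0] the default [k.-1 = 0] is harmless, as
   the factor [k] vanishes. *)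
have -> : 2 * k%:R * p0 k.-1 + c * p0 k = hermc k ^+ 2 * gaussp q 0.
  have -> : gaussp q 0 = H^`().[0] ^+ 2 + c * H.[0] ^+ 2.
    by rewrite /gaussp qE expr0n oppr0 expR0; ring.
  rewrite hermc_sqr !p0E -/H mulrDr; congr (_ + _); last by rewrite mulrCA.
  rewrite /H; case: k {c H q dq E0 qE} => [|k].
    by rewrite [hermp 0]/(1 : {poly R}) deriv1_poly horner0 mulr0 mul0r expr0n mulr0.
  rewrite deriv_hermp hornerM hornerC /= factS natrM [2 ^+ k.+1]exprS.
  have : (2 ^+ k : R) != 0 by rewrite expf_neq0.
  have : Num.sqrt pi != 0 :> R by rewrite gt_eqF// sqrtr_gt0 pi_gt0.
  have : (k`!%:R : R) != 0 by rewrite pnatr_eq0 -lt0n fact_gt0.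
  have : (k.+1%:R : R) != 0 by rewrite pnatr_eq0.
  move: (k.+1%:R) (k`!%:R) (Num.sqrt pi) (2 ^+ k) (hermp k).[0] => b c d e h b0 c0 d0 e0.
  by field; rewrite b0 c0 d0 e0.
apply: le_trans (ler_wpM2l (sqr_ge0 _) E0).
rewrite expr2 [hermite k x ^+ 2]expr2 hermite_mul -expr2 mulrCA ler_wpM2l ?sqr_ge0// /gaussp mulrA.
rewrite ler_wpM2r ?expR_ge0// qE hornerM -/H -/c.
by have := sqr_ge0 (H^`().[x] - x * H.[x]); lra.
Qed.

(** On this range [2k + 1 - x^2] is at least half of [2k + 1], while by [p0_le] the energy at the
    origin is at most [4 sqrt(2k + 1)], each of its two terms giving 2. *)
Lemma hermite_bound k x : x ^+ 2 <= k.*2.+1%:R / 2 ->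
  hermite k x ^+ 2 <= 8 / Num.sqrt k.*2.+1%:R.
Proof.
move=> xk; set c : R := k.*2.+1%:R in xk *; set s := Num.sqrt c.
have c1 : 1 <= c by rewrite ler1n.
have cE : c = 2 * k%:R + 1 by rewrite /c -muln2 -natr1 natrM mulrC.
have s2 : s ^+ 2 = c by rewrite sqr_sqrtr// (le_trans _ c1).
have s0 : 0 < s by rewrite sqrtr_gt0 (lt_le_trans _ c1).
have le2s a : 0 <= a -> a ^+ 2 <= 4 * c -> a <= 2 * s.
  move=> a0; have -> : 4 * c = (2 * s) ^+ 2 by rewrite exprMn s2; ring.
  by rewrite ler_pXn2r// nnegrE// mulr_ge0// ltW.
have p0_ge0 j : 0 <= p0 j by exact: sqr_ge0.
have h1 : 2 * k%:R * p0 k.-1 <= 2 * s.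
  apply: le2s; first by apply: mulr_ge0 => //; apply: mulr_ge0.
  have : p0 k.-1 ^+ 2 * k%:R <= 1 by case: (k) => [|j]; [rewrite mulr0|exact: p0_le].
  have : 0 <= p0 k.-1 ^+ 2 by exact: sqr_ge0.
  have : 0 <= k%:R :> R by [].
  by rewrite cE !exprMn; move: (k%:R) (p0 k.-1 ^+ 2) => y z; nra.
have h2 : c * p0 k <= 2 * s.
  apply: le2s; first by rewrite mulr_ge0// (le_trans _ c1).
  have := p0_le k; rewrite [(c * _) ^+ 2]exprMn.
  have : c <= 2 * k.+1%:R by rewrite cE -natr1; lra.
  have : 0 <= p0 k ^+ 2 by exact: sqr_ge0.
  move: (k.+1%:R) (p0 k ^+ 2) => y z z0 cy zy.
  have : c * z <= 2 by have := ler_wpM2r z0 cy; move: zy; lra.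
  move=> cz; have c0 : 0 <= c by rewrite (le_trans _ c1).
  have : 0 <= c * (2 - c * z) by rewrite mulr_ge0 ?subr_ge0.
  by move: c1; lra.
have h3 := hermite_energy k x.
have h4 : c / 2 * hermite k x ^+ 2 <= 4 * s.
  apply: (@le_trans _ _ ((c - x ^+ 2) * hermite k x ^+ 2)).
    by rewrite ler_wpM2r ?sqr_ge0//; move: xk; lra.
  by rewrite (le_trans h3)// (le_trans (lerD h1 h2))//; lra.
rewrite ler_pdivlMr// -(ler_pM2l s0); move: h4; rewrite -s2.
by move: (hermite k x ^+ 2) => y; lra.
Qed.

End hermite_functions.

(** * Product integrals and scaled Hermite functions *)

Section tensor.
Context d1 d2 (T1 : measurableType d1) (T2 : measurableType d2) (R : realType).
Variables (m1 : {sigma_finite_measure set T1 -> \bar R})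
  (m2 : {sigma_finite_measure set T2 -> \bar R}).
Implicit Types (f : T1 -> R) (g : T2 -> R).

Lemma measurable_tensor f g : measurable_fun setT f -> measurable_fun setT g ->
  measurable_fun setT (fun p : T1 * T2 => f p.1 * g p.2).
Proof.
move=> mf mg; apply: measurable_funM.
  exact: measurableT_comp mf (measurable_fst).
exact: measurableT_comp mg (measurable_snd).
Qed.

Lemma integ_tensor f g : integ m1 f -> integ m2 g ->
  integ (m1 \x m2)%E (fun p => f p.1 * g p.2).
Proof.
move=> fi gi; apply/integrable12ltyP.
  by apply/measurable_EFinP; apply: measurable_tensor; [exact: integ_measurable fi|exact: integ_measurable gi].
under eq_integral => x _.
  under eq_integral => y _ do rewrite /= normrM EFinM.
  rewrite ge0_integralZl//; last first.
    by apply/measurable_EFinP; apply: measurableT_comp => //; exact: integ_measurable gi.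
  rewrite (EFin_Rint (integ_norm gi)); over.
rewrite /= ge0_integralZr//.
- by rewrite (EFin_Rint (integ_norm fi)) -EFinM ltry.
- by apply/measurable_EFinP; apply: measurableT_comp => //; exact: integ_measurable fi.
- by rewrite lee_fin Rint_ge0.
Qed.

Lemma Rint_tensor f g : integ m1 f -> integ m2 g ->
  \int[(m1 \x m2)%E]_p (f p.1 * g p.2) = \int[m1]_x f x * \int[m2]_y g y.
Proof.
move=> fi gi; apply: EFin_inj; rewrite -EFin_Rint; last exact: integ_tensor.
rewrite -(integral12_prod_meas1 (integ_tensor fi gi)) /fubini_F /=.
under eq_integral => x _.
  under eq_integral => y _ do rewrite /=.
  rewrite (EFin_Rint (integZl (f x) gi)) (RintZl _ gi); over.
rewrite EFin_Rint; first by rewrite RintegralZr.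
by apply: eq_integ (integZl (\int[m2]_y g y) fi) => x; rewrite mulrC.
Qed.

End tensor.

Section tuples.
Context {R : realType}.
Notation tR n := (n.-tuple (measurableTypeR R)).
Notation leb := (@lebesgue_measure R).
Notation lebn := (@lebesgue_tuple R).

Let tcons n (p : measurableTypeR R * tR n) : tR n.+1 := [the n.+1.-tuple _ of p.1 :: p.2].

Let measurable_tcons n : measurable_fun setT (@tcons n).
Proof. by apply: measurable_cons; [exact: measurable_fst|exact: measurable_snd]. Qed.

Let push n := measure_function_pushforward__canonical__measure_function_Measure
  (leb \x lebn n)%E (@measurable_tcons n).

(** By construction the measure on [n.+1]-tuples is the image of a product measure under [tcons];
    [push] presents this image in the form that the pushforward lemmas expect. *)
Lemma integral_tupleS n (G : tR n.+1 -> R) : measurable_fun setT G ->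
  integ (leb \x lebn n)%E (G \o @tcons n) -> integ (lebn n.+1) G /\
  \int[lebn n.+1]_u G u = \int[(leb \x lebn n)%E]_p G (tcons p).
Proof.
move=> mG iG; have mG' : measurable_fun setT (EFin \o G) by exact/measurable_EFinP.
have E : (\int[lebn n.+1]_u (G u)%:E = \int[(leb \x lebn n)]_p (G (tcons p))%:E)%E.
  rewrite (eq_measure_integral (push n))//.
  by rewrite (integral_pushforward (@measurable_tcons n) mG').
split; last by rewrite /Rintegral E.
apply/integrableP; split => //.
rewrite (eq_measure_integral (push n))//.
rewrite (ge0_integral_pushforward (@measurable_tcons n))//.
  by move/integrableP : iG => [].
exact: measurableT_comp.
Qed.

Lemma tuple_integral_prod n (G : 'I_n -> R -> R) : (forall i, integ leb (G i)) ->
  integ (lebn n) (fun u => \prod_(i < n) G i (tnth u i)) /\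
  \int[lebn n]_u (\prod_(i < n) G i (tnth u i)) = \prod_(i < n) \int[leb]_x G i x.
Proof.
elim: n G => [|n IHn] G iG.
  have E : (fun u : tR 0 => \prod_(i < 0) G i (tnth u i)) = cst 1.
    by apply/funext => u; rewrite big_ord0.
  have I1 : (\int[lebn 0]_x (1%:E) = 1%:E)%E.
    by rewrite integral_cst// mul1e; exact: diracT.
  rewrite E big_ord0; split; last by rewrite /Rintegral /= I1.
  apply/integrableP; split; first by apply/measurable_EFinP; exact: measurable_cst.
  by under eq_integral do rewrite /= normr1; rewrite I1 ltry.
have [i1 e1] := IHn (fun i => G (lift ord0 i)) (fun i => iG _).
have mG : measurable_fun setT (fun u : tR n.+1 => \prod_(i < n.+1) G i (tnth u i)).
  apply: measurable_prod => i _.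
  apply: measurableT_comp; last exact: measurable_tnth.
  exact: integ_measurable (iG i).
have E (p : measurableTypeR R * tR n) : \prod_(i < n.+1) G i (tnth (tcons p) i) =
    G ord0 p.1 * \prod_(i < n) G (lift ord0 i) (tnth p.2 i).
  rewrite big_ord_recl; congr (_ * _); apply: eq_bigr => i _; congr (G _ _).
  by rewrite !(tnth_nth 0).
have [] := integral_tupleS mG.
  by apply: eq_integ (integ_tensor (iG ord0) i1) => p /=; rewrite E.
move=> i2 e2; split => //; rewrite e2 big_ord_recl -e1.
under eq_Rint do rewrite E.
by rewrite (Rint_tensor (iG ord0) i1).
Qed.

End tuples.

Section scaled_hermite.
Context {R : realType}.
Implicit Types (a x r : R) (i j k : nat).
Notation mu := (@lebesgue_measure R).

(** The one-variable factor of [Phi_scaled]: the exponent 1/4 normalizes it in L^2, and [n] such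
    factors rebuild the power [n / 4]. *)
Definition shermite a k x : R := a `^ 4^-1 * hermite k (Num.sqrt a * x).

Lemma shermite_continuous a k : continuous (shermite a k).
Proof.
move=> x; apply: cvgM; first exact: cvg_cst.
apply: continuous_comp; last exact: hermite_continuous.
exact: mulrl_continuous.
Qed.

Lemma shermite_mul a i j x : 0 < a -> shermite a i x * shermite a j x =
  Num.sqrt a * (hermite i (Num.sqrt a * x) * hermite j (Num.sqrt a * x)).
Proof.
move=> a0; rewrite /shermite mulrACA; congr (_ * _).
rewrite -powRD; last by rewrite (gt_eqF a0) implybT.
by rewrite -powR12_sqrt ?(ltW a0)//; congr (_ `^ _); field.
Qed.

Lemma integ_shermite a i j : 0 < a -> integ mu (fun x => shermite a i x * shermite a j x).
Proof.
move=> a0; have s0 : Num.sqrt a != 0 by rewrite gt_eqF// sqrtr_gt0.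
apply: eq_integ (integZl (Num.sqrt a) (integrable_scale s0 (integ_hermite i j))) => x.
by rewrite shermite_mul.
Qed.

Lemma shermite_orthonormal a i j : 0 < a ->
  \int[mu]_x (shermite a i x * shermite a j x) = (i == j)%:R.
Proof.
move=> a0; have s0 : 0 < Num.sqrt a by rewrite sqrtr_gt0.
have s1 : Num.sqrt a != 0 by rewrite gt_eqF.
under eq_Rint do rewrite (shermite_mul _ _ _ a0).
rewrite RintZl; last exact: integrable_scale s1 (integ_hermite i j).
by rewrite -(hermite_orthonormal i j) (Rintegral_scale s1 (integ_hermite i j)) gtr0_norm.
Qed.

(** Chebyshev's inequality: outside the interval [1 <= x^2 / r^2], and the second moment of the
    dilated function is [(k + 1/2) / a]. *)
Lemma shermite_tail a k r : 0 < a -> 0 < r ->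
  \int[mu]_x (\1_(~` `[- r, r]) x * (shermite a k x * shermite a k x)) <=
  (k%:R + 2^-1) / (a * r ^+ 2).
Proof.
move=> a0 r0; have s0 : 0 < Num.sqrt a by rewrite sqrtr_gt0.
have s1 : Num.sqrt a != 0 by rewrite gt_eqF.
have s2 : Num.sqrt a ^+ 2 = a by rewrite sqr_sqrtr// ltW.
have i1 := integrable_scale s1 (integ_hermite_sqrX k).
have -> : (k%:R + 2^-1) / (a * r ^+ 2) = \int[mu]_x ((Num.sqrt a / (a * r ^+ 2)) *
    ((Num.sqrt a * x) ^+ 2 * hermite k (Num.sqrt a * x) ^+ 2)).
  rewrite RintZl// mulrAC; congr (_ / _).
  by rewrite -(Rint_hermite_sqrX k) (Rintegral_scale s1 (integ_hermite_sqrX k)) gtr0_norm.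
apply: le_Rint.
- apply: integ_indic; last exact: integ_shermite.
  by apply: measurableC; exact: measurable_itv.
- exact: integZl.
- move=> x; rewrite indicE shermite_mul// exprMn s2.
  case: (boolP (x \in _)) => [|_]; last first.
    rewrite mul0r; apply: mulr_ge0.
      by rewrite divr_ge0 ?(ltW s0)// mulr_ge0 ?sqr_ge0 ?(ltW a0).
    by apply: mulr_ge0; [apply: mulr_ge0; [exact: ltW|exact: sqr_ge0]|exact: sqr_ge0].
  rewrite inE/= in_itv/= -ler_norml => /negP; rewrite -ltNge => rx.
  rewrite mul1r -expr2 mulrA ler_wpM2r ?sqr_ge0// -[leLHS]mulr1 -mulrA.
  rewrite ler_wpM2l ?(ltW s0)// mulrC -(mulrC _^-1) ler_pdivlMl ?mulr_gt0 ?exprn_gt0//.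
  rewrite mulr1 ler_wpM2l ?(ltW a0)// -[leRHS]real_normK ?num_real//.
  by rewrite ler_pXn2r ?nnegrE ?(ltW r0)// ltW.
Qed.

(** The hypothesis keeps the dilated interval inside the range of [hermite_bound]; 16 is its
    constant 8 times the 2 of the length [2 * r]. *)
Lemma shermite_local a k r : 0 < a -> 0 < r -> a * r ^+ 2 <= k.*2.+1%:R / 2 ->
  \int[mu]_x (\1_`[- r, r] x * (shermite a k x * shermite a k x)) <=
  16 * (Num.sqrt a * r) / Num.sqrt k.*2.+1%:R.
Proof.
move=> a0 r0 ar; have s0 : 0 < Num.sqrt a by rewrite sqrtr_gt0.
have mI : measurable (`[- r, r] : set (measurableTypeR R)) by exact: measurable_itv.
have muI : (mu `[(- r)%R, r%R] = (2 * r)%R%:E)%E.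
  rewrite lebesgue_measure_itv/= lte_fin ifT; last by lra.
  by rewrite -EFinD; congr EFin; ring.
have iI : integ mu (\1_`[- r, r] : R -> R).
  exact: integrable_indic_itv.
have -> : 16 * (Num.sqrt a * r) / Num.sqrt k.*2.+1%:R =
    \int[mu]_x ((Num.sqrt a * (8 / Num.sqrt k.*2.+1%:R)) * \1_`[- r, r] x).
  have h : \int[mu]_x \1_`[- r, r] x = 2 * r.
    by rewrite /Rintegral integral_indic// setIT; exact: (congr1 fine muI).
  by rewrite RintZl// h; ring.
apply: le_Rint.
- by apply: integ_indic => //; exact: integ_shermite.
- exact: integZl.
- move=> x; rewrite mulrC indicE shermite_mul//; case: (boolP (x \in _)) => [|_]; last by rewrite !mulr0.
  rewrite inE/= in_itv/= -ler_norml => xr; rewrite !mulr1 ler_wpM2l ?(ltW s0)//.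
  rewrite -expr2 hermite_bound// exprMn sqr_sqrtr ?(ltW a0)//.
  apply: le_trans ar; rewrite ler_wpM2l ?(ltW a0)// -[leLHS]real_normK ?num_real//.
  by rewrite ler_pXn2r ?nnegrE ?(ltW r0).
Qed.

End scaled_hermite.

(** * Tensor products of scaled Hermite functions and sums within one level *)

Section nhermite.
Context {R : realType} (n : nat).
Notation tR := (n.-tuple (measurableTypeR R)).
Notation leb := (@lebesgue_measure R).
Notation lebn := (@lebesgue_tuple R n).
Implicit Types (a b : multi_index n) (k : R) (u : tR) (s : seq (multi_index n)).

Definition nhermite k a (u : tR) : R := \prod_(j < n) shermite k (a j) (tnth u j).

Lemma measurable_coord j : measurable_fun setT (fun u : tR => tnth u j : R).
Proof. exact: measurable_tnth. Qed.

Lemma measurable_nhermite k a : measurable_fun setT (nhermite k a).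
Proof.
apply: measurable_prod => i _; apply: measurableT_comp; last exact: measurable_coord.
by apply: continuous_measurable_fun; exact: shermite_continuous.
Qed.

(** The integral factors over the coordinates. If [a] and [b] differ at some coordinate other than
    [j], orthogonality there gives 0; if they agree off [j], equality of sizes makes them agree at
    [j] too. *)
Lemma nhermite_integral k a b j (D : set R) : 0 < k -> measurable D ->
  integ lebn (fun u => \1_D (tnth u j) * (nhermite k a u * nhermite k b u)) /\
  (size_mi a = size_mi b -> \int[lebn]_u (\1_D (tnth u j) * (nhermite k a u * nhermite k b u)) =
  (a == b)%:R * \int[leb]_x (\1_D x * (shermite k (a j) x * shermite k (a j) x))).
Proof.
move=> k0 mD.
pose G i x := (if i == j then \1_D x else 1) * (shermite k (a i) x * shermite k (b i) x).
have iG i : integ leb (G i).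
  rewrite /G; case: eqP => _.
    by apply: integ_indic => //; exact: integ_shermite.
  by apply: eq_integ (integ_shermite (a i) (b i) k0) => x; rewrite mul1r.
have GE u : \prod_(i < n) G i (tnth u i) = \1_D (tnth u j) * (nhermite k a u * nhermite k b u).
  rewrite /G big_split big_split /=; congr (_ * _).
  rewrite (bigD1 j)//= eqxx big1 ?mulr1// => i /negbTE ->//.
have [i1 e1] := tuple_integral_prod iG; split; first by apply: eq_integ i1.
move=> ab; under eq_Rint do rewrite -GE.
rewrite e1 (bigD1 j)//= {1}/G eqxx.
have GI i : i != j -> \int[leb]_x G i x = (a i == b i)%:R.
  move=> /negbTE ij; rewrite -(shermite_orthonormal _ _ k0); apply: eq_Rint => x.
  by rewrite /G ij mul1r.
have [eab|neq] := eqVneq a b.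
  subst b; by rewrite mul1r big1 ?mulr1// => i /GI ->; rewrite eqxx.
rewrite mul0r; have [/existsP[i /andP[ij abi]]|] := boolP [exists i, (i != j) && (a i != b i)].
  by rewrite (bigD1 i)//= GI// (negbTE abi) mul0r mulr0.
rewrite negb_exists => /forallP h; exfalso; move/negP : neq; apply; apply/eqP/ffunP => i.
have abi i' : i' != j -> a i' = b i'.
  by move=> ij; apply/eqP; move: (h i'); rewrite ij /= negbK.
have [->|/abi//] := eqVneq i j.
move: ab; rewrite /size_mi (bigD1 j)//= [in RHS](bigD1 j)//=.
by rewrite (eq_bigr (fun i => b i)) => [/addIn|].
Qed.

(** Intended for multi-indices of one size, which share a single scale; [synth] is the version in
    which the scale follows the level. *)
Definition hsum k s (c : multi_index n -> R) (u : tR) : R :=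
  \sum_(a <- s) c a * nhermite k a u.

Lemma measurable_hsum k s c : measurable_fun setT (hsum k s c).
Proof.
apply: measurable_sum => a; apply: measurable_funM; first exact: measurable_cst.
exact: measurable_nhermite.
Qed.

Lemma hsum_sqr_integral k s (c : multi_index n -> R) j (D : set R) m : 0 < k ->
  measurable D -> uniq s -> (forall a, a \in s -> size_mi a = m) ->
  integ lebn (fun u => \1_D (tnth u j) * hsum k s c u ^+ 2) /\
  \int[lebn]_u (\1_D (tnth u j) * hsum k s c u ^+ 2) =
  \sum_(a <- s) c a ^+ 2 * \int[leb]_x (\1_D x * (shermite k (a j) x * shermite k (a j) x)).
Proof.
move=> k0 mD us sm.
have E u : \1_D (tnth u j) * hsum k s c u ^+ 2 = \sum_(a <- s) \sum_(b <- s)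
    (c a * c b) * (\1_D (tnth u j) * (nhermite k a u * nhermite k b u)).
  rewrite expr2 /hsum big_distrlr /= mulr_sumr; apply: eq_bigr => a _.
  by rewrite mulr_sumr; apply: eq_bigr => b _; ring.
have iab a b := (nhermite_integral a b j k0 mD).1.
have i2 a : integ lebn (fun u => \sum_(b <- s)
    (c a * c b) * (\1_D (tnth u j) * (nhermite k a u * nhermite k b u))).
  by apply: integ_sum => b _; exact: integZl.
split; first by apply: eq_integ (integ_sum s (P := xpredT) (fun a _ => i2 a)) => u; rewrite E.
under eq_Rint do rewrite E.
rewrite Rint_sum//; apply: eq_big_seq => a sa.
rewrite Rint_sum; last by move=> b; exact: integZl.
rewrite (bigD1_seq a)//= big_seq_cond big1 ?addr0.
  by rewrite RintZl// (nhermite_integral a a j k0 mD).2// eqxx mul1r expr2.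
move=> b /andP[sb ba].
by rewrite RintZl// (nhermite_integral a b j k0 mD).2 ?sm// eq_sym (negbTE ba) mul0r mulr0.
Qed.

Lemma hsum_sqr_le k s (c : multi_index n -> R) j (D : set R) m B : 0 < k ->
  measurable D -> uniq s -> (forall a, a \in s -> size_mi a = m) ->
  (forall a, a \in s -> \int[leb]_x (\1_D x * (shermite k (a j) x * shermite k (a j) x)) <= B) ->
  \int[lebn]_u (\1_D (tnth u j) * hsum k s c u ^+ 2) <= B * \sum_(a <- s) c a ^+ 2.
Proof.
move=> k0 mD us sm sB; rewrite (hsum_sqr_integral c j k0 mD us sm).2 mulr_sumr.
rewrite big_seq [leRHS]big_seq; apply: ler_sum => a sa.
by rewrite mulrC ler_wpM2r ?sqr_ge0 ?sB.
Qed.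

Lemma hsum_sqr k s (c : multi_index n -> R) (j : 'I_n) m : 0 < k -> uniq s ->
  (forall a, a \in s -> size_mi a = m) ->
  integ lebn (fun u => hsum k s c u ^+ 2) /\
  \int[lebn]_u (hsum k s c u ^+ 2) = \sum_(a <- s) c a ^+ 2.
Proof.
move=> k0 us sm; have [i e] := hsum_sqr_integral c j k0 (@measurableT _ R) us sm.
have E u : \1_setT (tnth u j) * hsum k s c u ^+ 2 = hsum k s c u ^+ 2.
  by rewrite indicT mul1r.
split; first by apply: eq_integ i => u.
under eq_Rint do rewrite -E.
rewrite e; apply: eq_bigr => a _; rewrite -[RHS]mulr1; congr (_ * _).
rewrite -[RHS]/((true)%:R) -(eqxx (a j)) -(shermite_orthonormal _ _ k0).
by apply: eq_Rint => x; rewrite indicT mul1r.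
Qed.

End nhermite.

(** * Almost orthogonality between levels with different scales *)

Section almost_orthogonality.
Context {R : realType} (n : nat).
Hypothesis n_gt0 : (0 < n)%N.
Notation tR := (n.-tuple (measurableTypeR R)).
Notation leb := (@lebesgue_measure R).
Notation lebn := (@lebesgue_tuple R n).
Implicit Types (a b : multi_index n) (k l m : nat) (u : tR) (s t : seq (multi_index n)).
Implicit Types (c : multi_index n -> R).

Definition lev k : R := (2 * k + n)%N%:R.

Lemma lev_ge1 k : 1 <= lev k.
Proof. by rewrite ler1n addn_gt0 n_gt0 orbT. Qed.

Lemma lev_gt0 k : 0 < lev k.
Proof. exact: lt_le_trans ltr01 (lev_ge1 k). Qed.

Lemma le_lev k l : (k <= l)%N -> lev k <= lev l.
Proof. by move=> kl; rewrite ler_nat leq_add2r leq_mul2l kl orbT. Qed.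

Lemma levS k : lev k.+1 = lev k + 2.
Proof. by rewrite /lev mulnS -addnA natrD addrC. Qed.

Definition qlev k : R := Num.sqrt (Num.sqrt (lev k)).

Lemma qlev_gt0 k : 0 < qlev k.
Proof. by rewrite !sqrtr_gt0 lev_gt0. Qed.

Lemma qlev4 k : qlev k ^+ 4 = lev k.
Proof.
by rewrite -[4%N]/(2 * 2)%N exprM !sqr_sqrtr ?sqrtr_ge0// ltW// lev_gt0.
Qed.

Lemma le_qlev k l : (k <= l)%N -> qlev k <= qlev l.
Proof. by move=> kl; rewrite !ler_wsqrtr// le_lev. Qed.

Lemma qlev_ge1 k : 1 <= qlev k.
Proof. by rewrite /qlev -[1]sqrtr1 ler_wsqrtr// -[1]sqrtr1 ler_wsqrtr// lev_ge1. Qed.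

(** Consecutive fourth roots [y <= z] satisfy [z^4 - y^4 = 2], and [z^4 - y^4 <= 4 z^3 (z - y)]. The
    bound makes the sums of [M_l^(-3/4)] and [M_l^(-5/4)] telescope. *)
Lemma qlevS k : 1 <= 2 * qlev k.+1 ^+ 3 * (qlev k.+1 - qlev k).
Proof.
have h := levS k; rewrite -!qlev4 in h.
have := le_qlev (leqnSn k); have := qlev_gt0 k; move: h.
move: (qlev k) (qlev k.+1) => y z h y0 yz.
have z0 : 0 < z by exact: lt_le_trans yz.
have h1 : (z - y) * (z ^+ 3 + z ^+ 2 * y + z * y ^+ 2 + y ^+ 3) = 2.
  by rewrite (_ : _ * _ = z ^+ 4 - y ^+ 4); [rewrite h; ring|ring].
have h2 : z ^+ 3 + z ^+ 2 * y + z * y ^+ 2 + y ^+ 3 <= 4 * z ^+ 3.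
  have e1 : z ^+ 2 * y <= z ^+ 3 by rewrite [z ^+ 3]exprSr ler_wpM2l// sqr_ge0.
  have y2 : y ^+ 2 <= z ^+ 2 by apply: lerXn2r => //; rewrite nnegrE ltW.
  have e2 : z * y ^+ 2 <= z ^+ 3 by rewrite [z ^+ 3]exprS ler_wpM2l// ltW.
  have e3 : y ^+ 3 <= z ^+ 3 by apply: lerXn2r => //; rewrite nnegrE ltW.
  by lra.
have : 2 <= (z - y) * (4 * z ^+ 3) by rewrite -{1}h1 ler_wpM2l// subr_ge0.
by lra.
Qed.

(* The ratio [(M_l / M_k)^(1/4)] for [l <= k], with [M_k = 2 k + n]. *)
Definition theta k l : R := qlev (minn k l) / qlev (maxn k l).

Lemma thetaC k l : theta k l = theta l k.
Proof. by rewrite /theta minnC maxnC. Qed.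

Lemma theta_gt0 k l : 0 < theta k l.
Proof. by rewrite divr_gt0// qlev_gt0. Qed.

(** The row sum of Schur's test. With [y_l] for [qlev l], the terms are [y_l^(-3) / y_k] up to [k]
    and [y_k y_l^(-5)] afterwards; [qlevS] compares them with differences of [y_l] and of
    [-1 / y_l]. The two ranges contribute 3 and 2. *)
Lemma sum_theta_lev k K : \sum_(l < K) theta k l / lev l <= 5.
Proof.
have low m : (m <= k)%N -> \sum_(l < m.+1) theta k l / lev l <= 3 * qlev m / qlev k.
  elim: m => [|m IHm] mk.
    rewrite big_ord_recl big_ord0 addr0 /theta minn0 maxn0 -qlev4.
    rewrite mulrAC ler_pM2r ?invr_gt0 ?qlev_gt0// ler_pdivrMr ?exprn_gt0 ?qlev_gt0//.
    have := qlev_ge1 0; move: (qlev 0) => y y1.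
    have y4 : 1 <= y ^+ 4 by exact: exprn_ege1.
    nra.
  rewrite big_ord_recr /=.
  apply: le_trans (lerD (IHm (ltnW mk)) (lexx _)) _.
  rewrite /theta (minn_idPr mk) (maxn_idPl mk) -qlev4.
  rewrite [X in _ + X]mulrAC -mulrDl ler_pM2r ?invr_gt0 ?qlev_gt0//.
  have := qlevS m; have := qlev_gt0 m.+1.
  move: (qlev m) (qlev m.+1) => y z z0 h.
  have -> : z / z ^+ 4 = (z ^+ 3)^-1 by field; rewrite gt_eqF.
  suff : (z ^+ 3)^-1 <= 3 * (z - y) by lra.
  rewrite -div1r ler_pdivrMr ?exprn_gt0//; move: h.
  by lra.
have high m : \sum_(l < (k + m).+1) theta k l / lev l <= 5 - 2 * qlev k / qlev (k + m).
  elim: m => [|m IHm].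
    rewrite addn0; have := low k (leqnn k).
    have -> : 3 * qlev k / qlev k = 3 by rewrite mulfK// gt_eqF// qlev_gt0.
    have -> : 2 * qlev k / qlev k = 2 by rewrite mulfK// gt_eqF// qlev_gt0.
    by lra.
  rewrite addnS big_ord_recr /=.
  apply: le_trans (lerD IHm (lexx _)) _.
  have km : (k <= (k + m).+1)%N by rewrite -addnS leq_addr.
  rewrite /theta (minn_idPl km) (maxn_idPr km) -[lev _]qlev4.
  have := qlevS (k + m); have := qlev_gt0 (k + m); have := qlev_gt0 k.
  have := le_qlev (leqnSn (k + m)).
  move: (qlev k) (qlev (k + m)) (qlev (k + m).+1) => x y z yz x0 y0 h.
  have z0 : 0 < z by exact: lt_le_trans yz.
  have e1 : 2 * x / y - 2 * x / z = x * (2 * (z - y) / (y * z)).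
    by field; rewrite !gt_eqF.
  have e2 : x / z / z ^+ 4 = x * (z ^+ 5)^-1 by field; rewrite gt_eqF.
  suff : x / z / z ^+ 4 <= 2 * x / y - 2 * x / z by lra.
  rewrite e1 e2 ler_wpM2l ?(ltW x0)// -div1r ler_pdivrMr ?exprn_gt0//.
  have -> : 2 * (z - y) / (y * z) * z ^+ 5 = (2 * z ^+ 3 * (z - y)) * (z / y).
    by field; rewrite !gt_eqF.
  have zy : 1 <= z / y by rewrite ler_pdivlMr// mul1r.
  by rewrite -[leLHS]mulr1 ler_pM.
have [kK|Kk] := leqP k.+1 K.
  rewrite -(subnKC kK) addSn; apply: le_trans (high _) _.
  by rewrite gerBl// divr_ge0 ?mulr_ge0 ?ltW ?qlev_gt0.
apply: (@le_trans _ _ (\sum_(l < k.+1) theta k l / lev l)).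
  rewrite (big_ord_widen k.+1 (fun l => theta k l / lev l))// 1?ltnW//.
  rewrite big_mkcond; apply: ler_sum => l _; case: ifP => // _.
  by rewrite divr_ge0// ltW// ?theta_gt0// lev_gt0.
have := high 0; rewrite addn0 => /le_trans; apply.
by rewrite gerBl// divr_ge0 ?mulr_ge0 ?ltW ?qlev_gt0.
Qed.

Variable nu : R.
Hypothesis nu_gt0 : 0 < nu.

Definition kap k : R := nu / lev k.

Lemma kap_gt0 k : 0 < kap k. Proof. by rewrite divr_gt0 ?lev_gt0. Qed.

Let amgm (x y z : R) : 0 < x -> y * z <= (x * y ^+ 2 + x^-1 * z ^+ 2) / 2.
Proof.
move=> x0; have := sqr_ge0 (x * y - z) => h.
have : 0 <= x^-1 * (x * y - z) ^+ 2 by rewrite mulr_ge0// invr_ge0 ltW.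
have -> : x^-1 * (x * y - z) ^+ 2 = x * y ^+ 2 + x^-1 * z ^+ 2 - 2 * (y * z).
  by field; rewrite gt_eqF.
by move: (x * _) (x^-1 * _) (y * z); clear; move=> ? ? ?; lra.
Qed.

(* Split at [|u_j| = rho]: inside, the level-k part is small because
   [h_{a_j}^2] is of size [O(k^{-1/2})]; outside, the level-l part is small
   because it is concentrated at scale [M_l]. *)
Lemma hsum_pair (j : 'I_n) k l s t c c' : (l <= k)%N -> uniq s -> uniq t ->
  (forall a, a \in s -> size_mi a = k) -> (forall b, b \in t -> size_mi b = l) ->
  (forall a, a \in s -> lev k <= n%:R * (a j).*2.+1%:R) ->
  \int[lebn]_u (hsum (kap k) s c u * hsum (kap l) t c' u) <=
  (13 + n%:R) * theta k l * (lev k / lev l * (\sum_(a <- s) c a ^+ 2) +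
                          lev l / lev k * (\sum_(b <- t) c' b ^+ 2)).
Proof.
move=> lk us ut sk tl sj.
set A := \sum_(a <- s) _; set B := \sum_(b <- t) _.
have K0 := lev_gt0 k; have L0 := lev_gt0 l.
have LK : lev l <= lev k by exact: le_lev.
have th0 := theta_gt0 k l.
have th4 : theta k l ^+ 4 = lev l / lev k.
  by rewrite /theta (minn_idPr lk) (maxn_idPl lk) expr_div_n !qlev4.
have th1 : theta k l <= 1.
  by rewrite /theta (minn_idPr lk) (maxn_idPl lk) ler_pdivrMr ?qlev_gt0// mul1r le_qlev.
have N1 : 1 <= n%:R :> R by rewrite ler1n.
have levlE : lev l = 2 * l%:R + n%:R by rewrite /lev natrD natrM.
have kapkE : kap k = nu / lev k by [].
have kaplE : kap l = nu / lev l by [].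
move: (lev k) (lev l) (theta k l) (n%:R : R) K0 L0 LK th0 th4 th1 N1 levlE kapkE kaplE sj.
move=> K L th N K0 L0 LK th0 th4 th1 N1 levlE kapkE kaplE sj.
have N0 : 0 < N by exact: lt_le_trans N1.
(* This radius gives [kap k * rho^2 = L / (2N)] and [kap l * rho^2 = K / (2N)]. The first stays in
   the range of [hermite_bound], as [L <= K <= N (2 a_j + 1)]; the second, with
   [b_j + 1/2 <= L / 2], makes the tail at most [N L / K]. *)
pose rho := Num.sqrt (L * K / (2 * N) / nu).
have LKN0 : 0 < L * K / (2 * N) / nu by rewrite !divr_gt0// !mulr_gt0.
have rho0 : 0 < rho by rewrite sqrtr_gt0.
have rho2 : rho ^+ 2 = L * K / (2 * N) / nu by rewrite sqr_sqrtr// ltW.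
pose D : set R := `[- rho, rho]%classic.
have mD : measurable D by exact: measurable_itv.
have mDC : measurable (~` D) by exact: measurableC.
pose U := hsum (kap k) s c; pose V := hsum (kap l) t c'.
have [iU eU] := hsum_sqr c j (kap_gt0 k) us sk.
have [iV eV] := hsum_sqr c' j (kap_gt0 l) ut tl.
have [iUD _] := hsum_sqr_integral c j (kap_gt0 k) mD us sk.
have [iVD _] := hsum_sqr_integral c' j (kap_gt0 l) mDC ut tl.
(* The square of the local bound is [128 L / (N (2 a_j + 1))], at most [128 L / K = 128 th^4]; the
   constant 12 is enough because [12^2 = 144]. *)
have leU : \int[lebn]_u (\1_D (tnth u j) * U u ^+ 2) <= 12 * th ^+ 2 * A.
  apply: (hsum_sqr_le c (kap_gt0 k) mD us sk) => a sa.
  have aj0 : 0 < (a j).*2.+1%:R :> R by rewrite ltr0n.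
  have h := sj a sa.
  apply: le_trans (shermite_local (kap_gt0 k) rho0 _) _.
    rewrite rho2 kapkE.
    have -> : nu / K * (L * K / (2 * N) / nu) = L / N / 2.
      by field; rewrite !gt_eqF.
    by rewrite ler_pM2r ?invr_gt0// ler_pdivrMr// mulrC (le_trans LK).
  rewrite ler_pdivrMr ?sqrtr_gt0//; move: (_.*2.+1%:R) aj0 h => E aj0 h.
  rewrite -ler_sqr ?nnegrE; last 2 first.
  - by rewrite !mulr_ge0// sqrtr_ge0.
  - by rewrite !mulr_ge0// ?sqr_ge0 ?(ltW th0) ?sqrtr_ge0.
  rewrite [(16 * _) ^+ 2]exprMn [(_ * rho) ^+ 2]exprMn [(12 * _ * _) ^+ 2]exprMn
    [(12 * _) ^+ 2]exprMn sqr_sqrtr ?(ltW (kap_gt0 k))// rho2 sqr_sqrtr ?(ltW aj0)//.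
  rewrite -exprM th4 kapkE.
  have -> : 16 ^+ 2 * (nu / K * (L * K / (2 * N) / nu)) = 128 * L / N by field; rewrite !gt_eqF.
  rewrite ler_pdivrMr//.
  have -> : 12 ^+ 2 * (L / K) * E * N = 144 * (N * E) * (L / K) by ring.
  apply: (@le_trans _ _ (144 * K * (L / K))).
    have -> : 144 * K * (L / K) = 144 * L by field; rewrite gt_eqF.
    by apply: ler_wpM2r; [exact: ltW|rewrite ler_nat].
  by rewrite ler_wpM2r ?(divr_ge0 (ltW L0) (ltW K0))// ler_wpM2l.
(* The tail bound carries [th^4]; it is relaxed to [th^2], the power available on the inner
   region. *)
have leV : \int[lebn]_u (\1_(~` D) (tnth u j) * V u ^+ 2) <= N * th ^+ 2 * B.
  apply: (hsum_sqr_le c' (kap_gt0 l) mDC ut tl) => b tb.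
  apply: le_trans (shermite_tail _ (kap_gt0 l) rho0) _.
  rewrite rho2 kaplE.
  have -> : nu / L * (L * K / (2 * N) / nu) = K / N / 2 by field; rewrite !gt_eqF.
  rewrite ler_pdivrMr ?divr_gt0//.
  have bl : (b j)%:R + 2^-1 <= L / 2.
    have : (b j <= l)%N by rewrite -(tl b tb) /size_mi (bigD1 j)//= leq_addr.
    by rewrite -(ler_nat R) levlE => h; move: h N1; clear; lra.
  apply: (le_trans bl).
  have -> : N * th ^+ 2 * (K / N / 2) = th ^+ 2 * K / 2 by field; rewrite gt_eqF.
  rewrite ler_pM2r ?invr_gt0// -ler_pdivrMr// -th4.
  by rewrite -[X in _ <= X]mulr1 -[4%N]/(2 + 2)%N exprD ler_wpM2l ?sqr_ge0// exprn_ile1// ltW.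
(* Weights for the arithmetic-geometric inequality on the two regions. They turn all four terms into
   multiples of [th * (K / L * A)], with coefficients 12 and 1, or of [th * (L / K * B)], with
   coefficients 1 and [N]; hence the constant [13 + N]. *)
pose t1 := K / (L * th); pose t2 := th * K / L.
have t10 : 0 < t1 by rewrite divr_gt0// mulr_gt0.
have t20 : 0 < t2 by rewrite divr_gt0// mulr_gt0.
pose W u := 2^-1 * (t1 * (\1_D (tnth u j) * U u ^+ 2) + t1^-1 * V u ^+ 2 +
  (t2 * U u ^+ 2 + t2^-1 * (\1_(~` D) (tnth u j) * V u ^+ 2))).
have i12 := integD (integZl t1 iUD) (integZl t1^-1 iV).
have i34 := integD (integZl t2 iU) (integZl t2^-1 iVD).
have iW : integ lebn W by exact: integZl (integD i12 i34).
apply: (@le_trans _ _ (\int[lebn]_u W u)).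
  apply: le_Rint => //.
    by apply: integM => //; exact: measurable_hsum.
  move=> u; rewrite /W -/(U u) -/(V u) !indicE in_setC.
  case: (tnth u j \in D) => /=; rewrite ?mul1r ?mul0r ?mulr0.
    apply: le_trans (amgm _ _ t10) _; rewrite mulrC ler_wpM2l// lerDl addr0.
    by rewrite mulr_ge0 ?sqr_ge0 ?ltW.
  apply: le_trans (amgm _ _ t20) _; rewrite mulrC ler_wpM2l// lerDr add0r.
  by rewrite mulr_ge0 ?sqr_ge0 ?invr_ge0 ?ltW.
rewrite /W RintZl; last exact: integD i12 i34.
rewrite (RintD i12 i34) (RintD (integZl t1 iUD) (integZl t1^-1 iV)) (RintD (integZl t2 iU) (integZl t2^-1 iVD)).
rewrite (RintZl t1 iUD) (RintZl t1^-1 iV) (RintZl t2 iU) (RintZl t2^-1 iVD) eU eV -/A -/B.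
have A0 : 0 <= A by apply: sumr_ge0 => a _; exact: sqr_ge0.
have B0 : 0 <= B by apply: sumr_ge0 => a _; exact: sqr_ge0.
have e1 : t1 * (12 * th ^+ 2 * A) = 12 * (th * (K / L * A)) by rewrite /t1; field; rewrite !gt_eqF.
have e2 : t1^-1 * B = th * (L / K * B) by rewrite /t1; field; rewrite !gt_eqF.
have e3 : t2 * A = th * (K / L * A) by rewrite /t2; field; rewrite !gt_eqF.
have e4 : t2^-1 * (N * th ^+ 2 * B) = N * (th * (L / K * B)) by rewrite /t2; field; rewrite !gt_eqF.
have := ler_wpM2l (ltW t10) leU; have h2 : 0 <= t2^-1 by rewrite invr_ge0 ltW.
have := ler_wpM2l h2 leV; rewrite e1 e2 e3 e4.
have x0 := mulr_ge0 (ltW th0) (mulr_ge0 (divr_ge0 (ltW K0) (ltW L0)) A0).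
have y0 := mulr_ge0 (ltW th0) (mulr_ge0 (divr_ge0 (ltW L0) (ltW K0)) B0).
rewrite -[(13 + N) * th * _]mulrA [th * (_ + _)]mulrDr; move: x0 y0.
move: (th * (K / L * A)) (th * (L / K * B)) => x y x0 y0.
set I1 := \int[_]__ _ => h1; set I2 := \int[_]__ _ => h3.
rewrite mulrDr !mulrDl; move: h1 h3 x0 y0 (mulr_ge0 (ltW N0) x0) (mulr_ge0 (ltW N0) y0).
move: (t1 * I2) (t2^-1 * I1) (N * x) (N * y); clear; move=> a b c d; lra.
Qed.

End almost_orthogonality.

(** * A Bessel inequality with level-dependent scales *)

Lemma sum_by_fibers (R : nmodType) (I : eqType) (s : seq I) (f : I -> nat) (K : nat)
    (F : I -> R) : (forall a, a \in s -> (f a < K)%N) ->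
  \sum_(k < K) \sum_(a <- [seq a <- s | f a == k]) F a = \sum_(a <- s) F a.
Proof.
move=> fK; under eq_bigr do rewrite big_filter big_mkcond.
rewrite exchange_big /= big_seq [RHS]big_seq; apply: eq_bigr => a sa.
rewrite (bigD1 (Ordinal (fK a sa)))//= eqxx big1 ?addr0// => i.
by rewrite eq_sym -val_eqE /= => /negbTE ->.
Qed.

Section bessel.
Context {R : realType} (n : nat).
Hypothesis n_gt0 : (0 < n)%N.
Variable nu : R.
Hypothesis nu_gt0 : 0 < nu.
Notation tR := (n.-tuple (measurableTypeR R)).
Notation lebn := (@lebesgue_tuple R n).
Notation lev := (@lev R n).
Notation kap := (@kap R n nu).
Notation theta := (@theta R n).
Implicit Types (a b : multi_index n) (k l m : nat) (u : tR) (s t : seq (multi_index n)).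
Implicit Types (c : multi_index n -> R).

Let jmax a : 'I_n := [arg max_(j > Ordinal n_gt0) a j].

(** The level [2|a| + n] is the sum of the [n] numbers [2 a_j + 1], hence at most [n] times the
    largest. *)
Let lev_jmax a : lev (size_mi a) <= n%:R * (a (jmax a)).*2.+1%:R.
Proof.
rewrite -natrM ler_nat /size_mi mulnS addnC leq_add2l -mul2n mulnCA leq_mul2l /=.
have -> : (n * a (jmax a) = \sum_(j < n) a (jmax a))%N by rewrite sum_nat_const card_ord.
apply: leq_sum => i _.
by rewrite /jmax; case: arg_maxnP => //= j _; exact.
Qed.

Let piece s k := [seq a <- s | size_mi a == k].

Let piece_size s k a : a \in piece s k -> size_mi a = k.
Proof. by rewrite mem_filter => /andP[/eqP]. Qed.

(** Dividing the level-[k] piece by the value of [jmax] gives classes on each of which [hsum_pair]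
    applies with one fixed coordinate. The level-[l] piece is counted once per class, whence the
    extra factor [n]. *)
Let hsum_piece_pair s c k l : (l <= k)%N -> uniq s ->
  \int[lebn]_u (hsum (kap k) (piece s k) c u * hsum (kap l) (piece s l) c u) <=
  (13 + n%:R) * n%:R * theta k l * (lev k / lev l * (\sum_(a <- piece s k) c a ^+ 2) +
                          lev l / lev k * (\sum_(b <- piece s l) c b ^+ 2)).
Proof.
move=> lk us.
have u_ m : uniq (piece s m) by exact: filter_uniq.
pose sub j := [seq a <- piece s k | nat_of_ord (jmax a) == j].
have us_ j : uniq (sub j) by exact: filter_uniq.
have ss j a : a \in sub j -> size_mi a = k.
  by rewrite mem_filter => /andP[_]; exact: piece_size.
have E u : hsum (kap k) (piece s k) c u = \sum_(j < n) hsum (kap k) (sub j) c u.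
  by rewrite /hsum sum_by_fibers.
have j0 : 'I_n := Ordinal n_gt0.
have k0 := kap_gt0 n_gt0 nu_gt0.
have iV := (hsum_sqr c j0 (k0 l) (u_ l) (@piece_size s l)).1.
have iUV j : integ lebn (fun u => hsum (kap k) (sub j) c u * hsum (kap l) (piece s l) c u).
  apply: integM => //; try exact: measurable_hsum.
  exact: (hsum_sqr c j0 (k0 k) (us_ j) (@ss j)).1.
under eq_Rint do rewrite E mulr_suml.
rewrite Rint_sum; last by move=> i; exact: iUV.
apply: (@le_trans _ _ (\sum_(j < n) (13 + n%:R) * theta k l *
   (lev k / lev l * (\sum_(a <- sub j) c a ^+ 2) +
    lev l / lev k * (\sum_(b <- piece s l) c b ^+ 2)))).
  apply: ler_sum => j _.
  apply: (hsum_pair n_gt0 nu_gt0 c c lk (us_ j) (u_ l) (@ss j) (@piece_size s l) (j := j)).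
  move=> a; rewrite mem_filter => /andP[/eqP/ord_inj <- /piece_size <-].
  exact: lev_jmax.
rewrite -mulr_sumr big_split /= -mulr_sumr sum_by_fibers//.
rewrite sumr_const card_ord.
have A0 : 0 <= \sum_(a <- piece s k) c a ^+ 2 by apply: sumr_ge0 => a _; exact: sqr_ge0.
have N1 : 1 <= n%:R :> R by rewrite ler1n.
have M0 m : 0 < lev m by exact: lev_gt0.
have t0 : 0 < theta k l by exact: theta_gt0.
have x0 := mulr_ge0 (divr_ge0 (ltW (M0 k)) (ltW (M0 l))) A0.
move: x0; set x := _ * (\sum_(a <- piece s k) _); set y := lev l / _ * _ => x0.
rewrite -[y *+ n]mulr_natl.
have -> : (13 + n%:R) * n%:R * theta k l * (x + y) =
    (13 + n%:R) * theta k l * (n%:R * x + n%:R * y) by ring.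
apply: ler_wpM2l; first by rewrite mulr_ge0 ?addr_ge0// ltW.
by rewrite lerD2r ler_peMl.
Qed.

(** The pair constant [(13 + n) n] times the row-sum bound 5, doubled because the pair bound has one
    term for each of the two levels. *)
Definition bessel_const : R := 10 * ((13 + n%:R) * n%:R).

Definition synth s c (u : tR) : R :=
  \sum_(a <- s) c a * nhermite (kap (size_mi a)) a u.

Lemma measurable_synth s c : measurable_fun setT (synth s c).
Proof.
apply: measurable_sum => a; apply: measurable_funM; first exact: measurable_cst.
exact: measurable_nhermite.
Qed.

(** Schur's test over pairs of levels: [hsum_piece_pair] bounds a pair by [M_k A_k theta / M_l] plus
    the same with [k] and [l] exchanged, and [sum_theta_lev] sums over the index that [A] does not
    contain. *)
Lemma synth_sqr_le s c : uniq s ->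
  integ lebn (fun u => synth s c u ^+ 2) /\
  \int[lebn]_u (synth s c u ^+ 2) <=
  bessel_const * \sum_(a <- s) lev (size_mi a) * c a ^+ 2.
Proof.
move=> us.
pose K := (\max_(a <- s) size_mi a).+1.
have sK a : a \in s -> (size_mi a < K)%N.
  by move=> sa; rewrite ltnS (bigD1_seq a)//= leq_maxl.
pose U k := hsum (kap k) (piece s k) c.
have u_ m : uniq (piece s m) by exact: filter_uniq.
have j0 : 'I_n := Ordinal n_gt0.
have k0 := kap_gt0 n_gt0 nu_gt0.
have iU k := (hsum_sqr c j0 (k0 k) (u_ k) (@piece_size s k)).1.
have E u : synth s c u = \sum_(k < K) U k u.
  rewrite /synth -(sum_by_fibers _ sK); apply: eq_bigr => k _.
  by apply: eq_big_seq => a /piece_size ->.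
have iUU k l : integ lebn (fun u => U k u * U l u).
  by apply: integM => //; try exact: measurable_hsum; exact: iU.
have E2 u : synth s c u ^+ 2 = \sum_(k < K) \sum_(l < K) U k u * U l u.
  by rewrite E expr2 big_distrlr.
have i2 (k : 'I_K) : integ lebn (fun u => \sum_(l < K) U k u * U l u).
  by apply: integ_sum => l _; exact: iUU.
split.
  apply: (@eq_integ _ _ _ _ (fun u => \sum_(k < K) \sum_(l < K) U k u * U l u)).
    by move=> u; rewrite E2.
  by apply: integ_sum => k _; exact: i2.
under eq_Rint do rewrite E2.
rewrite Rint_sum//.
pose A k := \sum_(a <- piece s k) c a ^+ 2.
pose C1 : R := (13 + n%:R) * n%:R.
have C10 : 0 <= C1 by rewrite mulr_ge0// addr_ge0.
have A0 k : 0 <= A k by apply: sumr_ge0 => a _; exact: sqr_ge0.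
have M0 m : 0 < lev m by exact: lev_gt0.
have pair k l : \int[lebn]_u (U k u * U l u) <=
    C1 * (lev k * A k * (theta k l / lev l) + lev l * A l * (theta k l / lev k)).
  have -> : C1 * (lev k * A k * (theta k l / lev l) + lev l * A l * (theta k l / lev k)) =
    C1 * theta k l * (lev k / lev l * A k + lev l / lev k * A l) by ring.
  have [lk|/ltnW kl] := leqP l k; first exact: hsum_piece_pair.
  rewrite thetaC addrC; apply: le_trans (hsum_piece_pair c kl us).
  by under eq_Rint do rewrite mulrC.
apply: (@le_trans _ _ (\sum_(k < K) \sum_(l < K)
    C1 * (lev k * A k * (theta k l / lev l) + lev l * A l * (theta k l / lev k)))).
  apply: ler_sum => k _; rewrite Rint_sum; last by move=> l; exact: iUU.
  by apply: ler_sum => l _; exact: pair.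
under eq_bigr do rewrite -mulr_sumr big_split /=.
rewrite -mulr_sumr big_split /= [X in _ + X]exchange_big /=.
have -> : \sum_(j < K) \sum_(i < K) lev j * A j * (theta i j / lev i) =
    \sum_(i < K) \sum_(i0 < K) lev i * A i * (theta i i0 / lev i0).
  by apply: eq_bigr => i _; apply: eq_bigr => j _; rewrite thetaC.
have h : \sum_(i < K) \sum_(i0 < K) lev i * A i * (theta i i0 / lev i0) <=
    5 * \sum_(i < K) lev i * A i.
  rewrite mulr_sumr; apply: ler_sum => i _; rewrite -mulr_sumr mulrC.
  by rewrite ler_wpM2r ?sum_theta_lev// mulr_ge0// ltW.
have -> : \sum_(a <- s) lev (size_mi a) * c a ^+ 2 = \sum_(i < K) lev i * A i.
  rewrite -(sum_by_fibers _ sK); apply: eq_bigr => k _; rewrite mulr_sumr.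
  by apply: eq_big_seq => a /piece_size ->.
rewrite /bessel_const -/C1.
have -> (S : R) : 10 * C1 * S = C1 * (5 * S + 5 * S) by ring.
by rewrite ler_wpM2l// lerD.
Qed.

Lemma bessel_const_gt0 : 0 < bessel_const.
Proof.
have N1 : 0 < n%:R :> R by rewrite ltr0n.
by rewrite !mulr_gt0// addr_gt0.
Qed.

(* Dual form of [synth_sqr_le]: the functions at different levels use different
   scales [nu / M_k], so they are not orthogonal, only almost so. *)
Lemma bessel s (g : tR -> R) : uniq s -> measurable_fun setT g ->
  integ lebn (fun u => g u ^+ 2) ->
  \sum_(a <- s) (\int[lebn]_u (g u * nhermite (kap (size_mi a)) a u)) ^+ 2 / lev (size_mi a) <=
  bessel_const * \int[lebn]_u (g u ^+ 2).
Proof.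
move=> us mg ig.
pose al a := \int[lebn]_u (g u * nhermite (kap (size_mi a)) a u).
(* With these coefficients both the pairing of [g] with [synth s c] and the weighted sum on the
   right of [synth_sqr_le] are equal to [S]. *)
pose c a := al a / lev (size_mi a).
have [iG leG] := synth_sqr_le c us.
set S := \sum_(a <- s) _.
have M0 m : 0 < lev m by exact: lev_gt0.
have k0 := kap_gt0 n_gt0 nu_gt0.
have j0 : 'I_n := Ordinal n_gt0.
have inh a : integ lebn (fun u => nhermite (kap (size_mi a)) a u ^+ 2).
  apply: eq_integ (nhermite_integral a a j0 (k0 (size_mi a)) (@measurableT _ R)).1 => u.
  by rewrite indicT mul1r expr2.
have ign a : integ lebn (fun u => g u * nhermite (kap (size_mi a)) a u).
  by apply: integM => //; exact: measurable_nhermite.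
have igG : \int[lebn]_u (g u * synth s c u) = S.
  have E u : g u * synth s c u =
      \sum_(a <- s) c a * (g u * nhermite (kap (size_mi a)) a u).
    by rewrite mulr_sumr; apply: eq_bigr => a _; ring.
  under eq_Rint do rewrite E.
  rewrite Rint_sum; last by move=> a; exact: integZl.
  by apply: eq_bigr => a _; rewrite RintZl// /c /al; ring.
have leGS : \int[lebn]_u (synth s c u ^+ 2) <= bessel_const * S.
  apply: (le_trans leG); rewrite ler_wpM2l ?(ltW bessel_const_gt0)//.
  rewrite le_eqVlt; apply/orP; left; apply/eqP; apply: eq_bigr => a _.
  rewrite /c -/(al a); move: (lev _) (M0 (size_mi a)) (al a) => M MM x.
  by field; rewrite gt_eqF.
have C0 := bessel_const_gt0.
(* Integrated form of [2xy <= C x^2 + y^2 / C]. The last term will be at most [S], so one of the two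
   copies of [S] is absorbed. *)
have h : 2 * S <= bessel_const * \int[lebn]_u (g u ^+ 2) +
    bessel_const^-1 * \int[lebn]_u (synth s c u ^+ 2).
  rewrite -igG -!RintZl//; last by apply: integM => //; exact: measurable_synth.
  rewrite -RintD; [|exact: integZl|exact: integZl].
  apply: le_Rint.
  - by apply: integZl; apply: integM => //; exact: measurable_synth.
  - by apply: integD; exact: integZl.
  move=> u; move: (g u) (synth s c u) => x y.
  have : 0 <= bessel_const^-1 * (bessel_const * x - y) ^+ 2.
    by rewrite mulr_ge0 ?sqr_ge0// invr_ge0 ltW.
  have -> : bessel_const^-1 * (bessel_const * x - y) ^+ 2 =
    bessel_const * x ^+ 2 + bessel_const^-1 * y ^+ 2 - 2 * (x * y).
    by field; rewrite gt_eqF.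
  by rewrite subr_ge0.
have : bessel_const^-1 * \int[lebn]_u (synth s c u ^+ 2) <= S.
  by rewrite ler_pdivrMl.
move=> hS; move: h; rewrite mulr_natl mulr2n => h.
by have := le_trans h (lerD (lexx _) hS); rewrite lerD2r.
Qed.

End bessel.

(** * Fourier transform with an exponential weight *)

Section parametric_integrals.
Context d1 d2 (T1 : measurableType d1) (T2 : measurableType d2) (R : realType).
Variable m2 : {sigma_finite_measure set T2 -> \bar R}.

(** The integral is [fine] of a difference of two Tonelli integrals, those of the positive and
    negative parts, each measurable in the parameter. *)
Lemma measurable_Rint (f : T1 * T2 -> R) : measurable_fun setT f ->
  measurable_fun setT (fun x => \int[m2]_y f (x, y)).
Proof.
move=> mf; have mf' : measurable_fun setT (EFin \o f) by exact/measurable_EFinP.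
rewrite /Rintegral; apply: (measurableT_comp (@measurable_realfun.fine_measurable R _ measurableT)) => //.
have -> : (fun x => \int[m2]_y (f (x, y))%:E)%E =
    (fun x => fubini_F m2 (EFin \o f)^\+ x - fubini_F m2 (EFin \o f)^\- x)%E.
  apply/funext => x; rewrite integralE /fubini_F.
  by congr (_ - _)%E; apply: eq_integral => y _; rewrite ?funeposE ?funenegE.
apply: emeasurable_funB; apply: measurable_fun_fubini_tonelli_F => //.
- exact: measurable_funepos.
- exact: measurable_funeneg.
Qed.

Lemma measurable_slice1 (f : T1 * T2 -> R) x : measurable_fun setT f ->
  measurable_fun setT (fun y => f (x, y)).
Proof. by move=> mf; exact: (measurableT_comp mf (pair1_measurable x)). Qed.

Lemma measurable_slice2 (f : T1 * T2 -> R) y : measurable_fun setT f ->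
  measurable_fun setT (fun x => f (x, y)).
Proof. by move=> mf; exact: (measurableT_comp mf (pair2_measurable y)). Qed.

End parametric_integrals.

Section cauchy_schwarz.
Context d (T : measurableType d) (R : realType).
Variable m : {sigma_finite_measure set T -> \bar R}.

(** Lagrange's identity: both sides are double integrals, and their difference is half the integral
    of [(f(x) g(y) - g(x) f(y))^2]. *)
Lemma Rint_cauchy_schwarz (f g : T -> R) :
  measurable_fun setT f -> measurable_fun setT g ->
  integ m (fun x => f x ^+ 2) -> integ m (fun x => g x ^+ 2) ->
  (\int[m]_x (f x * g x)) ^+ 2 <= \int[m]_x (f x ^+ 2) * \int[m]_x (g x ^+ 2).
Proof.
move=> mf mg f2 g2; have fg := integM mf mg f2 g2.
rewrite expr2 -(Rint_tensor fg fg).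
have -> : \int[m]_x f x ^+ 2 * \int[m]_x g x ^+ 2 =
    \int[(m \x m)%E]_p (2^-1 * (f p.1 ^+ 2 * g p.2 ^+ 2 + g p.1 ^+ 2 * f p.2 ^+ 2)).
  have i1 := integ_tensor f2 g2; have i2 := integ_tensor g2 f2.
  rewrite RintZl; last exact: (integD i1 i2).
  by rewrite (RintD i1 i2) (Rint_tensor f2 g2) (Rint_tensor g2 f2); field.
apply: le_Rint; first exact: (integ_tensor fg fg).
  exact: integZl (integD (integ_tensor f2 g2) (integ_tensor g2 f2)).
move=> p; have := sqr_ge0 (f p.1 * g p.2 - g p.1 * f p.2); lra.
Qed.

End cauchy_schwarz.

Section laplace_kernel.
Context {R : realType}.
Notation leb := (@lebesgue_measure R).

Lemma expRN_le (x : R) : 0 <= x -> expR (- x) <= 2 / (1 + x ^+ 2).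
Proof.
move=> x0; rewrite expRN -[leLHS]mul1r ler_pdivrMr ?expR_gt0//.
have p : 0 < 1 + x ^+ 2 by rewrite ltr_wpDr ?sqr_ge0.
rewrite mulrAC ler_pdivlMr// mul1r.
have := expR_ge1Dxn 1 x0; have := sqr_ge0 x; rewrite (_ : 2`! = 2)//; lra.
Qed.

Lemma expRN_norm_le (x : R) : expR (- `|x|) <= 2 / (1 + x ^+ 2).
Proof. by rewrite -(real_normK (num_real x)); exact: expRN_le. Qed.

Lemma continuous_expRN_norm : continuous (fun x : R => expR (- `|x|)).
Proof.
move=> x; apply: continuous_comp; last exact: continuous_expR.
by apply: cvgN; exact: norm_continuous.
Qed.

Lemma measurable_expRN_norm : measurable_fun setT (fun x : R => expR (- `|x|)).
Proof. by apply: continuous_measurable_fun; exact: continuous_expRN_norm. Qed.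

Lemma integ_expRN_norm : integ leb (fun x : R => expR (- `|x|)).
Proof.
apply: integ_le_inv1Dsqr; first exact: measurable_expRN_norm.
by move=> x; rewrite ger0_norm ?expR_ge0//; exact: expRN_norm_le.
Qed.

Lemma Rint_expRN_cos (a : R) :
  \int[leb]_x (expR (- `|x|) * cos (x * a)) = 2 / (1 + a ^+ 2).
Proof.
have p : 0 < 1 + a ^+ 2 by rewrite ltr_wpDr ?sqr_ge0.
have ccos : continuous (fun x : R => cos (x * a)).
  move=> x; apply: continuous_comp; last exact: continuous_cos.
  exact: mulrr_continuous.
rewrite (@Rintegral_even _ _ 2); last 3 first.
- by move=> x; apply: cvgM; [exact: continuous_expRN_norm|exact: ccos].
- by move=> x; rewrite normrN mulNr cosN.
- move=> x; rewrite normrM ger0_norm ?expR_ge0//.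
  by apply: le_trans (expRN_norm_le x); rewrite ler_piMr ?expR_ge0// cos_max.
(* An explicit primitive on the half-line, where the absolute value disappears; it tends to 0 at
   infinity and is [- (1 + a^2)^-1] at 0. *)
pose F x := (1 + a ^+ 2)^-1 * (expR (- x) * (a * sin (x * a) - cos (x * a))).
have dF (x : R) : is_derive x (1 : R) F (expR (- x) * cos (x * a)).
  have dE : is_derive x (1 : R) (fun x : R => expR (- x)) (expR (- x) * -1).
    exact: (is_derive1_comp (g := -%R) (is_derive_expR (- x)) (is_deriveN (is_derive_id x 1))).
  have dm : is_derive x (1 : R) (fun x => x * a) a.
    have -> : (fun x : R => x * a) = (fun x => a * x) by apply/funext => y; rewrite mulrC.
    by rewrite -[X in is_derive _ _ _ X]mulr1; exact: (is_deriveZ a (is_derive_id x 1)).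
  have dS : is_derive x (1 : R) (fun x => sin (x * a)) (cos (x * a) * a).
    exact: (is_derive1_comp (g := fun x => x * a) (is_derive_sin (x * a)) dm).
  have dC : is_derive x (1 : R) (fun x => cos (x * a)) (- sin (x * a) * a).
    exact: (is_derive1_comp (g := fun x => x * a) (is_derive_cos (x * a)) dm).
  have dD : is_derive x (1 : R) (fun x => a * sin (x * a) - cos (x * a))
      (a * (cos (x * a) * a) - (- sin (x * a) * a)).
    by apply: is_deriveB; exact: (is_deriveZ a dS).
  have h := is_deriveZ (1 + a ^+ 2)^-1 (is_deriveM dE dD).
  have -> : expR (- x) * cos (x * a) = (1 + a ^+ 2)^-1 *
     (expR (- x) * (a * (cos (x * a) * a) - (- sin (x * a) * a)) +
      (a * sin (x * a) - cos (x * a)) * (expR (- x) * -1)).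
    by field; rewrite gt_eqF.
  exact: h.
have E : \int[leb]_(x in `[0, +oo[) (expR (- `|x|) * cos (x * a)) =
    \int[leb]_(x in `[0, +oo[) (expR (- x) * cos (x * a)).
  by apply: eq_Rintegral => x; rewrite inE/= in_itv/= andbT => x0; rewrite ger0_norm.
have cf : continuous (fun x : R => expR (- x) * cos (x * a)).
  move=> x; apply: cvgM; last exact: ccos.
  apply: continuous_comp; last exact: continuous_expR.
  exact: opp_continuous.
have bf (x : R) : 0 <= x -> `|expR (- x) * cos (x * a)| <= 2 / (1 + x ^+ 2).
  move=> x0; rewrite normrM ger0_norm ?expR_ge0//.
  by apply: le_trans (expRN_le x0); rewrite ler_piMr ?expR_ge0// cos_max.
have F0 : F x @[x --> +oo%R] --> 0.
  apply: (@cvg_le_inv1Dsqr _ _ ((1 + a ^+ 2)^-1 * (2 * (`|a| + 1)))) => x x0.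
  rewrite /F !normrM ger0_norm ?invr_ge0 ?(ltW p)// -mulrA ler_wpM2l ?invr_ge0 ?(ltW p)//.
  rewrite (ger0_norm (expR_ge0 _)) mulrAC; apply: ler_pM => //; first exact: expRN_le.
  rewrite (le_trans (ler_normB _ _))// lerD ?cos_max// normrM ler_piMr// sin_max//.
rewrite E (Rintegral_FTC2y cf bf dF F0).
by rewrite /F oppr0 expR0 mul0r sin0 cos0 mulr0 sub0r mul1r mulrN1 opprK.
Qed.

End laplace_kernel.

(* The instance for products of probabilities shadows the canonical sigma-finite
   structure of a product measure. *)
Section sigma_finite_product.
Context d1 d2 (T1 : measurableType d1) (T2 : measurableType d2) (R : realType).
Variables (m1 : {sigma_finite_measure set T1 -> \bar R})
  (m2 : {sigma_finite_measure set T2 -> \bar R}).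

Let sigma_finite_prod : sigma_finite setT (m1 \x m2)%E.
Proof.
have /sigma_finiteP[F [TF ndF Foo]] := sigma_finiteT m1.
have /sigma_finiteP[G [TG ndG Goo]] := sigma_finiteT m2.
exists (fun k => F k `*` G k).
  rewrite -setXTT TF TG; apply/seteqP; split=> -[x y].
    move=> [/= [k _ Fkx] [l _ Gly]]; exists (maxn k l) => //; split.
    - by move: x Fkx; exact/subsetPset/ndF/leq_maxl.
    - by move: y Gly; exact/subsetPset/ndG/leq_maxr.
  by move=> [k _ []/= ? ?]; split; exists k.
move=> k; have [? ?] := Foo k; have [? ?] := Goo k; split; first exact: measurableX.
by rewrite product_measure1E// lte_mul_pinfty// ge0_fin_numE.
Qed.

Definition sigma_prod : {sigma_finite_measure set (T1 * T2)%type -> \bar R} :=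
  HB.pack (m1 \x m2)%E (Measure_isSigmaFinite.Build _ _ _ _ sigma_finite_prod).

End sigma_finite_product.

(** * The weighted Plancherel bound and its convolution estimate *)

Section weighted_fourier.
Context {R : realType}.
Notation leb := (@lebesgue_measure R).
Notation leb2 := (leb \x leb)%E.
Notation mR := (measurableTypeR R).

Lemma measurable_cosM (a : R) : measurable_fun setT (fun s : mR => cos (a * s) : mR).
Proof.
apply: continuous_measurable_fun => x; apply: continuous_comp.
  exact: mulrl_continuous.
exact: continuous_cos.
Qed.

Lemma measurable_sinM (a : R) : measurable_fun setT (fun s : mR => sin (a * s) : mR).
Proof.
apply: continuous_measurable_fun => x; apply: continuous_comp.
  exact: mulrl_continuous.
exact: continuous_sin.
Qed.

Lemma integ_cosM (a : R) (h : R -> R) : integ leb h -> integ leb (fun s => cos (a * s) * h s).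
Proof.
move=> ih; apply: (@le_integ _ _ _ leb _ (fun s => `|h s|)).
- by apply: measurable_funM; [exact: measurable_cosM|exact: integ_measurable ih].
- by move=> s; rewrite normrM ler_piMl// cos_max.
- exact: integ_norm.
Qed.

Lemma integ_sinM (a : R) (h : R -> R) : integ leb h -> integ leb (fun s => sin (a * s) * h s).
Proof.
move=> ih; apply: (@le_integ _ _ _ leb _ (fun s => `|h s|)).
- by apply: measurable_funM; [exact: measurable_sinM|exact: integ_measurable ih].
- by move=> s; rewrite normrM ler_piMl// sin_max.
- exact: integ_norm.
Qed.

(** The Fourier transform of [exp(-|v|)], by [Rint_expRN_cos]. *)
Definition lorentz (x : R) : R := 2 / (1 + x ^+ 2).

Lemma lorentz_ge0 x : 0 <= lorentz x.
Proof. by rewrite divr_ge0// addr_ge0// sqr_ge0. Qed.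

Lemma lorentz_le2 x : lorentz x <= 2.
Proof.
by rewrite /lorentz ler_pdivrMr ?ltr_wpDr ?sqr_ge0// ler_peMr// lerDl sqr_ge0.
Qed.

Lemma lorentzBC x y : lorentz (x - y) = lorentz (y - x).
Proof. by rewrite /lorentz -sqrrN opprB. Qed.

Lemma continuous_lorentz : continuous lorentz.
Proof. by move=> x; apply: cvgM; [exact: cvg_cst|exact: continuous_inv1Dsqr]. Qed.

Lemma measurable_lorentzB : measurable_fun setT (fun p : mR * mR => lorentz (p.1 - p.2)).
Proof.
apply: (@measurableT_comp _ _ _ _ _ _ lorentz _ (fun p : mR * mR => p.1 - p.2 : mR)).
  by apply: continuous_measurable_fun; exact: continuous_lorentz.
by apply: measurable_funB; [exact: measurable_fst|exact: measurable_snd].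
Qed.

(** By the formula for the cosine of a difference, the sum of the two squares is the double integral
    of [cos(v (s - s')) h(s) h(s')]. Fubini and [Rint_expRN_cos] replace the cosine by
    [lorentz (s - s')]; since this kernel is nonnegative, [h] may be replaced by its absolute
    value. *)
Lemma weighted_plancherel (h : R -> R) : integ leb h ->
  (\int[leb]_v (expR (- `|v|) * ((\int[leb]_s (cos (v * s) * h s)) ^+ 2 +
     (\int[leb]_s (sin (v * s) * h s)) ^+ 2))%:E <=
   \int[leb2]_p (lorentz (p.1 - p.2) * (`|h p.1| * `|h p.2|))%:E)%E.
Proof.
move=> ih; have mh := integ_measurable ih.
have ihh := integ_tensor ih ih.
have mhh : measurable_fun setT (fun p : mR * mR => h p.1 * h p.2) by exact: measurable_tensor.
have mcos : measurable_fun setT (fun z : mR * (mR * mR) => cos (z.1 * (z.2.1 - z.2.2)) : mR).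
  apply: (@measurableT_comp _ _ _ _ _ _ (@cos R) _ (fun z : mR * (mR * mR) => z.1 * (z.2.1 - z.2.2) : mR)).
    by apply: continuous_measurable_fun; exact: continuous_cos.
  apply: measurable_funM; first exact: measurable_fst.
  apply: measurable_funB.
    exact: (measurableT_comp measurable_fst measurable_snd).
  exact: (measurableT_comp measurable_snd measurable_snd).
pose K (z : mR * (mR * mR)) : R := expR (- `|z.1|) * (cos (z.1 * (z.2.1 - z.2.2)) * (h z.2.1 * h z.2.2)).
have mK : measurable_fun setT K.
  apply: measurable_funM.
    exact: (measurableT_comp measurable_expRN_norm measurable_fst).
  apply: measurable_funM => //.
  exact: (measurableT_comp mhh measurable_snd).
have iK : integ (leb \x sigma_prod leb leb)%E K.
  have iD := @integ_tensor _ _ _ _ _ leb (sigma_prod leb leb) _ _ (@integ_expRN_norm R) (integ_norm ihh).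
  apply: le_integ mK _ iD => z.
  by rewrite /K !normrM (ger0_norm (expR_ge0 _)) ler_wpM2l ?expR_ge0// ler_piMl// cos_max.
have iKv (v : R) : integ leb2 (fun p => cos (v * (p.1 - p.2)) * (h p.1 * h p.2)).
  apply: (@le_integ _ _ _ leb2 _ (fun p => `|h p.1 * h p.2|)).
  - apply: measurable_funM => //.
    exact: (@measurable_slice1 _ _ _ _ _ (fun z : mR * (mR * mR) => cos (z.1 * (z.2.1 - z.2.2)) : R) v mcos).
  - by move=> p; rewrite !normrM ler_piMl ?mulr_ge0// cos_max.
  - exact: integ_norm.
have E1 (v : R) : (\int[leb]_s (cos (v * s) * h s)) ^+ 2 + (\int[leb]_s (sin (v * s) * h s)) ^+ 2 =
    \int[leb2]_p (cos (v * (p.1 - p.2)) * (h p.1 * h p.2)).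
  have ic := integ_cosM v ih; have is_ := integ_sinM v ih.
  rewrite !expr2 -(Rint_tensor ic ic) -(Rint_tensor is_ is_) -RintD; last 2 first.
  - exact: (integ_tensor ic ic).
  - exact: (integ_tensor is_ is_).
  by apply: eq_Rint => p; rewrite mulrBr cosB; ring.
under eq_integral => v _.
  rewrite E1 -(RintZl (expR (- `|v|)) (iKv v)) -(EFin_Rint (integZl (expR (- `|v|)) (iKv v))); over.
rewrite (Fubini iK) /=.
have iexp (a : R) : integ leb (fun v => expR (- `|v|) * cos (v * a)).
  apply: (@le_integ _ _ _ leb _ (fun v => expR (- `|v|))).
  - apply: measurable_funM; first exact: measurable_expRN_norm.
    apply: continuous_measurable_fun => x; apply: continuous_comp; last exact: continuous_cos.
    exact: mulrr_continuous.
  - by move=> v; rewrite normrM (ger0_norm (expR_ge0 _)) ler_piMr ?expR_ge0// cos_max.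
  - exact: integ_expRN_norm.
have E2 (p : mR * mR) : (\int[leb]_v (K (v, p))%:E)%E = (lorentz (p.1 - p.2) * (h p.1 * h p.2))%:E.
  rewrite /lorentz -Rint_expRN_cos [X in (X)%:E]mulrC -(RintZl _ (iexp _)) -EFin_Rint; last exact: integZl.
  by apply: eq_integral => v _; rewrite /K /=; congr EFin; ring.
under eq_integral => p _ do rewrite E2.
have ikh : integ leb2 (fun p => lorentz (p.1 - p.2) * (`|h p.1| * `|h p.2|)).
  apply: (@le_integ _ _ _ leb2 _ (fun p => 2 * `|h p.1 * h p.2|)).
  - apply: measurable_funM; first exact: measurable_lorentzB.
    have mnh := integ_measurable (integ_norm ih); exact: (measurable_tensor mnh mnh).
  - move=> p; rewrite normrM (ger0_norm (lorentz_ge0 _)) normrM !normr_id -normrM.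
    by rewrite ler_wpM2r// lorentz_le2.
  - exact: integZl (integ_norm ihh).
have ikh' : integ leb2 (fun p => lorentz (p.1 - p.2) * (h p.1 * h p.2)).
  apply: le_integ ikh.
  - by apply: measurable_funM => //; exact: measurable_lorentzB.
  - by move=> p; rewrite normrM (ger0_norm (lorentz_ge0 _)) normrM.
rewrite (EFin_Rint ikh) (EFin_Rint ikh') lee_fin; apply: le_Rint => // p.
by rewrite ler_wpM2l ?lorentz_ge0// -normrM ler_norm.
Qed.

Lemma integral_lorentz (x : R) : (\int[leb]_y (lorentz (x - y))%:E = (2 * pi)%:E)%E.
Proof.
have -> : (2 * pi)%:E = (2%:E * \int[leb]_y (1 + y ^+ 2)^-1%:E)%E :> \bar R.
  by rewrite integral_inv1Dsqr.
have mi : measurable_fun setT (fun y : R => (1 + y ^+ 2)^-1).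
  by apply: continuous_measurable_fun; exact: continuous_inv1Dsqr.
rewrite -ge0_integralZl//; last 2 first.
- exact/measurable_EFinP.
- by move=> y _; rewrite lee_fin inv1Dsqr_ge0.
have N1 : (-1 : R) != 0 by rewrite oppr_eq0 oner_eq0.
rewrite [RHS](@ge0_integral_affine _ (-1) x _ N1); first last.
- by move=> y; rewrite mule_ge0// lee_fin inv1Dsqr_ge0.
- by apply: measurable_funeM; exact/measurable_EFinP.
- rewrite normrN1 mul1e; apply: eq_integral => y _.
  by rewrite /lorentz mulN1r [- y + x]addrC EFinM.
Qed.

(* This replaces Young's convolution inequality. *)
Lemma mul_le_powR (a b q : R) : 0 <= a -> 0 <= b -> 1 <= q <= 2 ->
  a * b <= a `^ q * b `^ q + a `^ q + b `^ q.
Proof.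
move=> a0 b0 /andP[q1 q2].
have A0 := powR_ge0 a q; have B0 := powR_ge0 b q.
(* The bound [1 <= q] serves numbers above 1 and [q <= 2] numbers below 1; when both are below 1,
   [a b <= (a^2 + b^2) / 2] is used. *)
have big x : 1 <= x -> x <= x `^ q by move=> x1; exact: le1r_powR.
have small x : 0 <= x -> x <= 1 -> x ^+ 2 <= x `^ q.
  rewrite le_eqVlt => /predU1P[<-|x0 x1]; first by rewrite expr0n/= powR_ge0.
  by rewrite -powR_mulrn ?(ltW x0)// ger_powR// x0.
have AB0 := mulr_ge0 A0 B0.
have [a1|a1] := leP 1 a; have [b1|b1] := leP 1 b.
- by have := ler_pM a0 b0 (big a a1) (big b b1); lra.
- have := big a a1; have : a * b <= a by rewrite ler_piMr// ltW.
  lra.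
- have := big b b1; have : a * b <= b by rewrite ler_piMl// ltW.
  lra.
have := small a a0 (ltW a1); have := small b b0 (ltW b1); have := sqr_ge0 (a - b).
nra.
Qed.

(** After division by [c], [mul_le_powR] reduces to [A = (F / c)^q], of integral at most 1. The
    product term uses the sup bound 2 of the kernel and each single term its integral [2 pi], which
    add up to [2 + 4 pi]. *)
Lemma lorentz_young (F : R -> R) (c q : R) : measurable_fun setT F ->
  (forall s, 0 <= F s) -> 0 < c -> 1 <= q <= 2 ->
  (\int[leb]_s (F s `^ q)%:E <= (c `^ q)%:E)%E ->
  (\int[leb2]_p (lorentz (p.1 - p.2) * (F p.1 * F p.2))%:E <=
   ((2 + 4 * pi) * c ^+ 2)%:E)%E.
Proof.
move=> mF F0 c0 q12 Fc.
pose A s := (F s / c) `^ q.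
have A0 s : 0 <= A s by exact: powR_ge0.
have mA : measurable_fun setT A.
  apply: (@measurableT_comp _ _ _ _ _ _ (fun x : mR => x `^ q : mR) _ (fun s : mR => F s / c : mR)).
    exact: measurable_powR.
  by apply: measurable_funM => //; exact: measurable_cst.
have iA : (\int[leb]_s (A s)%:E <= 1)%E.
  have cq : 0 < c `^ q by exact: powR_gt0.
  have E s : (A s)%:E = ((c `^ q)^-1%:E * (F s `^ q)%:E)%E.
    rewrite -EFinM /A powRM// ?invr_ge0 ?(ltW c0)// mulrC; congr (_ * _)%:E.
    by rewrite -powRN -[X in X `^ q]powR_inv1 ?(ltW c0)// -powRrM mulN1r.
  under eq_integral do rewrite E.
  rewrite ge0_integralZl//; last 3 first.
  - apply/measurable_EFinP.
    exact: (@measurableT_comp _ _ _ _ _ _ (fun x : mR => x `^ q : mR) _ F (@measurable_powR R q) mF).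
  - by move=> s _; rewrite lee_fin powR_ge0.
  - by rewrite lee_fin invr_ge0 ltW.
  by rewrite lee_pdivrMl// mule1.
have mA1 : measurable_fun setT (fun p : mR * mR => (A p.1)%:E).
  by apply/measurable_EFinP; exact: (measurableT_comp mA measurable_fst).
have mA2 : measurable_fun setT (fun p : mR * mR => (A p.2)%:E).
  by apply/measurable_EFinP; exact: (measurableT_comp mA measurable_snd).
have mk := measurable_lorentzB.
have m1 : measurable_fun setT (fun p : mR * mR => (2 * (A p.1 * A p.2))%:E).
  apply/measurable_EFinP; apply: measurable_funM; first exact: measurable_cst.
  exact: measurable_tensor.
have m2 : measurable_fun setT (fun p : mR * mR => (lorentz (p.1 - p.2) * A p.1)%:E).
  by apply/measurable_EFinP; apply: measurable_funM => //; exact/measurable_EFinP.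
have m3 : measurable_fun setT (fun p : mR * mR => (lorentz (p.1 - p.2) * A p.2)%:E).
  by apply/measurable_EFinP; apply: measurable_funM => //; exact/measurable_EFinP.
have I1 : (\int[leb2]_p (2 * (A p.1 * A p.2))%:E <= 2%:E)%E.
  rewrite fubini_tonelli1//; last by move=> p; rewrite lee_fin !mulr_ge0.
  rewrite /fubini_F /=; under eq_integral => x _.
    under eq_integral do rewrite mulrA EFinM.
    rewrite ge0_integralZl//; last 3 first.
    - exact/measurable_EFinP.
    - by move=> y _; rewrite lee_fin.
    - by rewrite lee_fin mulr_ge0.
    over.
  apply: (@le_trans _ _ (\int[leb]_x (2%:E * (A x)%:E))%E).
    apply: ge0_le_integral => //.
    - by move=> x _; rewrite mule_ge0 ?lee_fin ?mulr_ge0// integral_ge0// => y _; rewrite lee_fin.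
    - apply: emeasurable_funM; last exact: measurable_cst.
      by apply/measurable_EFinP; apply: measurable_funM => //; exact: measurable_cst.
    - by apply: measurable_funeM; exact/measurable_EFinP.
    - move=> x _; rewrite EFinM -[leRHS]mule1 lee_wpmul2l// mule_ge0// lee_fin//.
  rewrite ge0_integralZl//; last 2 first.
  - exact/measurable_EFinP.
  - by move=> y _; rewrite lee_fin.
  by rewrite -[leRHS]mule1 lee_wpmul2l.
have I2 : (\int[leb2]_p (lorentz (p.1 - p.2) * A p.1)%:E <= (2 * pi)%:E)%E.
  rewrite fubini_tonelli1//; last by move=> p; rewrite lee_fin mulr_ge0// lorentz_ge0.
  rewrite /fubini_F /=; under eq_integral => x _.
    under eq_integral do rewrite EFinM muleC.
    rewrite ge0_integralZl//; last 3 first.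
    - by apply/measurable_EFinP; exact: (measurable_slice1 x mk).
    - by move=> y _; rewrite lee_fin lorentz_ge0.
    - by rewrite lee_fin.
    rewrite integral_lorentz muleC; over.
  rewrite ge0_integralZl//; last 3 first.
  - exact/measurable_EFinP.
  - by move=> y _; rewrite lee_fin.
  - by rewrite lee_fin mulr_ge0// pi_ge0.
  by rewrite -[leRHS]mule1 lee_wpmul2l// lee_fin mulr_ge0// pi_ge0.
have I3 : (\int[leb2]_p (lorentz (p.1 - p.2) * A p.2)%:E <= (2 * pi)%:E)%E.
  rewrite fubini_tonelli2//; last by move=> p; rewrite lee_fin mulr_ge0// lorentz_ge0.
  rewrite /fubini_G /=; under eq_integral => y _.
    under eq_integral do rewrite lorentzBC EFinM muleC.
    rewrite ge0_integralZl//; last 3 first.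
    - by apply/measurable_EFinP; exact: (measurable_slice1 y mk).
    - by move=> x _; rewrite lee_fin lorentz_ge0.
    - by rewrite lee_fin.
    rewrite integral_lorentz muleC; over.
  rewrite ge0_integralZl//; last 3 first.
  - exact/measurable_EFinP.
  - by move=> y _; rewrite lee_fin.
  - by rewrite lee_fin mulr_ge0// pi_ge0.
  by rewrite -[leRHS]mule1 lee_wpmul2l// lee_fin mulr_ge0// pi_ge0.
pose D p := (2 * (A p.1 * A p.2))%:E + (lorentz (p.1 - p.2) * A p.1)%:E + (lorentz (p.1 - p.2) * A p.2)%:E.
apply: (@le_trans _ _ (\int[leb2]_p ((c ^+ 2)%:E * D p))%E).
  apply: ge0_le_integral => //.
  - by move=> p _; rewrite lee_fin mulr_ge0 ?lorentz_ge0// mulr_ge0.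
  - apply/measurable_EFinP; apply: measurable_funM => //; exact: measurable_tensor.
  - by apply: measurable_funeM; apply: emeasurable_funD => //; apply: emeasurable_funD.
  move=> p _; rewrite /D -!EFinD -EFinM lee_fin.
  have F1 : F p.1 = c * (F p.1 / c) by rewrite mulrC divfK// gt_eqF.
  have F2 : F p.2 = c * (F p.2 / c) by rewrite mulrC divfK// gt_eqF.
  have a0 : 0 <= F p.1 / c by rewrite divr_ge0// ltW.
  have b0 : 0 <= F p.2 / c by rewrite divr_ge0// ltW.
  have h := mul_le_powR a0 b0 q12; rewrite -/(A p.1) -/(A p.2) in h.
  rewrite {1}F1 {1}F2.
  have -> : lorentz (p.1 - p.2) * (c * (F p.1 / c) * (c * (F p.2 / c))) =
     c ^+ 2 * (lorentz (p.1 - p.2) * (F p.1 / c * (F p.2 / c))) by ring.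
  rewrite ler_wpM2l ?sqr_ge0//.
  apply: (le_trans (ler_wpM2l (lorentz_ge0 _) h)).
  by rewrite !mulrDr !lerD// ler_wpM2r ?mulr_ge0// lorentz_le2.
have D1 p : (0 <= (2 * (A p.1 * A p.2))%:E + (lorentz (p.1 - p.2) * A p.1)%:E)%E.
  by apply: adde_ge0; rewrite lee_fin; [rewrite !mulr_ge0|rewrite mulr_ge0// lorentz_ge0].
have D2 (p : mR * mR) : (0 <= (lorentz (p.1 - p.2) * A p.2)%:E)%E.
  by rewrite lee_fin mulr_ge0 ?lorentz_ge0.
rewrite ge0_integralZl//; last 3 first.
- by apply: emeasurable_funD => //; apply: emeasurable_funD.
- by move=> p _; rewrite adde_ge0.
- by rewrite lee_fin sqr_ge0.
rewrite [X in (_ <= X)%E](_ : _ = ((c ^+ 2)%:E * (2 + 4 * pi)%:E)%E); last by rewrite -EFinM mulrC.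
apply: lee_wpmul2l; first by rewrite lee_fin sqr_ge0.
rewrite /D.
rewrite ge0_integralD//; last by apply: emeasurable_funD.
rewrite ge0_integralD//; last 2 first.
- by move=> p _; rewrite lee_fin mulr_ge0// mulr_ge0.
- by move=> p _; rewrite lee_fin mulr_ge0// lorentz_ge0.
have -> : (2 + 4 * pi)%:E = (2%:E + (2 * pi)%:E + (2 * pi)%:E)%E :> \bar R.
  by rewrite -!EFinD; congr EFin; ring.
exact: (leeD (leeD I1 I2) I3).
Qed.

End weighted_fourier.

(** * Coefficients at fixed t *)

Section trigonometric.
Context {R : realType}.

Definition trig (b : bool) (x : R) : R := if b then cos x else sin x.

Lemma trig_max b x : `|trig b x| <= 1.
Proof. by case: b; [exact: cos_max|exact: sin_max]. Qed.

Lemma continuous_trig b : continuous (trig b).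
Proof. by case: b; [exact: continuous_cos|exact: continuous_sin]. Qed.

Lemma measurable_trig b : measurable_fun setT (trig b).
Proof. by apply: continuous_measurable_fun; exact: continuous_trig. Qed.

Lemma integ_trig b a (h : R -> R) : integ lebesgue_measure h ->
  integ lebesgue_measure (fun s => trig b (a * s) * h s).
Proof. by case: b; [exact: integ_cosM|exact: integ_sinM]. Qed.

End trigonometric.

Section partial_transform.
Context {R : realType} (n : nat).
Hypothesis n_gt0 : (0 < n)%N.
Notation mR := (measurableTypeR R).
Notation tR := (n.-tuple mR).
Notation leb := (@lebesgue_measure R).
Notation leb2 := (leb \x leb)%E.
Notation lebn := (@lebesgue_tuple R n).
Notation lev := (@lev R n).
Variable f : tR * mR * mR -> R.
Hypothesis mf : measurable_fun setT f.

Lemma measurable_shermite2 k : measurable_fun setT (fun p : mR * mR => shermite p.1 k p.2 : mR).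
Proof.
apply: measurable_funM.
  exact: (@measurableT_comp _ _ _ _ _ _ (fun x : mR => x `^ 4^-1 : mR) _ _ (@measurable_powR R _) measurable_fst).
apply: (@measurableT_comp _ _ _ _ _ _ (@hermite R k) _ (fun p : mR * mR => Num.sqrt p.1 * p.2 : mR)).
  by apply: continuous_measurable_fun; exact: hermite_continuous.
apply: measurable_funM; last exact: measurable_snd.
apply: (@measurableT_comp _ _ _ _ _ _ (@Num.sqrt R) _ (fun p : mR * mR => p.1)); last exact: measurable_fst.
by apply: continuous_measurable_fun; exact: sqrt_continuous.
Qed.

Lemma measurable_nhermite2 a : measurable_fun setT (fun p : mR * tR => nhermite p.1 a p.2 : mR).
Proof.
apply: measurable_prod => i _.
apply: (measurableT_comp (measurable_shermite2 (a i)) (g := fun p : mR * tR => (p.1, tnth p.2 i))).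
apply: measurable_fun_pair; first exact: measurable_fst.
exact: (measurableT_comp (measurable_tnth i) measurable_snd).
Qed.

Definition ft b (v t : R) (u : tR) : R := \int[leb]_s (trig b (v * s) * f (u, t, s)).

(** At fixed [t], one trigonometric component of the transform at the point of the surface above [a]
    and [l]; the frequency in [s] is therefore the level, and only the character in [t] remains to
    be integrated. *)
Definition coeff b a (t l : R) : R :=
  \int[lebn]_u (ft b (lev (size_mi a) * `|l|) t u * nhermite `|l| a u).

Lemma measurable_ft b : measurable_fun setT (fun p : mR * mR * tR => ft b p.1.1 p.1.2 p.2 : mR).
Proof.
have := @measurable_Rint _ _ (mR * mR * tR)%type mR R leb (fun q : mR * mR * tR * mR =>
  trig b (q.1.1.1 * q.2) * f (q.1.2, q.1.1.2, q.2)).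
apply.
have m1 := @measurable_fst _ _ (mR * mR * tR)%type mR.
have m2 := @measurable_snd _ _ (mR * mR * tR)%type mR.
have m11 := measurableT_comp (@measurable_fst _ _ (mR * mR)%type tR) m1.
have m12 := measurableT_comp (@measurable_snd _ _ (mR * mR)%type tR) m1.
have m111 := measurableT_comp (@measurable_fst _ _ mR mR) m11.
have m112 := measurableT_comp (@measurable_snd _ _ mR mR) m11.
apply: measurable_funM; last exact: (measurableT_comp mf (measurable_fun_pair (measurable_fun_pair m12 m112) m2)).
exact: (measurableT_comp (measurable_trig b) (measurable_funM m111 m2)).
Qed.

Lemma measurable_coeff b a : measurable_fun setT (fun p : mR * mR => coeff b a p.1 p.2 : mR).
Proof.
have := @measurable_Rint _ _ (mR * mR)%type tR R lebn (fun q : mR * mR * tR =>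
  ft b (lev (size_mi a) * `|q.1.2|) q.1.1 q.2 * nhermite `|q.1.2| a q.2).
apply.
have m1 := @measurable_fst _ _ (mR * mR)%type tR.
have m2 := @measurable_snd _ _ (mR * mR)%type tR.
have m11 := measurableT_comp (@measurable_fst _ _ mR mR) m1.
have m12 := measurableT_comp (@measurable_snd _ _ mR mR) m1.
have mn : measurable_fun setT (fun q : mR * mR * tR => `|q.1.2| : mR).
  exact: (measurableT_comp (@measurable_realfun.normr_measurable R setT) m12).
apply: measurable_funM.
  have mln : measurable_fun setT (fun q : mR * mR * tR => lev (size_mi a) * `|q.1.2| : mR).
    by apply: measurable_funM => //; exact: measurable_cst.
  exact: (measurableT_comp (measurable_ft b) (measurable_fun_pair (measurable_fun_pair mln m11) m2)).
exact: (measurableT_comp (measurable_nhermite2 a) (measurable_fun_pair mn m2)).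
Qed.

Variable t : R.
Hypothesis f1 : forall u, integ leb (fun s => f (u, t, s)).
Hypothesis f2 : forall s, integ lebn (fun u => f (u, t, s) ^+ 2).
Hypothesis f12 : integ lebn (fun u => (\int[leb]_s `|f (u, t, s)|) ^+ 2).

Let measurable_ftu b v : measurable_fun setT (fun u => ft b v t u).
Proof. exact: (measurable_slice1 (v, t) (measurable_ft b)). Qed.

Let ft_le b v u : `|ft b v t u| <= \int[leb]_s `|f (u, t, s)|.
Proof.
have i1 := integ_trig b v (f1 u).
apply: (le_trans (le_normr_Rintegral measurableT i1)).
apply: le_Rint; [exact: integ_norm|exact: integ_norm|move=> s].
by rewrite normrM ler_piMl// trig_max.
Qed.

Lemma integ_ft_sqr b v : integ lebn (fun u => ft b v t u ^+ 2).
Proof.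
apply: le_integ f12.
  exact: (measurable_funX 2 (measurable_ftu b v)).
move=> u; rewrite normrX lerXn2r ?nnegrE// ?ft_le//.
by apply: Rint_ge0.
Qed.

Let ft_norm b v u : ft b `|v| t u ^+ 2 = ft b v t u ^+ 2.
Proof.
have [v0|v0] := leP 0 v; first by rewrite ger0_norm.
rewrite ltr0_norm//; case: b.
  by rewrite /ft; under eq_Rint do rewrite mulNr /= cosN.
rewrite -[RHS]sqrrN -mulN1r /ft -RintZl; last exact: (integ_trig false v (f1 u)).
by under eq_Rint do rewrite mulNr /= sinN mulNr -mulN1r.
Qed.

Let energy v u := ft true v t u ^+ 2 + ft false v t u ^+ 2.

Let ft_le_energy b v u : ft b v t u ^+ 2 <= energy v u.
Proof. by case: b; rewrite /energy ?lerDl ?lerDr sqr_ge0. Qed.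

Let energy_ge0 v u : 0 <= energy v u.
Proof. by rewrite addr_ge0// sqr_ge0. Qed.

Let integ_energy v : integ lebn (energy v).
Proof. by apply: integD; exact: integ_ft_sqr. Qed.

Let measurable_energy : measurable_fun setT (fun p : mR * tR => energy p.1 p.2 : mR).
Proof.
have mg b : measurable_fun setT (fun p : mR * tR => ft b p.1 t p.2 : mR).
  apply: (measurableT_comp (measurable_ft b) (g := fun p : mR * tR => ((p.1, t), p.2))).
  apply: measurable_fun_pair; last exact: measurable_snd.
  by apply: measurable_fun_pair; [exact: measurable_fst|exact: measurable_cst].
by apply: measurable_funD; apply: measurable_funX; exact: mg.
Qed.

Let F s := Num.sqrt (\int[lebn]_u (f (u, t, s) ^+ 2)).

Let measurable_F : measurable_fun setT (F : mR -> mR).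
Proof.
apply: (@measurableT_comp _ _ _ _ _ _ (@Num.sqrt R) _ (fun s : mR => \int[lebn]_u (f (u, t, s) ^+ 2) : mR)).
  by apply: continuous_measurable_fun; exact: sqrt_continuous.
have := @measurable_Rint _ _ mR tR R lebn (fun q : mR * tR => f (q.2, t, q.1) ^+ 2).
apply; apply: measurable_funX.
apply: (measurableT_comp mf (g := fun q : mR * tR => ((q.2, t), q.1))).
apply: measurable_fun_pair; last exact: measurable_fst.
by apply: measurable_fun_pair; [exact: measurable_snd|exact: measurable_cst].
Qed.

(** [weighted_plancherel] is applied at each [u]. After exchanging the integrals, Cauchy-Schwarz in
    [u] bounds the product of two slices by [F s * F s'], to which [lorentz_young] applies. *)
Lemma integral_energy_le (c q : R) : 0 < c -> 1 <= q <= 2 ->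
  (\int[leb]_s (F s `^ q)%:E <= (c `^ q)%:E)%E ->
  (\int[leb]_v (expR (- `|v|) * \int[lebn]_u energy v u)%:E <=
   ((2 + 4 * pi) * c ^+ 2)%:E)%E.
Proof.
move=> c0 q12 Fc.
apply: le_trans (lorentz_young measurable_F (fun s => sqrtr_ge0 _) c0 q12 Fc).
pose K (z : mR * tR) : R := expR (- `|z.1|) * energy z.1 z.2.
have mK : measurable_fun setT K.
  apply: measurable_funM => //.
  exact: (measurableT_comp measurable_expRN_norm measurable_fst).
have K0 z : (0 <= (K z)%:E)%E by rewrite lee_fin mulr_ge0// expR_ge0.
have -> : (\int[leb]_v (expR (- `|v|) * \int[lebn]_u energy v u)%:E =
    \int[leb]_v \int[lebn]_u (K (v, u))%:E)%E.
  apply: eq_integral => v _.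
  by rewrite -(RintZl _ (integ_energy v)) -(EFin_Rint (integZl _ (integ_energy v))).
rewrite (fubini_tonelli (EFin \o K))//=; last exact/measurable_EFinP.
pose L (z : tR * (mR * mR)) : R := lorentz (z.2.1 - z.2.2 : R) * (`|f (z.1, t, z.2.1)| * `|f (z.1, t, z.2.2)|).
have mabs (pr : mR * mR -> mR) : measurable_fun setT pr ->
    measurable_fun setT (fun z : tR * (mR * mR) => `|f (z.1, t, pr z.2)| : mR).
  move=> mpr; apply: (measurableT_comp (@measurable_realfun.normr_measurable R setT)).
  apply: (measurableT_comp mf (g := fun z : tR * (mR * mR) => ((z.1, t), pr z.2))).
  apply: measurable_fun_pair; last exact: (measurableT_comp mpr measurable_snd).
  by apply: measurable_fun_pair; [exact: measurable_fst|exact: measurable_cst].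
have mL : measurable_fun setT L.
  apply: measurable_funM; first exact: (measurableT_comp (@measurable_lorentzB R) measurable_snd).
  by apply: measurable_funM; apply: mabs; [exact: measurable_fst|exact: measurable_snd].
have L0 z : (0 <= (L z)%:E)%E by rewrite lee_fin mulr_ge0 ?lorentz_ge0// mulr_ge0.
apply: (@le_trans _ _ (\int[lebn]_u \int[sigma_prod leb leb]_p (L (u, p))%:E)%E).
  apply: ge0_le_integral => //.
  - by move=> u _; apply: integral_ge0 => v _; exact: K0.
  - apply: (@measurable_fun_fubini_tonelli_G _ _ _ _ _ leb (EFin \o K)) => //.
    exact/measurable_EFinP.
  - apply: (@measurable_fun_fubini_tonelli_F _ _ _ _ _ (sigma_prod leb leb) (EFin \o L)) => //.
    exact/measurable_EFinP.
  by move=> u _; exact: (weighted_plancherel (f1 u)).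
rewrite (fubini_tonelli (EFin \o L))//=; last exact/measurable_EFinP.
apply: ge0_le_integral => //.
- by move=> p _; apply: integral_ge0 => u _; exact: L0.
- apply: (@measurable_fun_fubini_tonelli_G _ _ _ _ _ lebn (EFin \o L)) => //.
  exact/measurable_EFinP.
- apply/measurable_EFinP; apply: measurable_funM; first exact: measurable_lorentzB.
  exact: (measurable_tensor measurable_F measurable_F).
move=> p _; rewrite /L /=.
have mfs s : measurable_fun setT (fun u : tR => `|f (u, t, s)|).
  apply: (measurableT_comp (@measurable_realfun.normr_measurable R setT)).
  apply: (measurableT_comp mf (g := fun u : tR => ((u, t), s))).
  by apply: measurable_fun_pair; [apply: measurable_fun_pair|]; try exact: measurable_cst.
have ifs s : integ lebn (fun u => `|f (u, t, s)| ^+ 2).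
  by apply: eq_integ (f2 s) => u; rewrite real_normK// num_real.
have iff := integM (mfs p.1) (mfs p.2) (ifs p.1) (ifs p.2).
rewrite (EFin_Rint (integZl _ iff)) (RintZl _ iff) lee_fin ler_wpM2l ?lorentz_ge0//.
have h := Rint_cauchy_schwarz (mfs p.1) (mfs p.2) (ifs p.1) (ifs p.2).
rewrite -ler_sqr ?nnegrE ?mulr_ge0 ?sqrtr_ge0//; last by apply: Rint_ge0 => u; rewrite mulr_ge0.
have Rge0 s : 0 <= \int[lebn]_u (f (u, t, s) ^+ 2) by apply: Rint_ge0 => u; exact: sqr_ge0.
rewrite exprMn !sqr_sqrtr//; apply: (le_trans h).
by under [X in X * _ <= _]eq_Rint do rewrite real_normK ?num_real//;
   under [X in _ * X <= _]eq_Rint do rewrite real_normK ?num_real//.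
Qed.

(** Settles the frequency [v = 0], which [bessel] does not cover: the factor [0^(1/4)] is 0. *)
Let nhermite0 (a : multi_index n) (u : tR) : nhermite 0 a u = 0 :> R.
Proof.
by rewrite /nhermite (bigD1 (Ordinal n_gt0))//= /shermite powR0 ?mul0r//.
Qed.

(** Each term has its own substitution [l = v / lev (size_mi a)]. It brings all terms to the same
    frequency [v], turns their scales into [kap], and its Jacobian is the weight in [bessel], which
    is then applied under the integral in [v]. *)
Lemma sum_coeff_le b (s : seq (multi_index n)) (psi : R -> R) (P c q : R) :
  uniq s -> measurable_fun setT psi -> (forall x, 0 <= psi x) ->
  (forall x, psi x <= P * expR (- `|x|)) -> 0 < c -> 1 <= q <= 2 ->
  (\int[leb]_s (F s `^ q)%:E <= (c `^ q)%:E)%E ->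
  (\sum_(a <- s) \int[leb]_l (coeff b a t l ^+ 2 * psi (lev (size_mi a) * `|l|))%:E <=
   (P * bessel_const n * ((2 + 4 * pi) * c ^+ 2))%:E)%E.
Proof.
move=> us mpsi psi0 psiP c0 q12 Fc.
have P0 : 0 <= P by have := le_trans (psi0 0) (psiP 0); rewrite pmulr_lge0 ?expR_gt0.
have C0 := bessel_const_gt0 (R := R) n_gt0.
pose H a l := coeff b a t l ^+ 2 * psi (lev (size_mi a) * `|l|).
have H0 a l : 0 <= H a l by rewrite mulr_ge0 ?sqr_ge0.
have mH a : measurable_fun setT (H a : mR -> mR).
  apply: measurable_funM.
    by apply: measurable_funX; exact: (measurable_slice1 t (measurable_coeff b a)).
  apply: (@measurableT_comp _ _ _ _ _ _ psi _ (fun l : mR => lev (size_mi a) * `|l| : mR)) => //.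
  apply: measurable_funM; first exact: measurable_cst.
  exact: (@measurable_realfun.normr_measurable R setT).
pose M (a : multi_index n) : R := (lev (size_mi a))^-1.
have M0 a : 0 < M a by rewrite invr_gt0 lev_gt0.
have mHM a : measurable_fun setT (fun v : mR => H a (M a * v) : mR).
  exact: (measurableT_comp (mH a) (@measurable_realfun.mulrl_measurable R setT (M a))).
have E a : (\int[leb]_l (H a l)%:E = \int[leb]_v (M a * H a (M a * v))%:E)%E.
  have Mn0 : M a != 0 by rewrite gt_eqF.
  have mHE : measurable_fun setT (fun l : mR => (H a l)%:E) by apply/measurable_EFinP; exact: mH.
  have HE0 l : (0 <= (H a l)%:E)%E by rewrite lee_fin.
  rewrite (ge0_integral_scale Mn0 mHE HE0) -ge0_integralZl//; last first.
    by apply/measurable_EFinP; exact: mHM.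
  by apply: eq_integral => v _; rewrite ger0_norm ?(ltW (M0 a)).
under eq_bigr do rewrite E.
rewrite -(ge0_integral_sum leb measurableT (f := fun a v => (M a * H a (M a * v))%:E)); last 2 first.
- by move=> a; apply/measurable_EFinP; apply: measurable_funM; [exact: measurable_cst|exact: mHM].
- by move=> a v _; rewrite lee_fin mulr_ge0// ltW.
have C1 : 0 <= P * bessel_const n by rewrite mulr_ge0// ltW.
have mE : measurable_fun setT (fun v : mR => expR (- `|v|) * \int[lebn]_u energy v u).
  apply: measurable_funM; first exact: measurable_expRN_norm.
  exact: (@measurable_Rint _ _ mR tR R lebn _ measurable_energy).
have E0 v : 0 <= expR (- `|v|) * \int[lebn]_u energy v u.
  by rewrite mulr_ge0 ?expR_ge0// Rint_ge0.
apply: (@le_trans _ _ (\int[leb]_v ((P * bessel_const n)%:E *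
    (expR (- `|v|) * \int[lebn]_u energy v u)%:E))%E); last first.
  rewrite ge0_integralZl//; last 2 first.
  - by apply/measurable_EFinP; exact: mE.
  - by move=> v _; rewrite lee_fin E0.
  by rewrite [leRHS]EFinM lee_wpmul2l ?lee_fin// (integral_energy_le c0 q12 Fc).
apply: ge0_le_integral => //.
- by move=> v _; apply: sume_ge0 => a _; rewrite lee_fin mulr_ge0// ltW.
- apply: emeasurable_sum => a; apply/measurable_EFinP.
  by apply: measurable_funM; [exact: measurable_cst|exact: mHM].
- by apply: measurable_funeM; exact/measurable_EFinP.
move=> v _; rewrite sumEFin -EFinM lee_fin.
have HE a : H a (M a * v) =
    (\int[lebn]_u (ft b `|v| t u * nhermite `|M a * v| a u)) ^+ 2 * psi `|v|.
  rewrite /H /coeff normrM (ger0_norm (ltW (M0 a))).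
  by rewrite (mulVKf (lt0r_neq0 (lev_gt0 n_gt0 _))).
have [v0|v0] := eqVneq v 0.
  rewrite big1 => [|a _]; first by rewrite mulr_ge0// E0.
  rewrite HE v0 mulr0 normr0; under eq_Rint do rewrite nhermite0 mulr0.
  by rewrite Rintegral_cst// mul0r expr0n mul0r mulr0.
have nv0 : 0 < `|v| by rewrite normr_gt0.
have := bessel n_gt0 nv0 us (measurable_ftu b `|v|) (integ_ft_sqr b `|v|).
have -> : \int[lebn]_u (ft b `|v| t u ^+ 2) = \int[lebn]_u (ft b v t u ^+ 2).
  by apply: eq_Rint => u; exact: ft_norm.
move=> h.
have le1 : \int[lebn]_u (ft b v t u ^+ 2) <= \int[lebn]_u energy v u.
  apply: le_Rint => [||u]; [exact: integ_ft_sqr|exact: integ_energy|exact: ft_le_energy].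
have -> : \sum_(a <- s) M a * H a (M a * v) = psi `|v| *
    \sum_(a <- s) (\int[lebn]_u (ft b `|v| t u * nhermite (kap n `|v| (size_mi a)) a u)) ^+ 2 / lev (size_mi a).
  rewrite mulr_sumr; apply: eq_bigr => a _; rewrite HE.
  have -> : `|M a * v| = kap n `|v| (size_mi a).
    by rewrite normrM (ger0_norm (ltW (M0 a))) mulrC.
  by rewrite /M; ring.
have psiv : psi `|v| <= P * expR (- `|v|) by have := psiP `|v|; rewrite normr_id.
apply: le_trans (ler_wpM2l (psi0 _) (le_trans h (ler_wpM2l (ltW C0) le1))) _.
have -> : P * bessel_const n * (expR (- `|v|) * \int[lebn]_u energy v u) =
  (P * expR (- `|v|)) * (bessel_const n * \int[lebn]_u energy v u) by ring.
by rewrite ler_wpM2r// mulr_ge0 ?(ltW C0)// Rint_ge0.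
Qed.

End partial_transform.

(** * Integration in t *)

Lemma measurable_inv_gt0 d (T : measurableType d) (R : realType) (w : T -> R) :
  (forall t, 0 < w t) -> measurable_fun setT w -> measurable_fun setT (fun t => (w t)^-1).
Proof.
move=> w0 mw; rewrite (_ : (fun t => _) = (fun t => w t `^ (-1))); last first.
  by apply/funext => t; rewrite powR_inv1// ltW.
exact: (@measurableT_comp _ _ _ _ _ _ 
  (fun x : measurableTypeR R => x `^ (-1) : measurableTypeR R) _ w (@measurable_powR R _) mw).
Qed.

(** Integrating [2 c b <= c^2 w + b^2 / w] gives a family of inequalities that remain meaningful
    when the integrals are infinite; the best [c] is the integral of [b] divided by [W]. *)
Lemma weighted_cauchy_schwarz d (T : measurableType d) (R : realType)
    (mu : {measure set T -> \bar R}) (b w : T -> R) :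
  measurable_fun setT b -> (forall t, 0 <= b t) -> (forall t, 0 < w t) ->
  integ mu w -> 0 < \int[mu]_t w t ->
  (\int[mu]_t (b t)%:E * \int[mu]_t (b t)%:E <=
   (\int[mu]_t w t)%:E * \int[mu]_t (b t ^+ 2 / w t)%:E)%E.
Proof.
move=> mb b0 w0 iw W0; set W := \int[mu]_t w t in W0 *.
have mw : measurable_fun setT w := integ_measurable iw.
have mwV := measurable_inv_gt0 w0 mw.
have mV : measurable_fun setT (fun t => b t ^+ 2 / w t).
  by apply: measurable_funM => //; exact: measurable_funX.
have V0 t : 0 <= b t ^+ 2 / w t by rewrite divr_ge0 ?sqr_ge0// ltW.
have x0 : (0 <= \int[mu]_t (b t)%:E)%E by apply: integral_ge0 => t _; rewrite lee_fin.
have : (0 <= \int[mu]_t (b t ^+ 2 / w t)%:E)%E by apply: integral_ge0 => t _; rewrite lee_fin.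
have amgm c : 0 < c -> ((2 * c)%:E * \int[mu]_t (b t)%:E <=
    (c ^+ 2 * W)%:E + \int[mu]_t (b t ^+ 2 / w t)%:E)%E.
  move=> c0; rewrite [X in (_ <= X + _)%E]EFinM /W -(EFin_Rint iw).
  have c2 : 0 <= 2 * c by rewrite mulr_ge0// ltW.
  rewrite -!ge0_integralZl//; [|exact/measurable_EFinP|by move=> t _; rewrite lee_fin ltW
    |by rewrite lee_fin sqr_ge0|exact/measurable_EFinP|by move=> t _; rewrite lee_fin].
  rewrite -ge0_integralD//; [|by move=> t _; rewrite lee_fin mulr_ge0 ?sqr_ge0// ltW
   | by apply: measurable_funeM; exact/measurable_EFinP|by move=> t _; rewrite lee_fin
   |exact/measurable_EFinP].
  apply: ge0_le_integral => //.
  - by move=> t _; rewrite -EFinM lee_fin mulr_ge0.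
  - by apply: measurable_funeM; exact/measurable_EFinP.
  - by apply: emeasurable_funD; [apply: measurable_funeM|]; exact/measurable_EFinP.
  move=> t _; rewrite -!EFinM -EFinD lee_fin.
  have wt := w0 t; rewrite -subr_ge0.
  have -> : c ^+ 2 * w t + b t ^+ 2 / w t - 2 * c * b t = (c * w t - b t) ^+ 2 / w t.
    by move: (w t) wt => z z0; field; rewrite gt_eqF.
  by rewrite divr_ge0 ?sqr_ge0// ltW.
(* An infinite right-hand side is trivial. When it is finite, the case [c = 1] excludes an infinite
   integral of [b]. *)
case: (\int[mu]_t (b t ^+ 2 / w t)%:E)%E amgm => [v|_ _|//]; last first.
  by rewrite gt0_muley ?lte_fin// leey.
case: (\int[mu]_t (b t)%:E)%E x0 => [x||//]; last first.
  by move=> _ /(_ _ ltr01); rewrite mulr1 gt0_muley ?lte_fin//.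
rewrite lee_fin le_eqVlt => /predU1P[<-|x0] amgm v0.
  by rewrite mul0e mule_ge0// lee_fin ltW.
have := amgm (x / W) (divr_gt0 x0 W0).
rewrite -!EFinM -EFinD !lee_fin -(ler_pM2l W0).
have -> : W * (2 * (x / W) * x) = 2 * (x * x) by field; rewrite gt_eqF.
have -> : W * ((x / W) ^+ 2 * W + v) = x * x + W * v by field; rewrite gt_eqF.
lra.
Qed.

Section time_integration.
Context {R : realType} (n : nat).
Hypothesis n_gt0 : (0 < n)%N.
Notation mR := (measurableTypeR R).
Notation tR := (n.-tuple mR).
Notation leb := (@lebesgue_measure R).
Notation lebn := (@lebesgue_tuple R n).
Notation lev := (@lev R n).
Variable f : tR * mR * mR -> R.
Hypothesis mf : measurable_fun setT f.
Hypothesis f1 : forall t u, integ leb (fun s => f (u, t, s)).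
Hypothesis f2 : forall t s, integ lebn (fun u => f (u, t, s) ^+ 2).
Hypothesis f12 : forall t, integ lebn (fun u => (\int[leb]_s `|f (u, t, s)|) ^+ 2).

(** Cauchy-Schwarz in [t] costs one factor [W] and leaves the squared coefficients divided by [w t].
    At fixed [t], [sum_coeff_le] with [c = w t] is quadratic in [w t]; the division leaves a linear
    bound, whose integral is the second factor [W]. *)
Lemma sum_int_coeff_le b (s : seq (multi_index n)) (psi w : R -> R) (P q : R) :
  uniq s -> measurable_fun setT psi -> (forall x, 0 <= psi x) ->
  (forall x, psi x <= P * expR (- `|x|)) -> 1 <= q <= 2 ->
  (forall t, 0 < w t) -> integ leb w -> 0 < \int[leb]_t w t ->
  (forall t, (\int[leb]_s ((Num.sqrt (\int[lebn]_u (f (u, t, s) ^+ 2))) `^ q)%:E <=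
     (w t `^ q)%:E)%E) ->
  (\sum_(a <- s) \int[leb]_l (\int[leb]_t `|coeff f b a t l|%:E * \int[leb]_t `|coeff f b a t l|%:E *
      (psi (lev (size_mi a) * `|l|))%:E) <=
   (P * bessel_const n * (2 + 4 * pi) * (\int[leb]_t w t) ^+ 2)%:E)%E.
Proof.
move=> us mpsi psi0 psiP q12 w0 iw W0 wF; set W := \int[leb]_t w t in W0 *.
have mw : measurable_fun setT w := integ_measurable iw.
have mwV := measurable_inv_gt0 w0 mw.
have P0 : 0 <= P by have := le_trans (psi0 0) (psiP 0); rewrite pmulr_lge0 ?expR_gt0.
have C0 := ltW (bessel_const_gt0 (R := R) n_gt0).
have mc a := measurable_coeff mf b a.
have mpl (a : multi_index n) : measurable_fun setT (fun l : mR => psi (lev (size_mi a) * `|l|) : mR).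
  apply: (@measurableT_comp _ _ _ _ _ _ psi _ (fun l : mR => lev (size_mi a) * `|l| : mR)) => //.
  apply: measurable_funM; first exact: measurable_cst.
  exact: (@measurable_realfun.normr_measurable R setT).
pose H a (p : mR * mR) : R := coeff f b a p.1 p.2 ^+ 2 * psi (lev (size_mi a) * `|p.2|).
have H0 a p : 0 <= H a p by rewrite mulr_ge0 ?sqr_ge0.
have mH a : measurable_fun setT (H a).
  apply: measurable_funM; first exact: (measurable_funX 2 (mc a)).
  exact: (measurableT_comp (mpl a) measurable_snd).
pose G a (p : mR * mR) : R := H a p / w p.1.
have G0 a p : 0 <= G a p by rewrite divr_ge0// ltW.
have mG a : measurable_fun setT (G a).
  by apply: measurable_funM => //; exact: (measurableT_comp mwV measurable_fst).
have mGE a : measurable_fun setT (EFin \o G a) by apply/measurable_EFinP; exact: mG.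
have GE0 a p : (0 <= (EFin \o G a) p)%E by rewrite lee_fin.
have mcn (a : multi_index n) l : measurable_fun setT (fun t : mR => `|coeff f b a t l| : mR).
  apply: (measurableT_comp (@measurable_realfun.normr_measurable R setT)).
  exact: (measurable_slice2 l (mc a)).
have mT a : measurable_fun setT (fun l : mR => \int[leb]_t (G a (t, l))%:E)%E.
  exact: (@measurable_fun_fubini_tonelli_G _ _ _ _ _ leb _ (mGE a) (GE0 a)).
have mF a : measurable_fun setT (fun t : mR => \int[leb]_l (G a (t, l))%:E)%E.
  exact: (@measurable_fun_fubini_tonelli_F _ _ _ _ _ leb _ (mGE a) (GE0 a)).
have step a : (\int[leb]_l (\int[leb]_t `|coeff f b a t l|%:E * \int[leb]_t `|coeff f b a t l|%:E *
      (psi (lev (size_mi a) * `|l|))%:E) <= W%:E * \int[leb]_t \int[leb]_l (G a (t, l))%:E)%E.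
  rewrite (fubini_tonelli _ (mGE a) (GE0 a))/=.
  rewrite -ge0_integralZl//; [|by move=> l _; apply: integral_ge0 => t _; rewrite lee_fin
    |by rewrite lee_fin ltW].
  apply: ge0_le_integral => //.
  - by move=> l _; rewrite mule_ge0// ?lee_fin// -expe2 sqre_ge0.
  - have mI : measurable_fun setT (fun l : mR => \int[leb]_t `|coeff f b a t l|%:E)%E.
      apply: (@measurable_fun_fubini_tonelli_G _ _ _ _ _ leb (fun p : mR * mR => `|coeff f b a p.1 p.2|%:E)) => //.
      by apply/measurable_EFinP; exact: (measurableT_comp (@measurable_realfun.normr_measurable R setT) (mc a)).
    apply: emeasurable_funM; first exact: emeasurable_funM.
    by apply/measurable_EFinP; exact: mpl.
  - exact: measurable_funeM.
  move=> l _.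
  have h := weighted_cauchy_schwarz (mcn a l) (fun t => normr_ge0 _) w0 iw W0.
  apply: (le_trans (lee_wpmul2r _ h)); first by rewrite lee_fin.
  rewrite -muleA lee_wpmul2l ?lee_fin ?(ltW W0)// muleC.
  rewrite -ge0_integralZl//; [|
    |by move=> t _; rewrite lee_fin divr_ge0 ?sqr_ge0// ltW|by rewrite lee_fin].
    rewrite le_eqVlt; apply/orP; left; apply/eqP; apply: eq_integral => t _.
    by rewrite -EFinM /G /H/= real_normK ?num_real//; congr EFin; rewrite mulrCA mulrA.
  apply/measurable_EFinP; apply: measurable_funM => //; apply: measurable_funX; exact: mcn.
apply: (le_trans (lee_sum _ (fun a _ => step a))).
rewrite -ge0_sume_distrr; last first.
  by move=> a _; apply: integral_ge0 => t _; apply: integral_ge0 => l _; rewrite lee_fin.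
rewrite -(ge0_integral_sum leb measurableT (f := fun a t => \int[leb]_l (G a (t, l))%:E)%E)//; last first.
  by move=> a t _; apply: integral_ge0 => l _; rewrite lee_fin.
rewrite [X in (_ <= X)%E](_ : _ = (W%:E * \int[leb]_t ((P * bessel_const n * (2 + 4 * pi))%:E * (w t)%:E))%E); last first.
  rewrite ge0_integralZl//; [|exact/measurable_EFinP|by move=> t _; rewrite lee_fin ltW
    |by rewrite lee_fin !mulr_ge0// addr_ge0// mulr_ge0// pi_ge0].
  by rewrite (EFin_Rint iw) -/W -!EFinM; congr EFin; ring.
rewrite lee_wpmul2l ?lee_fin ?(ltW W0)//; apply: ge0_le_integral => //.
- by move=> t _; apply: sume_ge0 => a _; apply: integral_ge0 => l _; rewrite lee_fin.
- by apply: emeasurable_sum => a; exact: mF.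
- by apply: measurable_funeM; exact/measurable_EFinP.
move=> t _.
have h := sum_coeff_le n_gt0 mf (f1 t) (f2 t) (f12 t) b us mpsi psi0 psiP (w0 t) q12 (wF t).
have -> : ((P * bessel_const n * (2 + 4 * pi))%:E * (w t)%:E =
   (w t)^-1%:E * (P * bessel_const n * ((2 + 4 * pi) * w t ^+ 2))%:E)%E.
  rewrite -!EFinM; congr EFin; have := w0 t; move: (w t) (bessel_const n) pi => x y z x0.
  by field; rewrite gt_eqF.
have w1 : (0 <= (w t)^-1%:E)%E by rewrite lee_fin invr_ge0 ltW.
apply: le_trans (lee_wpmul2l w1 h).
rewrite ge0_sume_distrr; last by move=> a _; apply: integral_ge0 => l _; rewrite lee_fin; exact: (H0 a (t, l)).
apply: lee_sum => a _; rewrite -ge0_integralZl//; last 2 first.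
- by apply/measurable_EFinP; exact: (measurable_slice1 t (mH a)).
- by move=> l _; rewrite lee_fin; exact: (H0 a (t, l)).
by rewrite le_eqVlt; apply/orP; left; apply/eqP; apply: eq_integral => l _; rewrite -EFinM mulrC.
Qed.

End time_integration.

(** * Schwartz functions *)

Section point_norm.
Context {R : realType} (n : nat).

Lemma rV_coord_le (x : 'rV[R]_n) j : `|x 0 j| <= `|x|.
Proof.
rewrite [leRHS]/Num.norm/= mx_normrE.
exact: (le_bigmax _ (fun ij : 'I_1 * 'I_n => `|x ij.1 ij.2|) (0, j)).
Qed.

Lemma rV_norm_le (x : 'rV[R]_n) e : 0 <= e -> (forall j, `|x 0 j| <= e) -> `|x| <= e.
Proof.
move=> e0 xe; rewrite /Num.norm/= mx_normrE; apply/bigmax_leP; split=> // -[i j] _ /=.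
by rewrite ord1.
Qed.

Lemma point_norm_le (z : hspace R n) e : 0 <= e -> (forall j, `|z.1.1 0 j| <= e) ->
  `|z.1.2| <= e -> `|z.2| <= e -> `|z| <= e.
Proof.
move=> e0 h1 h2 h3; rewrite /Num.norm/= ge_max h3 andbT.
by rewrite /Num.norm/= ge_max h2 andbT; exact: rV_norm_le.
Qed.

Lemma point_coord_le (z : hspace R n) :
  [/\ forall j, `|z.1.1 0 j| <= `|z|, `|z.1.2| <= `|z| & `|z.2| <= `|z|].
Proof.
have h : `|z| = Num.max (Num.max `|z.1.1| `|z.1.2|) `|z.2| by [].
by split; first move=> j; rewrite h !le_max ?lexx ?(rV_coord_le _ j) ?orbT.
Qed.

End point_norm.

Section continuous_measurable.
Context {R : realType} (n : nat).
Notation mR := (measurableTypeR R).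
Notation tR := (n.-tuple mR).

Let grid := ({ffun 'I_n -> int} * int * int)%type.
Let cell N (p : tR * mR * mR) : grid :=
  ([ffun j => Num.floor (N.+1%:R * tnth p.1.1 j)], Num.floor (N.+1%:R * p.1.2),
   Num.floor (N.+1%:R * p.2)).
Let corner N (k : grid) : hspace R n :=
  (\row_j ((k.1.1 j)%:~R / N.+1%:R), (k.1.2)%:~R / N.+1%:R, (k.2)%:~R / N.+1%:R).

Let measurable_floor_eq d (T : measurableType d) N (h : T -> mR) k : measurable_fun setT h ->
  measurable [set p | Num.floor (N.+1%:R * h p) = k].
Proof.
move=> mh; have mNh : measurable_fun setT (fun p => N.+1%:R * h p : mR).
  exact: (measurableT_comp (@measurable_realfun.mulrl_measurable R setT _) mh).
have -> : [set p | Num.floor (N.+1%:R * h p) = k] =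
    (fun p => N.+1%:R * h p) @^-1` [set` `[k%:~R, (k + 1)%:~R[ ].
  apply/seteqP; split => p /=.
    by move=> <-; rewrite in_itv /= floor_itv.
  by rewrite in_itv /=; exact: floor_def.
by rewrite -[X in measurable X]setTI; apply: mNh => //; exact: measurable_itv.
Qed.

Let measurable_cell N k : measurable [set p | cell N p = k].
Proof.
have -> : [set p | cell N p = k] =
  \bigcap_(j in [set: 'I_n]) [set p : tR * mR * mR | Num.floor (N.+1%:R * tnth p.1.1 j) = k.1.1 j] `&`
  ([set p : tR * mR * mR | Num.floor (N.+1%:R * p.1.2) = k.1.2] `&`
   [set p : tR * mR * mR | Num.floor (N.+1%:R * p.2) = k.2]).
  apply/seteqP; split => p /=.
    by move=> <-; split => // j _; rewrite /= ffunE.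
  case: k => -[k1 k2] k3 /= [h1 [h2 h3]]; rewrite /cell h2 h3; congr (_, _, _).
  by apply/ffunP => j; rewrite ffunE h1.
have m11 : measurable_fun setT (fun p : tR * mR * mR => p.1.1).
  exact: measurableT_comp measurable_fst measurable_fst.
apply: measurableI; last apply: measurableI.
- apply: fin_bigcap_measurable => // j _; apply: measurable_floor_eq.
  exact: measurableT_comp (measurable_tnth j) m11.
- by apply: measurable_floor_eq; exact: measurableT_comp measurable_snd measurable_fst.
- by apply: measurable_floor_eq; exact: measurable_snd.
Qed.

Let floor_dist N (x : R) : `|x - (Num.floor (N.+1%:R * x))%:~R / N.+1%:R| <= N.+1%:R^-1.
Proof.
have N0 : 0 < N.+1%:R :> R by [].
have /andP[h1 h2] := floor_itv (N.+1%:R * x).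
have -> : x - (Num.floor (N.+1%:R * x))%:~R / N.+1%:R =
   (N.+1%:R * x - (Num.floor (N.+1%:R * x))%:~R) / N.+1%:R.
  by rewrite mulrBl mulrAC divff ?mul1r// gt_eqF.
rewrite normrM (ger0_norm (x := N.+1%:R^-1)) ?invr_ge0// ler_piMl ?invr_ge0//.
rewrite ger0_norm ?subr_ge0// lerBlDl; apply: le_trans (ltW h2) _.
by rewrite intrD.
Qed.

(** Links the topology of row vectors to the product sigma-algebra on tuples: [g] is the limit of
    its values at the corner of the grid cell of mesh [1 / (N + 1)] containing the point, and the
    cells are countably many and measurable. *)
Lemma continuous_measurable_hspace (g : hspace R n -> R) : continuous g ->
  measurable_fun setT (fun p : tR * mR * mR => g (tuple_row p.1.1, p.1.2, p.2) : mR).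
Proof.
move=> cg; apply: (@measurable_fun_cvg _ _ _ _ (fun N p => g (corner N (cell N p)))).
  move=> N _ Y mY; rewrite setTI.
  have -> : (fun p => g (corner N (cell N p))) @^-1` Y =
      \bigcup_(k in [set: grid]) (if pselect (Y (g (corner N k))) then [set p | cell N p = k] else set0).
    apply/seteqP; split => p /=.
      by move=> Yp; exists (cell N p) => //; case: pselect.
    by move=> [k _]; case: pselect => //= Yk pk; rewrite pk.
  apply: countable_bigcupT_measurable => [|k]; first exact: countableP.
  by case: pselect => h; [exact: measurable_cell|exact: measurable0].
move=> p _; apply: (@continuous_cvg _ _ _ _ _ _ g); first exact: cg.
set z := (tuple_row p.1.1, p.1.2, p.2).
apply/cvgrPdist_le => e e0; near=> N.
apply: (@le_trans _ _ N.+1%:R^-1); last by apply: ltW; near: N; exact: (near_infty_natSinv_lt (PosNum e0)).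
apply: point_norm_le => [|j||]; rewrite ?invr_ge0// ?mxE/= ?ffunE; exact: floor_dist.
Unshelve. all: by end_near. Qed.

End continuous_measurable.

Section schwartz_decay.
Context {R : realType} (n : nat).
Notation mR := (measurableTypeR R).
Notation tR := (n.-tuple mR).
Notation leb := (@lebesgue_measure R).
Notation lebn := (@lebesgue_tuple R n).

Definition decay1 (x : R) : R := (1 + x ^+ 2)^-1.

Definition decayn (u : n.-tuple R) : R := \prod_(j < n) decay1 (tnth u j).

Lemma decay1_gt0 x : 0 < decay1 x.
Proof. by rewrite invr_gt0 ltr_wpDr ?sqr_ge0. Qed.

Lemma decay1_le1 x : decay1 x <= 1.
Proof. by rewrite invf_le1 ?ltr_wpDr ?sqr_ge0// lerDl sqr_ge0. Qed.

Lemma decayn_ge0 u : 0 <= decayn u.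
Proof. by apply: prodr_ge0 => j _; rewrite ltW// decay1_gt0. Qed.

Lemma decayn_le1 u : decayn u <= 1.
Proof. by apply: prodr_ile1 => j _; rewrite decay1_le1 ltW// decay1_gt0. Qed.

Lemma integ_decayn : integ lebn decayn.
Proof. by have [] := @tuple_integral_prod R n (fun=> decay1) (fun=> integ_inv1Dsqr). Qed.

(** The exponent [2 (n + 2)] supplies one factor [(1 + |z|)^2] for each of the [n + 2] scalar
    variables, and each such factor dominates [1 + x^2] for its variable. *)
Lemma schwartz_decay (g : hspace R n -> R) : schwartz g ->
  exists2 M, 0 <= M & forall u t s,
    `|g (tuple_row u, t, s)| <= M * (decayn u * decay1 t * decay1 s).
Proof.
move=> [_ /(_ [::] (2 * n.+2)%N)[M hM]]; exists M.
  by apply: le_trans (hM 0); rewrite mulr_ge0// exprn_ge0// addr_ge0.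
move=> u t s; set z := (tuple_row u, t, s).
have := hM z; rewrite /= exprM; set A := (1 + `|z|) ^+ 2 => h.
have [z1 z2 z3] := point_coord_le z.
have key x : `|x| <= `|z| -> 1 + x ^+ 2 <= A.
  move=> xz; rewrite /A -(real_normK (num_real x)).
  have := normr_ge0 x; have := normr_ge0 z; nra.
have A0 : 0 < A by rewrite exprn_gt0// ltr_wpDr.
have keyV x : `|x| <= `|z| -> A^-1 <= decay1 x.
  by move=> xz; rewrite lef_pV2 ?posrE ?key// ltr_wpDr ?sqr_ge0.
have M0 : 0 <= M by apply: le_trans (hM 0); rewrite mulr_ge0// exprn_ge0// addr_ge0.
have An0 : 0 < A ^+ n.+2 by rewrite exprn_gt0.
have : `|g z| <= M * (A ^+ n.+2)^-1 by rewrite ler_pdivlMr// mulrC.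
move/le_trans; apply; rewrite ler_wpM2l// -exprVn !exprSr.
have AV : 0 <= A^-1 by rewrite invr_ge0 ltW.
have dn : A^-1 ^+ n <= decayn u.
  rewrite -[n in _ ^+ n]card_ord -prodr_const; apply: ler_prod => j _.
  by rewrite AV keyV//; have := z1 j; rewrite mxE.
apply: ler_pM; rewrite ?mulr_ge0 ?exprn_ge0 ?keyV//.
by apply: ler_pM; rewrite ?exprn_ge0 ?keyV.
Qed.

End schwartz_decay.

Lemma Rint_swap d1 d2 (T1 : measurableType d1) (T2 : measurableType d2) (R : realType)
    (m1 : {sigma_finite_measure set T1 -> \bar R})
    (m2 : {sigma_finite_measure set T2 -> \bar R}) (K : T1 * T2 -> R) :
  integ (m1 \x m2)%E K -> (forall x, integ m2 (fun y => K (x, y))) ->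
  (forall y, integ m1 (fun x => K (x, y))) ->
  \int[m1]_x \int[m2]_y K (x, y) = \int[m2]_y \int[m1]_x K (x, y).
Proof.
move=> iK i2 i1; rewrite /Rintegral; congr fine.
under eq_integral => x _ do rewrite -/(Rintegral m2 setT (fun y => K (x, y))) -(EFin_Rint (i2 x)).
under [RHS]eq_integral => y _ do rewrite -/(Rintegral m1 setT (fun x => K (x, y))) -(EFin_Rint (i1 y)).
exact: (Fubini iK).
Qed.

Section decaying_functions.
Context {R : realType} (n : nat).
Notation mR := (measurableTypeR R).
Notation tR := (n.-tuple mR).
Notation leb := (@lebesgue_measure R).
Notation lebn := (@lebesgue_tuple R n).
Notation lev := (@lev R n).

(** Domination by a product of integrable functions of separate variables yields the integrability
    of every slice and of the joint integrands for Fubini. *)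
Definition decaying (g : tR * mR * mR -> R) := measurable_fun setT g /\
  exists2 M, 0 <= M & forall u t s, `|g (u, t, s)| <= M * (decayn u * decay1 t * decay1 s).

Lemma schwartz_decaying (g : hspace R n -> R) : schwartz g ->
  decaying (fun p => g (tuple_row p.1.1, p.1.2, p.2)).
Proof.
move=> sg; split; last exact: schwartz_decay.
by apply: continuous_measurable_hspace; have [/(_ [::])[]] := sg.
Qed.

Section one_function.
Variables (g : tR * mR * mR -> R) (M : R).
Hypotheses (mg : measurable_fun setT g) (M0 : 0 <= M)
  (gM : forall u t s, `|g (u, t, s)| <= M * (decayn u * decay1 t * decay1 s)).

Let measurable_gs t u : measurable_fun setT (fun s : mR => g (u, t, s)).
Proof. exact: (measurable_slice1 (u, t) mg). Qed.

Let measurable_gu t s : measurable_fun setT (fun u : tR => g (u, t, s)).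
Proof.
exact: (measurable_slice2 t (measurable_slice2 s mg)).
Qed.

Let gMs u t s : `|g (u, t, s)| <= M * decayn u * decay1 t * decay1 s.
Proof.
have -> : M * decayn u * decay1 t * decay1 s = M * (decayn u * decay1 t * decay1 s) by ring.
exact: gM.
Qed.

Lemma integ_s u t : integ leb (fun s => g (u, t, s)).
Proof.
apply: le_integ (gMs u t) _; first exact: measurable_gs.
exact: (integZl _ integ_inv1Dsqr).
Qed.

Lemma Rint_s_le u t : \int[leb]_s `|g (u, t, s)| <= M * decayn u * decay1 t * pi.
Proof.
apply: le_trans (le_Rint (integ_norm (integ_s u t)) (integZl _ integ_inv1Dsqr) (gMs u t)) _.
rewrite (RintZl _ integ_inv1Dsqr).
have -> : \int[leb]_x (1 + x ^+ 2)^-1 = pi :> R.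
  by apply: EFin_inj; rewrite -EFin_Rint ?integral_inv1Dsqr//; exact: integ_inv1Dsqr.
by [].
Qed.

Lemma integ_u2 t s : integ lebn (fun u => g (u, t, s) ^+ 2).
Proof.
apply: (@le_integ _ _ _ lebn _ (fun u => M ^+ 2 * decayn u)).
- exact: (measurable_funX 2 (measurable_gu t s)).
- move=> u; rewrite normrX.
  apply: (@le_trans _ _ ((M * decayn u) ^+ 2)).
    rewrite lerXn2r ?nnegrE ?mulr_ge0 ?decayn_ge0//; apply: le_trans (gM u t s) _.
    rewrite ler_wpM2l// -mulrA ler_piMr ?decayn_ge0//.
    by rewrite mulr_ile1 ?decay1_le1// ltW// decay1_gt0.
  by rewrite exprMn ler_wpM2l ?sqr_ge0// expr2 ler_piMr ?decayn_ge0 ?decayn_le1.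
- exact: integZl (@integ_decayn R n).
Qed.

Lemma integ_u_sqr_int t : integ lebn (fun u => (\int[leb]_s `|g (u, t, s)|) ^+ 2).
Proof.
apply: (@le_integ _ _ _ lebn _ (fun u => (M * pi) ^+ 2 * decayn u)).
- apply: measurable_funX.
  have := @measurable_Rint _ _ tR mR R leb (fun p : tR * mR => `|g (p.1, t, p.2)|).
  apply; apply: (measurableT_comp (@measurable_realfun.normr_measurable R setT)).
  apply: (measurableT_comp mg (g := fun p : tR * mR => ((p.1, t), p.2))).
  apply: measurable_fun_pair; last exact: measurable_snd.
  by apply: measurable_fun_pair; [exact: measurable_fst|exact: measurable_cst].
- move=> u; rewrite normrX ger0_norm; last by apply: Rint_ge0.
  apply: (@le_trans _ _ ((M * pi * decayn u) ^+ 2)).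
    rewrite lerXn2r ?nnegrE ?mulr_ge0 ?decayn_ge0 ?pi_ge0//; first by apply: Rint_ge0.
    apply: (le_trans (Rint_s_le u t)).
    rewrite [leRHS]mulrAC ler_wpM2r ?pi_ge0// ler_piMr ?decay1_le1//.
    by rewrite mulr_ge0 ?decayn_ge0.
  by rewrite [leLHS]exprMn ler_wpM2l ?sqr_ge0// expr2 ler_piMr ?decayn_ge0 ?decayn_le1.
- exact: integZl (@integ_decayn R n).
Qed.

Variables (a : multi_index n) (l : R).
Hypothesis l0 : l != 0.
Let v := lev (size_mi a) * `|l|.
Let h u := nhermite `|l| a u : R.

Let mh : measurable_fun setT h.
Proof. exact: measurable_nhermite. Qed.

Let integ_h2 : integ lebn (fun u => h u ^+ 2).
Proof.
have nl : 0 < `|l| by rewrite normr_gt0.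
have i1 (j : 'I_n) : integ leb (fun x => shermite `|l| (a j) x ^+ 2).
  by apply: eq_integ (integ_shermite (a j) (a j) nl) => x; rewrite expr2.
have [+ _] := tuple_integral_prod i1.
by apply: eq_integ => u; rewrite /h /nhermite -prodrXl.
Qed.

(** Dominates the [u]-dependence of the integrand; it is integrable as a product of two
    square-integrable functions. *)
Let D u := decayn u * `|h u|.

Let D0 u : 0 <= D u.
Proof. by rewrite mulr_ge0 ?decayn_ge0. Qed.

Let integ_D : integ lebn D.
Proof.
apply: integM.
- exact: integ_measurable (@integ_decayn R n).
- exact: (measurableT_comp (@measurable_realfun.normr_measurable R setT) mh).
- apply: le_integ (@integ_decayn R n).
    exact: (measurable_funX 2 (integ_measurable (@integ_decayn R n))).
  by move=> u; rewrite normrX ger0_norm ?decayn_ge0// expr2 ler_piMr ?decayn_ge0 ?decayn_le1.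
- by apply: eq_integ integ_h2 => u; rewrite real_normK ?num_real.
Qed.

Let K b c (p : tR * mR) := trig b (l * p.2) * (ft g c v p.2 p.1 * h p.1).

Let measurable_K b c : measurable_fun setT (K b c).
Proof.
apply: measurable_funM.
  apply: (measurableT_comp (measurable_trig b)).
  exact: (measurableT_comp (@measurable_realfun.mulrl_measurable R setT l) measurable_snd).
apply: measurable_funM; last exact: measurableT_comp mh measurable_fst.
apply: (measurableT_comp (measurable_ft mg c) (g := fun p : tR * mR => ((v, p.2), p.1))).
apply: measurable_fun_pair; last exact: measurable_fst.
by apply: measurable_fun_pair; [exact: measurable_cst|exact: measurable_snd].
Qed.

Let ft_le c t u : `|ft g c v t u| <= M * decayn u * decay1 t * pi.
Proof.
apply: le_trans (Rint_s_le u t).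
have i1 := integ_trig c v (integ_s u t).
apply: (le_trans (le_normr_Rintegral measurableT i1)).
apply: le_Rint; [exact: integ_norm|exact: integ_norm (integ_s u t)|move=> s].
by rewrite normrM ler_piMl// trig_max.
Qed.

Let fth_le c t u : `|ft g c v t u * h u| <= M * pi * decay1 t * D u.
Proof.
rewrite normrM; apply: le_trans (ler_wpM2r (normr_ge0 _) (ft_le c t u)) _.
by rewrite /D le_eqVlt; apply/orP; left; apply/eqP; ring.
Qed.

Let K_le b c p : `|K b c p| <= M * pi * (D p.1 * decay1 p.2).
Proof.
rewrite normrM; apply: (@le_trans _ _ (`|ft g c v p.2 p.1 * h p.1|)).
  by rewrite ler_piMl// trig_max.
have -> : M * pi * (D p.1 * decay1 p.2) = M * pi * decay1 p.2 * D p.1 by ring.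
exact: fth_le.
Qed.

Let integ_K b c : integ (lebn \x leb)%E (K b c).
Proof.
apply: le_integ (K_le b c) _ => //.
exact: integZl (integ_tensor integ_D integ_inv1Dsqr).
Qed.

Let integ_Kt b c u : integ leb (fun t => K b c (u, t)).
Proof.
apply: (@le_integ _ _ _ leb _ (fun t => M * pi * D u * decay1 t)).
- exact: measurable_slice1 (measurable_K b c).
- by move=> t; rewrite -mulrA; exact: K_le.
- exact: integZl integ_inv1Dsqr.
Qed.

Let integ_fth c t : integ lebn (fun u => ft g c v t u * h u).
Proof.
apply: (@le_integ _ _ _ lebn _ (fun u => M * pi * decay1 t * D u)) => //.
- apply: measurable_funM => //.
  exact: (measurable_slice1 (v, t) (measurable_ft mg c)).
- exact: integZl integ_D.
Qed.

Lemma integ_coeff c : integ leb (fun t => coeff g c a t l).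
Proof.
apply: (@le_integ _ _ _ leb _ (fun t => M * pi * \int[lebn]_u D u * decay1 t)).
- exact: (measurable_slice2 l (measurable_coeff mg c a)).
- move=> t; apply: (le_trans (le_normr_Rintegral measurableT (integ_fth c t))).
  have i2 := integZl (M * pi * decay1 t) integ_D.
  apply: le_trans (le_Rint (integ_norm (integ_fth c t)) i2 (fth_le c t)) _.
  by rewrite (RintZl _ integ_D) mulrAC.
- exact: integZl integ_inv1Dsqr.
Qed.

Let integ_trig_s b c u t :
  integ leb (fun s => trig b (l * t) * trig c (v * s) * g (u, t, s) * h u).
Proof.
apply: eq_integ (integZl (trig b (l * t) * h u) (integ_trig c v (integ_s u t))) => s.
by ring.
Qed.

Let Rint_trig_s b c u t :
  \int[leb]_s (trig b (l * t) * trig c (v * s) * g (u, t, s) * h u) = K b c (u, t).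
Proof.
have -> : K b c (u, t) = trig b (l * t) * h u * ft g c v t u by rewrite /K /=; ring.
rewrite /ft -(RintZl _ (integ_trig c v (integ_s u t))).
by apply: eq_Rint => s; ring.
Qed.

(** The three integrability claims allow sums of such terms to be integrated stage by stage. For the
    bound, exchanging [u] and [t] makes the inner integral a [coeff], and the trigonometric factor
    in [t] is at most 1. *)
Lemma triple_integral b c :
  [/\ forall u t, integ leb (fun s => trig b (l * t) * trig c (v * s) * g (u, t, s) * h u),
    forall u, integ leb (fun t => \int[leb]_s (trig b (l * t) * trig c (v * s) * g (u, t, s) * h u)),
    integ lebn (fun u => \int[leb]_t \int[leb]_s (trig b (l * t) * trig c (v * s) * g (u, t, s) * h u)) &
    `|\int[lebn]_u \int[leb]_t \int[leb]_s (trig b (l * t) * trig c (v * s) * g (u, t, s) * h u)| <=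
      \int[leb]_t `|coeff g c a t l|].
Proof.
split.
- exact: integ_trig_s.
- by move=> u; apply: eq_integ (integ_Kt b c u) => t; rewrite Rint_trig_s.
- apply: (@eq_integ _ _ _ _ (fun u => \int[leb]_t K b c (u, t))).
    by move=> u; apply: eq_Rint => t; rewrite Rint_trig_s.
  apply: (@le_integ _ _ _ lebn _ (fun u => M * pi * \int[leb]_t decay1 t * D u)).
  + exact: (@measurable_Rint _ _ tR mR R leb (K b c) (measurable_K b c)).
  + move=> u; apply: (le_trans (le_normr_Rintegral measurableT (integ_Kt b c u))).
    have i2 : integ leb (fun t => M * pi * D u * decay1 t) by exact: integZl integ_inv1Dsqr.
    have le t : `|K b c (u, t)| <= M * pi * D u * decay1 t by rewrite -[leRHS]mulrA; exact: K_le.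
    apply: le_trans (le_Rint (integ_norm (integ_Kt b c u)) i2 le) _.
    by rewrite (RintZl _ integ_inv1Dsqr) mulrAC.
  + exact: integZl integ_D.
have -> : \int[lebn]_u \int[leb]_t \int[leb]_s (trig b (l * t) * trig c (v * s) * g (u, t, s) * h u) =
    \int[leb]_t (trig b (l * t) * coeff g c a t l).
  transitivity (\int[lebn]_u \int[leb]_t K b c (u, t)).
    by apply: eq_Rint => u; apply: eq_Rint => t; rewrite Rint_trig_s.
  have iKu t : integ lebn (fun u => K b c (u, t)).
    exact: (integZl (trig b (l * t)) (integ_fth c t)).
  rewrite (Rint_swap (integ_K b c) (integ_Kt b c) iKu).
  by apply: eq_Rint => t; exact: (RintZl (trig b (l * t)) (integ_fth c t)).
have ic := integ_trig b l (integ_coeff c).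
apply: (le_trans (le_normr_Rintegral measurableT ic)).
apply: le_Rint; [exact: integ_norm|exact: integ_norm (integ_coeff c)|move=> t].
by rewrite normrM ler_piMl// trig_max.
Qed.

End one_function.

End decaying_functions.

Section fourier_coefficients.
Context {R : realType} (n : nat).
Notation mR := (measurableTypeR R).
Notation tR := (n.-tuple mR).
Notation leb := (@lebesgue_measure R).
Notation lebn := (@lebesgue_tuple R n).
Notation lev := (@lev R n).

Lemma Phi_scaled_nhermite (a : multi_index n) l (u : n.-tuple R) :
  Phi_scaled a l (tuple_row u) = nhermite `|l| a u.
Proof.
rewrite /Phi_scaled /nhermite /shermite big_split/= prodr_const card_ord.
rewrite -powR_mulrn ?powR_ge0// -powRrM [4^-1 * _]mulrC; congr (_ * _).
by apply: eq_bigr => j _; rewrite !mxE.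
Qed.

Variables (a : multi_index n) (l : R).
Hypothesis l0 : l != 0.
Let v := lev (size_mi a) * `|l|.

Lemma sum_triple_integral_le (G : bool * bool -> tR * mR * mR -> R) (sg : bool * bool -> R)
    (r : seq (bool * bool)) : (forall i, decaying (G i)) -> (forall i, `|sg i| <= 1) ->
  `|\int[lebn]_u \int[leb]_t \int[leb]_s (\sum_(i <- r)
     sg i * (trig i.1 (l * t) * trig i.2 (v * s) * G i (u, t, s) * nhermite `|l| a u))| <=
  \sum_(i <- r) \int[leb]_t `|coeff (G i) i.2 a t l|.
Proof.
move=> dG sg1.
have key i := let: conj mG (ex_intro2 _ M0 GM) := dG i in
  @triple_integral R n (G i) _ mG GM a l l0 i.1 i.2.
pose I i u t s := trig i.1 (l * t) * trig i.2 (v * s) * G i (u, t, s) * nhermite `|l| a u.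
have Is i u t : integ leb (I i u t) by have [h _ _ _] := key i; exact: h.
have It i u : integ leb (fun t => \int[leb]_s I i u t s) by have [_ h _ _] := key i; exact: h.
have Iu i : integ lebn (fun u => \int[leb]_t \int[leb]_s I i u t s) by have [_ _ h _] := key i; exact: h.
have -> : \int[lebn]_u \int[leb]_t \int[leb]_s (\sum_(i <- r)
     sg i * (trig i.1 (l * t) * trig i.2 (v * s) * G i (u, t, s) * nhermite `|l| a u)) =
   \sum_(i <- r) sg i * \int[lebn]_u \int[leb]_t \int[leb]_s I i u t s.
  transitivity (\int[lebn]_u \sum_(i <- r) sg i * \int[leb]_t \int[leb]_s I i u t s).
    apply: eq_Rint => u.
    transitivity (\int[leb]_t \sum_(i <- r) sg i * \int[leb]_s I i u t s).
      apply: eq_Rint => t.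
      rewrite (@Rint_sum _ _ _ leb _ r xpredT (fun i s => sg i * I i u t s)); last first.
        by move=> i; exact: integZl (Is i u t).
      by apply: eq_bigr => i _; exact: RintZl (Is i u t).
    rewrite (@Rint_sum _ _ _ leb _ r xpredT (fun i t => sg i * \int[leb]_s I i u t s)); last first.
      by move=> i; exact: integZl (It i u).
    by apply: eq_bigr => i _; exact: RintZl (It i u).
  rewrite (@Rint_sum _ _ _ lebn _ r xpredT (fun i u => sg i * \int[leb]_t \int[leb]_s I i u t s)); last first.
    by move=> i; exact: integZl (Iu i).
  by apply: eq_bigr => i _; exact: RintZl (Iu i).
apply: (le_trans (ler_norm_sum _ _ _)); apply: ler_sum => i _.
rewrite normrM; have [_ _ _] := key i; apply: le_trans.
by rewrite ler_piMl.
Qed.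

Variable f : hspace R n -> R[i].
Let p (z : tR * mR * mR) : R := complex.Re (f (tuple_row z.1.1, z.1.2, z.2)).
Let q (z : tR * mR * mR) : R := complex.Im (f (tuple_row z.1.1, z.1.2, z.2)).
Hypotheses (dp : decaying p) (dq : decaying q).
Let T g c := \int[leb]_t `|@coeff R n g c a t l|.

Let signs := [:: (true, true); (true, false); (false, true); (false, false)].

Let Re_le : `|complex.Re (hermite_fourier f (a, l, v))| <=
  T p true + T p false + T q true + T q false.
Proof.
(* In the real part of the two characters times [p + i q], two cosines or two sines go with [p] and
   mixed products with [q]; only the product of two cosines has sign +. *)
pose G (i : bool * bool) := if i.1 == i.2 then p else q.
pose sg (i : bool * bool) : R := if i.1 && i.2 then 1 else -1.
have dG i : decaying (G i) by rewrite /G; case: ifP.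
have sg1 i : `|sg i| <= 1 by rewrite /sg; case: ifP; rewrite ?normrN normr1.
have sumT : \sum_(i <- signs) \int[leb]_t `|coeff (G i) i.2 a t l| =
  T p true + (T q false + (T q true + (T p false + 0))) by rewrite !big_cons big_nil.
have -> : complex.Re (hermite_fourier f (a, l, v)) =
  \int[lebn]_u \int[leb]_t \int[leb]_s (\sum_(i <- signs)
     sg i * (trig i.1 (l * t) * trig i.2 (v * s) * G i (u, t, s) * nhermite `|l| a u)).
  apply: eq_Rint => u; apply: eq_Rint => t; apply: eq_Rint => s.
  rewrite Phi_scaled_nhermite !big_cons big_nil /sg /G /= /p /q /=.
  by case: (f _) => x y /=; ring.
apply: (le_trans (sum_triple_integral_le signs dG sg1)); rewrite sumT.
move: (T p true) (T p false) (T q true) (T q false) => x y z w.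
by rewrite le_eqVlt; apply/orP; left; apply/eqP; ring.
Qed.

Let Im_le : `|complex.Im (hermite_fourier f (a, l, v))| <=
  T p true + T p false + T q true + T q false.
Proof.
(* In the imaginary part [p] and [q] are exchanged, and only the product of two sines has sign -. *)
pose G (i : bool * bool) := if i.1 == i.2 then q else p.
pose sg (i : bool * bool) : R := if i.1 || i.2 then 1 else -1.
have dG i : decaying (G i) by rewrite /G; case: ifP.
have sg1 i : `|sg i| <= 1 by rewrite /sg; case: ifP; rewrite ?normrN normr1.
have sumT : \sum_(i <- signs) \int[leb]_t `|coeff (G i) i.2 a t l| =
  T q true + (T p false + (T p true + (T q false + 0))) by rewrite !big_cons big_nil.
have -> : complex.Im (hermite_fourier f (a, l, v)) =
  \int[lebn]_u \int[leb]_t \int[leb]_s (\sum_(i <- signs)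
     sg i * (trig i.1 (l * t) * trig i.2 (v * s) * G i (u, t, s) * nhermite `|l| a u)).
  apply: eq_Rint => u; apply: eq_Rint => t; apply: eq_Rint => s.
  rewrite Phi_scaled_nhermite !big_cons big_nil /sg /G /= /p /q /=.
  by case: (f _) => x y /=; ring.
apply: (le_trans (sum_triple_integral_le signs dG sg1)); rewrite sumT.
move: (T p true) (T p false) (T q true) (T q false) => x y z w.
by rewrite le_eqVlt; apply/orP; left; apply/eqP; ring.
Qed.

Lemma sqnormE (z : R[i]) : sqnorm z = complex.Re z ^+ 2 + complex.Im z ^+ 2.
Proof. by case: z => x y; rewrite /sqnorm /= sqr_sqrtr// addr_ge0// sqr_ge0. Qed.

(** The constant 8 is 2, for the real and imaginary parts, times 4, for the square of a sum of four
    terms. *)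
Lemma sqnorm_hermite_fourier_le : sqnorm (hermite_fourier f (a, l, level a l)) <=
  8 * (T p true ^+ 2 + T p false ^+ 2 + T q true ^+ 2 + T q false ^+ 2).
Proof.
rewrite sqnormE -[level a l]/v.
pose S := T p true + T p false + T q true + T q false.
have T0 g c : 0 <= T g c by apply: Rint_ge0.
have S0 : 0 <= S by rewrite !addr_ge0.
have h x : `|x| <= S -> x ^+ 2 <= S ^+ 2.
  by move=> xS; rewrite -(real_normK (num_real x)) lerXn2r ?nnegrE.
have hR := h _ Re_le; have hI := h _ Im_le.
apply: (le_trans (lerD hR hI)); rewrite /S.
move: (T p true) (T p false) (T q true) (T q false) => x y z w; rewrite -subr_ge0.
have -> : 8 * (x ^+ 2 + y ^+ 2 + z ^+ 2 + w ^+ 2) - ((x + y + z + w) ^+ 2 + (x + y + z + w) ^+ 2) =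
  2 * ((x - y) ^+ 2 + (x - z) ^+ 2 + (x - w) ^+ 2 + (y - z) ^+ 2 + (y - w) ^+ 2 + (z - w) ^+ 2) by ring.
by rewrite mulr_ge0// !addr_ge0// sqr_ge0.
Qed.

End fourier_coefficients.

(** * The restriction estimate *)

(** Read off from the integral as a supremum over simple functions below the integrand. It lets the
    transform on the surface enter the estimate through a pointwise bound alone. *)
Lemma ge0_le_integral_nomeas d (T : measurableType d) (R : realType)
    (mu : {measure set T -> \bar R}) (D : set T) (f g : T -> \bar R) :
  (forall x, D x -> 0 <= f x)%E -> (forall x, 0 <= g x)%E -> (forall x, D x -> f x <= g x)%E ->
  (\int[mu]_(x in D) f x <= \int[mu]_x g x)%E.
Proof.
move=> f0 g0 fg; rewrite ge0_integralE// ge0_integralTE//.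
apply: ge_ereal_sup => /= _ [h hf <-]; apply: ereal_sup_ubound; exists h => //= x.
apply: le_trans (hf x) _; rewrite patchE; case: ifPn => // /set_mem Dx.
exact: fg.
Qed.

Lemma le_expRN_of_compact_supp (R : realType) (psi : R -> R) : continuous psi ->
  compact (closure [set x | psi x != 0]) -> exists P, forall x, psi x <= P * expR (- `|x|).
Proof.
move=> cpsi cK; set K := closure _ in cK.
pose h x := psi x * expR `|x|.
have ch : continuous h.
  move=> x; apply: cvgM; first exact: cpsi.
  by apply: continuous_comp; [exact: norm_continuous|exact: continuous_expR].
have /compact_bounded[N [_ hN]] : compact (h @` K).
  by apply: continuous_compact => //; exact: continuous_subspaceT.
(* [compact_bounded] provides a bound for every real above [N], whose sign is unknown. This witness
   is above [N], and it is nonnegative, as needed off the support. *)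
exists `|N + 1 + `|N| |; move=> x; rewrite expRN ler_pdivlMr ?expR_gt0//.
have [Kx|nKx] := pselect (K x).
  apply: le_trans (ler_norm _) _.
  apply: hN; last by exists x.
  have := ler_norm (N + 1 + `|N|); have := normr_ge0 N; lra.
have -> : psi x = 0 by apply/eqP/negPn/negP => p0; apply: nKx; exact: subset_closure.
by rewrite mul0r.
Qed.

(** * The weight in [t] built from the mixed norm *)

Section mixed_norm_weight.
Context {R : realType} (n : nat).
Notation mR := (measurableTypeR R).
Notation tR := (n.-tuple mR).
Notation leb := (@lebesgue_measure R).
Notation lebn := (@lebesgue_tuple R n).
Variable f : hspace R n -> R[i].
Let fr (z : tR * mR * mR) : R := complex.Re (f (tuple_row z.1.1, z.1.2, z.2)).
Let fi (z : tR * mR * mR) : R := complex.Im (f (tuple_row z.1.1, z.1.2, z.2)).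
Hypotheses (dr : decaying fr) (di : decaying fi).
Variable q : R.
Hypothesis q12 : 1 <= q <= 2.

Let q0 : 0 < q. Proof. by case/andP: q12 => q1 _; apply: lt_le_trans q1. Qed.

Let decaying_integ_u2 g t s : decaying g -> integ lebn (fun u => g (u, t, s) ^+ 2).
Proof. by move=> [mg [M M0 gM]]; exact: (integ_u2 mg M0 gM). Qed.

(** The squared L^2 norm of a slice in physical space, unlike the frequency-side quantity called
    [energy] in the estimates at fixed [t]. *)
Definition energy t s := \int[lebn]_u sqnorm (f (tuple_row u, t, s)).

Let sqnormfE u t s : sqnorm (f (tuple_row u, t, s)) = fr (u, t, s) ^+ 2 + fi (u, t, s) ^+ 2.
Proof. exact: sqnormE. Qed.

Let integ_sqnorm t s : integ lebn (fun u => sqnorm (f (tuple_row u, t, s))).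
Proof.
apply: (@eq_integ _ _ _ _ (fun u => fr (u, t, s) ^+ 2 + fi (u, t, s) ^+ 2)).
  by move=> u; rewrite sqnormfE.
by apply: integD; exact: decaying_integ_u2.
Qed.

Lemma energy_ge0 t s : 0 <= energy t s.
Proof. by apply: Rint_ge0 => u; rewrite sqnormfE addr_ge0 ?sqr_ge0. Qed.

Lemma sqr_le_energy g t s : (g = fr \/ g = fi) -> \int[lebn]_u (g (u, t, s) ^+ 2) <= energy t s.
Proof.
move=> gE; apply: le_Rint => //; first by case: gE => ->; exact: decaying_integ_u2.
by move=> u; rewrite sqnormfE; case: gE => ->; rewrite ?lerDl ?lerDr sqr_ge0.
Qed.

Let measurable_energy : measurable_fun setT (fun p : mR * mR => energy p.1 p.2 : mR).
Proof.
have := @measurable_Rint _ _ (mR * mR)%type tR R lebn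
  (fun z : mR * mR * tR => fr (z.2, z.1.1, z.1.2) ^+ 2 + fi (z.2, z.1.1, z.1.2) ^+ 2).
rewrite (_ : (fun x : mR * mR => \int[lebn]_y _) = (fun p : mR * mR => energy p.1 p.2)); last first.
  by apply/funext => p; apply: eq_Rint => u; rewrite -sqnormfE.
apply.
have [mfr _] := dr; have [mfi _] := di.
have mz : measurable_fun setT (fun z : mR * mR * tR => ((z.2, z.1.1), z.1.2) : tR * mR * mR).
  apply: measurable_fun_pair; last exact: (measurableT_comp measurable_snd measurable_fst).
  apply: measurable_fun_pair; first exact: measurable_snd.
  exact: (measurableT_comp measurable_fst measurable_fst).
by apply: measurable_funD; apply: measurable_funX; [exact: (measurableT_comp mfr mz)|exact: (measurableT_comp mfi mz)].
Qed.

Let energy_le : exists2 c, 0 <= c & forall t s, energy t s <= c * decay1 s ^+ 2.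
Proof.
have [_ [M1 M10 h1]] := dr; have [_ [M2 M20 h2]] := di.
set D := \int[lebn]_u decayn u.
have D0 : 0 <= D by apply: Rint_ge0 => u; exact: decayn_ge0.
exists ((M1 ^+ 2 + M2 ^+ 2) * D) => [|t s].
  by rewrite mulr_ge0// addr_ge0// sqr_ge0.
have key (g : tR * mR * mR -> R) (M : R) (u : tR) : 0 <= M ->
    (`|g (u, t, s)| <= M * (decayn u * decay1 t * decay1 s)) ->
    g (u, t, s) ^+ 2 <= M ^+ 2 * (decay1 s ^+ 2 * decayn u).
  move=> M0 gM; rewrite -(real_normK (num_real (g _))).
  have d1 (x : R) : 0 <= decay1 x := ltW (decay1_gt0 x).
  apply: (@le_trans _ _ ((M * (decayn u * decay1 s)) ^+ 2)).
    rewrite lerXn2r ?nnegrE ?mulr_ge0 ?decayn_ge0 ?d1//; apply: le_trans gM _.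
    rewrite ler_wpM2l// (ler_wpM2r (d1 s))// ler_piMr ?decayn_ge0// decay1_le1//.
  rewrite exprMn ler_wpM2l ?sqr_ge0// exprMn mulrC ler_wpM2l ?sqr_ge0//.
  by rewrite expr2 ler_piMr ?decayn_ge0 ?decayn_le1.
have -> : (M1 ^+ 2 + M2 ^+ 2) * D * decay1 s ^+ 2 =
   \int[lebn]_u ((M1 ^+ 2 + M2 ^+ 2) * decay1 s ^+ 2 * decayn u).
  by rewrite (RintZl _ (@integ_decayn R n)) mulrAC.
apply: le_Rint => //; first exact: integZl (@integ_decayn R n).
move=> u; rewrite sqnormfE.
have k1 := key fr _ u M10 (h1 u t s); have k2 := key fi _ u M20 (h2 u t s).
apply: (le_trans (lerD k1 k2)).
by rewrite -mulrDl mulrA.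
Qed.

Let measurable_powRl (r : R) : measurable_fun setT (fun x : mR => x `^ r : mR).
Proof. exact: measurable_powR. Qed.

Lemma integ_energy_pow t : integ leb (fun s => energy t s `^ (q / 2)).
Proof.
have [c c0 hc] := energy_le.
have q20 : 0 <= q / 2 by rewrite divr_ge0// ltW.
apply: (@le_integ _ _ _ leb _ (fun s => c `^ (q / 2) * decay1 s)).
- apply: (measurableT_comp (measurable_powRl (q / 2))).
  exact: (measurable_slice1 t measurable_energy).
- move=> s; rewrite ger0_norm ?powR_ge0//.
  have d0 := decay1_gt0 s.
  apply: (@le_trans _ _ ((c * decay1 s ^+ 2) `^ (q / 2))).
    have c1 := mulr_ge0 c0 (sqr_ge0 (decay1 s)).
    by apply: (ge0_ler_powR q20); rewrite ?nnegrE ?energy_ge0 ?hc.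
  rewrite powRM ?sqr_ge0// ler_wpM2l ?powR_ge0//.
  (* The power [q / 2] of [decay1 s ^+ 2] is the power [q] of [decay1 s], at most [decay1 s] because
     [decay1 s <= 1 <= q]. *)
  rewrite -powR_mulrn ?(ltW d0)// -powRrM mulrCA divff// mulr1.
  rewrite -[leRHS]powRr1 ?(ltW d0)//; apply: ger_powR; first by rewrite d0 decay1_le1.
  by case/andP: q12.
- exact: integZl integ_inv1Dsqr.
Qed.

Definition weight (e t : R) := (\int[leb]_s (energy t s `^ (q / 2))) `^ q^-1 + e * decay1 t.

Lemma mixed_normE : mixed_norm q f = (\int[leb]_t (weight 0 t)%:E)%E.
Proof.
apply: eq_integral => t _.
rewrite /weight mul0r addr0 -poweR_EFin; congr (poweR _ _).
rewrite -(EFin_Rint (integ_energy_pow t)); apply: eq_integral => s _.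
by rewrite -poweR_EFin /energy -(EFin_Rint (integ_sqnorm t s)).
Qed.

Lemma weight_gt0 e t : 0 < e -> 0 < weight e t.
Proof. by move=> e0; rewrite ltr_wpDl ?powR_ge0// mulr_gt0// decay1_gt0. Qed.

Lemma measurable_weight e : measurable_fun setT (weight e).
Proof.
apply: measurable_funD; last first.
  apply: measurable_funM; first exact: measurable_cst.
  exact: integ_measurable integ_inv1Dsqr.
apply: (measurableT_comp (measurable_powRl q^-1)).
have := @measurable_Rint _ _ mR mR R leb (fun p : mR * mR => energy p.1 p.2 `^ (q / 2)).
by apply; exact: (measurableT_comp (measurable_powRl (q / 2)) measurable_energy).
Qed.

Lemma integral_weight e m : 0 < e -> mixed_norm q f = m%:E ->
  integ leb (weight e) /\ \int[leb]_t weight e t = m + e * pi.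
Proof.
move=> e0 mE.
have w0 t : 0 <= weight 0 t by rewrite /weight mul0r addr0 powR_ge0.
have i0 : integ leb (weight 0).
  apply/integrableP; split; first by apply/measurable_EFinP; exact: measurable_weight.
  under eq_integral do rewrite /= ger0_norm//.
  by rewrite -mixed_normE mE ltry.
have i1 : integ leb (fun t => e * decay1 t) by exact: integZl integ_inv1Dsqr.
have wE t : weight e t = weight 0 t + e * decay1 t by rewrite /weight mul0r addr0.
split; first by apply: eq_integ (integD i0 i1) => t.
under eq_Rint do rewrite wE.
rewrite (RintD i0 i1) (RintZl _ integ_inv1Dsqr).
have -> : \int[leb]_x (1 + x ^+ 2)^-1 = pi :> R.
  by apply: EFin_inj; rewrite -EFin_Rint ?integral_inv1Dsqr//; exact: integ_inv1Dsqr.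
by congr (_ + _); apply: EFin_inj; rewrite -EFin_Rint// -mixed_normE.
Qed.

(** This is the condition on [w] in [sum_int_coeff_le], for the real and the imaginary part alike,
    since each is dominated by the complex slice. *)
Lemma slice_norm_le_weight g e t : (g = fr \/ g = fi) -> 0 < e ->
  (\int[leb]_s ((Num.sqrt (\int[lebn]_u (g (u, t, s) ^+ 2))) `^ q)%:E <= (weight e t `^ q)%:E)%E.
Proof.
move=> gE e0.
have q20 : 0 <= q / 2 by rewrite divr_ge0// ltW.
apply: (@le_trans _ _ (\int[leb]_s (energy t s `^ (q / 2))%:E)%E).
  apply: ge0_le_integral_nomeas => [s _|s|s _]; rewrite ?lee_fin ?powR_ge0//.
  have g0 : 0 <= \int[lebn]_u (g (u, t, s) ^+ 2) by apply: Rint_ge0 => u; exact: sqr_ge0.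
  rewrite -powR12_sqrt// -powRrM [2^-1 * q]mulrC.
  by apply: ge0_ler_powR; rewrite ?nnegrE ?energy_ge0 ?sqr_le_energy.
rewrite (EFin_Rint (integ_energy_pow t)) lee_fin.
set N := \int[leb]_s _; have N0 : 0 <= N by apply: Rint_ge0 => s; exact: powR_ge0.
rewrite -[leLHS]powRr1// -(@mulVf _ q) ?gt_eqF// powRrM.
apply: ge0_ler_powR; rewrite ?nnegrE ?powR_ge0 ?(ltW (weight_gt0 _ _))// ?(ltW q0)//.
by rewrite lerDl mulr_ge0 ?(ltW e0)// ltW// decay1_gt0.
Qed.

End mixed_norm_weight.

Section surface_bound.
Context {R : realType} (n : nat).
Hypothesis n_gt0 : (0 < n)%N.
Notation mR := (measurableTypeR R).
Notation tR := (n.-tuple mR).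
Notation leb := (@lebesgue_measure R).
Notation lebn := (@lebesgue_tuple R n).
Notation lev := (@lev R n).
Variables (psi : R -> R) (P : R).
Hypotheses (mpsi : measurable_fun setT psi) (psi0 : forall x, 0 <= psi x)
  (psiP : forall x, psi x <= P * expR (- `|x|)).
Variables (q : R).
Hypothesis q12 : 1 <= q <= 2.
Variable f : hspace R n -> R[i].
Let fr (z : tR * mR * mR) : R := complex.Re (f (tuple_row z.1.1, z.1.2, z.2)).
Let fi (z : tR * mR * mR) : R := complex.Im (f (tuple_row z.1.1, z.1.2, z.2)).
Hypotheses (dr : decaying fr) (di : decaying fi).

Let g (j : bool) := if j then fr else fi.
Let dg j : decaying (g j). Proof. by case: j. Qed.
Let E (j : bool * bool) (a : multi_index n) (l : R) := (\int[leb]_t `|coeff (g j.1) j.2 a t l|%:E)%E.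
Let J j (a : multi_index n) l := (E j a l * E j a l * (psi (lev (size_mi a) * `|l|))%:E)%E.
Let js := [:: (true, true); (true, false); (false, true); (false, false)].

Let E0 j a l : (0 <= E j a l)%E.
Proof. by apply: integral_ge0 => t _; rewrite lee_fin. Qed.

Let J0 j a l : (0 <= J j a l)%E.
Proof. by rewrite !mule_ge0// lee_fin. Qed.

Let measurable_J j a : measurable_fun setT (J j a : mR -> \bar R).
Proof.
have [mg _] := dg j.1.
have mE : measurable_fun setT (E j a : mR -> \bar R).
  apply: (@measurable_fun_fubini_tonelli_G _ _ _ _ _ leb (fun p : mR * mR => `|coeff (g j.1) j.2 a p.1 p.2|%:E)) => //.
  apply/measurable_EFinP.
  exact: (measurableT_comp (@measurable_realfun.normr_measurable R setT) (measurable_coeff mg j.2 a)).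
apply: emeasurable_funM; first exact: emeasurable_funM.
apply/measurable_EFinP.
apply: (@measurableT_comp _ _ _ _ _ _ psi _ (fun l : mR => lev (size_mi a) * `|l| : mR)) => //.
apply: measurable_funM; first exact: measurable_cst.
exact: (@measurable_realfun.normr_measurable R setT).
Qed.

Let sum_js (S : bool * bool -> R) p : \sum_(j <- js) 8 * (S j ^+ 2 * p) =
  8 * (S (true, true) ^+ 2 + S (true, false) ^+ 2 + S (false, true) ^+ 2 +
    S (false, false) ^+ 2) * p.
Proof. by rewrite !big_cons big_nil; ring. Qed.

Let pointwise_le a l : l != 0 ->
  ((sqnorm (restriction f (a, l, level a l)))%:E * (psi (level a l))%:E <=
   \sum_(j <- js) (8%:E * J j a l))%E.
Proof.
move=> l0; have -> : restriction f (a, l, level a l) = hermite_fourier f (a, l, level a l).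
  by rewrite /restriction /patch mem_set//=.
have EE j : E j a l = (\int[leb]_t `|coeff (g j.1) j.2 a t l|)%:E.
  have [mg [M M0 gM]] := dg j.1.
  by rewrite /E -EFin_Rint//; apply: integ_norm; exact: (integ_coeff mg gM a l0).
have h := sqnorm_hermite_fourier_le a l0 dr di.
have JE j : J j a l = ((\int[leb]_t `|coeff (g j.1) j.2 a t l|) ^+ 2 * psi (lev (size_mi a) * `|l|))%:E.
  by rewrite /J EE -!EFinM -expr2.
under eq_bigr do rewrite JE -EFinM.
rewrite sumEFin -EFinM lee_fin.
have p0 := psi0 (level a l).
pose S (j : bool * bool) := \int[leb]_t `|coeff (g j.1) j.2 a t l|.
suff : sqnorm (hermite_fourier f (a, l, level a l)) * psi (level a l) <=
  \sum_(j <- js) 8 * (S j ^+ 2 * psi (level a l)) by [].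
rewrite sum_js; exact: (ler_wpM2r p0 h).
Qed.

(** There are four components, real or imaginary part with cosine or sine, and each brings the 8 of
    [sqnorm_hermite_fourier_le], hence 32. The parameter [e] stays free so that it can tend to 0. *)
Lemma surface_integral_le e m : 0 < e -> mixed_norm q f = m%:E ->
  (surface_integral psi (fun w => (sqnorm (restriction f w))%:E) <=
   (32 * (P * bessel_const n * (2 + 4 * pi)) * (m + e * pi) ^+ 2)%:E)%E.
Proof.
move=> e0 mE; have [iw We] := integral_weight dr di q12 e0 mE.
have sq0 z : 0 <= sqnorm z :> R by exact: sqr_ge0.
have m0 : 0 <= m.
  rewrite -lee_fin -mE (mixed_normE dr di q12); apply: integral_ge0 => t _.
  by rewrite lee_fin /weight mul0r addr0 powR_ge0.
(* The sum over all multi-indices is a supremum of finite sums, so a bound uniform in the finite set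
   suffices; this is why [bessel] and what follows use finite sequences. *)
apply: ge_ereal_sup => /= _ [X [finX _] <-]; rewrite fsbig_finite//=.
set s := finmap.enum_fset (fset_set X).
apply: (@le_trans _ _ (\sum_(a <- s) \sum_(j <- js) 8%:E * \int[leb]_l J j a l)%E).
  apply: lee_sum => a _.
  apply: (@le_trans _ _ (\int[leb]_l \sum_(j <- js) 8%:E * J j a l)%E).
    apply: ge0_le_integral_nomeas => [l _|l|l l0]; last exact: pointwise_le.
      by rewrite mule_ge0 ?lee_fin.
    by apply: sume_ge0 => j _; rewrite mule_ge0// lee_fin.
  rewrite ge0_integral_sum//; last 2 first.
  - by move=> j; apply: measurable_funeM; exact: measurable_J.
  - by move=> j l _; rewrite mule_ge0// lee_fin.
  by apply: lee_sum => j _; rewrite ge0_integralZl//; exact: measurable_J.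
rewrite exchange_big /=.
have key j : (\sum_(a <- s) 8%:E * \int[leb]_l J j a l <=
    (8 * (P * bessel_const n * (2 + 4 * pi) * (m + e * pi) ^+ 2))%:E)%E.
  rewrite -ge0_sume_distrr; last by move=> a _; apply: integral_ge0 => l _; exact: J0.
  rewrite EFinM; apply: lee_wpmul2l; first by rewrite lee_fin.
  have [mg [M M0 gM]] := dg j.1.
  have gE : g j.1 = fr \/ g j.1 = fi by rewrite /g; case: (j.1); [left|right].
  have W0 : 0 < \int[leb]_t weight f q e t.
    by rewrite We ltr_wpDl// mulr_gt0// pi_gt0.
  rewrite -We.
  apply: (sum_int_coeff_le n_gt0 mg _ _ _ _ _ mpsi psi0 psiP q12 _ iw W0).
  - by move=> t u; exact: (integ_s mg gM).
  - by move=> t s'; exact: (integ_u2 mg M0 gM).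
  - by move=> t; exact: (integ_u_sqr_int mg M0 gM).
  - exact: finmap.fset_uniq.
  - by move=> t; exact: weight_gt0.
  - by move=> t; exact: (slice_norm_le_weight dr di q12).
apply: (le_trans (lee_sum _ (fun j _ => key j))).
rewrite sumEFin lee_fin !big_cons big_nil.
by rewrite le_eqVlt; apply/orP; left; apply/eqP; ring.
Qed.

End surface_bound.

Theorem proposition7p2 (R : realType) (n : nat) (hn : (2 <= n)%N)
  (psi : R -> R)
  (psi_smooth : smooth psi)
  (psi_ge0 : forall x, 0 <= psi x)
  (psi_even : forall x, psi (- x) = psi x)
  (psi_supp : compact (closure [set x | psi x != 0]))
  (psi_le1 : ('N[lebesgue_measure]_+oo[EFin \o psi] <= 1)%E)
  (q : R) (hq : 1 <= q <= 2) :
  exists C : R, forall f : hspace R n -> R[i],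
    cschwartz f -> radial f ->
    (surface_L2norm psi (restriction f) <= C%:E * mixed_norm q f)%E.
Proof.
have n_gt0 : (0 < n)%N by exact: ltn_trans hn.
have cpsi : continuous psi by have [] := psi_smooth [::].
have mpsi : measurable_fun setT psi by exact: continuous_measurable_fun.
have [P psiP] := le_expRN_of_compact_supp cpsi psi_supp.
have P0 : 0 <= P by have := le_trans (psi_ge0 0) (psiP 0); rewrite pmulr_lge0 ?expR_gt0.
have C0 := ltW (bessel_const_gt0 (R := R) n_gt0).
set K : R := 32 * (P * bessel_const n * (2 + 4 * pi)).
have K0 : 0 <= K by rewrite !mulr_ge0// addr_ge0// mulr_ge0// pi_ge0.
have sK : 0 < Num.sqrt K + 1 by rewrite ltr_wpDl ?sqrtr_ge0.
(* The added 1 keeps the constant positive even if [K = 0]: its product with an infinite mixed norm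
   is then infinite, and it may be divided by in [e']. *)
exists (Num.sqrt K + 1) => f [sr si] _.
have dr := schwartz_decaying sr; have di := schwartz_decaying si.
have : (0 <= mixed_norm q f)%E.
  rewrite (mixed_normE dr di hq); apply: integral_ge0 => t _.
  by rewrite lee_fin /weight mul0r addr0 powR_ge0.
case mE: (mixed_norm q f) => [m||//]; last by move=> _; rewrite gt0_muley ?lte_fin// leey.
rewrite lee_fin => m0; apply/lee_addgt0Pr => e e0.
(* Chosen so that the constant times [e' * pi], the contribution of the added weight, is exactly
   [e]. *)
pose e' := e / ((Num.sqrt K + 1) * pi).
have e'0 : 0 < e' by rewrite divr_gt0// mulr_gt0// pi_gt0.
have h := surface_integral_le n_gt0 mpsi psi_ge0 psiP hq dr di e'0 mE.
have me0 : 0 <= m + e' * pi by rewrite addr_ge0// mulr_ge0 ?(ltW e'0)// pi_ge0.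
apply: (@le_trans _ _ ((K * (m + e' * pi) ^+ 2)%:E `^ 2^-1)%E).
  apply: gt0_ler_poweR => //; rewrite in_itv /= ?leey ?andbT//.
    apply: esum_ge0 => a _; apply: integral_ge0 => l _.
    by rewrite mule_ge0// lee_fin ?psi_ge0// sqr_ge0.
  by rewrite lee_fin mulr_ge0 ?sqr_ge0.
have k2 := mulr_ge0 K0 (sqr_ge0 (m + e' * pi)).
rewrite poweR_EFin (powR12_sqrt k2) (sqrtrM _ K0) sqrtr_sqr ger0_norm//.
rewrite -EFinM -EFinD lee_fin.
apply: (@le_trans _ _ ((Num.sqrt K + 1) * (m + e' * pi))).
  by rewrite ler_wpM2r// lerDl.
rewrite mulrDr lerD2l /e' le_eqVlt; apply/orP; left; apply/eqP.
have := pi_gt0 R; move: (pi : R) (Num.sqrt K + 1) sK => x y x0 y0.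
by field; rewrite !gt_eqF.
Qed.
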